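(* Let $0<p\le\frac12$. Suppose the collision kernel satisfies the Assumption stated in the context with $\eta\ge1+p$. Let $F_0\in\mathcal B_1^+(\mathbb R_{\ge0})$ with mass $N=N(F_0)$ and energy $E=E(F_0)$ satisfy $M_{-p}(F_0)<\infty$, and let $F_t$ be a conservative measure-valued isotropic solution on $[0,\infty)$ with initial datum $F_0$. Then $M_{-p}(F_t)<\infty$ for all $t>0$; more precisely $$M_{-p}(F_t)\le(at+M_{-p}(F_0))e^{bt}\qquad\forall\,t\ge0,$$ where $a=8^2b_0^2N^{\frac32+p}E^{\frac12-p}+8^{2+\eta}b_0^2N^3$ and $b=8^{3+\eta}b_0^2N^2(1+q_1)$.
   Context: Notation. $\mathcal B_1^+(\mathbb R_{\ge0})$: nonnegative Borel measures $F$ on $[0,\infty)$ with $\int(1+x)dF<\infty$. $M_q(F)=\int x^q\,dF(x)$ for $q\in\mathbb R$ (with $0^q=\infty$ for $q<0$, $\infty\cdot0=0$); $N=M_0$, $E=M_1$. $C^{1,1}_b(\mathbb R_{\ge0})$: $C^1_b$ functions with Lipschitz derivative. Kernel. $\hat\phi:[0,\infty)\to\mathbb R$ continuous bounded, $\Phi(r,\rho)=(\hat\phi(r)+\hat\phi(\rho))^2$, $x_*=(y+z-x)_+$. If $x_*xyz>0$, $W(x,y,z)=\frac{1}{4\pi\sqrt{xyz}}\int_{|\sqrt x-\sqrt y|\vee|\sqrt{x_*}-\sqrt z|}^{(\sqrt x+\sqrt y)\wedge(\sqrt{x_*}+\sqrt z)}ds\int_0^{2\pi}\Phi(\sqrt2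 s,\sqrt2 Y_* )d\theta$ with $Y_*=\big|\sqrt{(z-\frac{(x-y+s^2)^2}{4s^2})_+}+e^{i\theta}\sqrt{(x-\frac{(x-y+s^2)^2}{4s^2})_+}\big|$ ($s>0$), $Y_*=0$ ($s=0$). Otherwise $W(0,y,z)=\Phi(\sqrt{2y},\sqrt{2z})/\sqrt{yz}$ ($y,z>0$), $W(x,0,z)=\Phi(\sqrt{2x},\sqrt{2(z-x)})/\sqrt{xz}$ ($z>x>0$), $W(x,y,0)=\Phi(\sqrt{2(y-x)},\sqrt{2x})/\sqrt{xy}$ ($y>x>0$), $W=0$ otherwise. $\mathcal K[\varphi]=W(\varphi(x)+\varphi(x_* )-\varphi(y)-\varphi(z))$, $\mathcal J[\varphi](y,z)=\frac12\int_0^{y+z}\mathcal K[\varphi](x,y,z)\sqrt x\,dx$. Solutions. $\{F_t\}_{t\ge0}\subset\mathcal B_1^+$ is a conservative measure-valued isotropic solution with initial datum $F_0$ if $N(F_t),E(F_t)$ are constant, $t\mapsto\int\varphi\,dF_t\in C^1([0,\infty))$ for all $\varphi\in C^{1,1}_b$, and $\frac{d}{dt}\int\varphi\,dF_t=\int\mathcal J[\varphi]\,d(F_t\otimes F_t)+\int\mathcal K[\varphi]\,d(F_t\otimes F_t\otimes F_t)$ for all $t\ge0$. Assumption. $\hat\phi$ continuous on $[0,\infty)$; constants $b_0>0,\eta\ge1$ with $0\le\hat\phi(r)\le b_0\frac{r^\eta}{1+r^\eta}$ for all $r\ge0$; there is $k\in C^1([1,\sqrt2])$, $k(1)=1$,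 with $\hat\phi(ar)\le k(a)\hat\phi(r)$ for all $r>0$, $1<a\le\sqrt2$. $q_1=\max_{x\in[1,\sqrt2]}\max\{2k(x)k'(x),0\}$. *)

(* Defs.v *)
From mathcomp Require Import all_boot all_order all_algebra.
From mathcomp Require Import all_classical all_reals all_analysis.
Import Order.TTheory GRing.Theory Num.Theory numFieldNormedType.Exports.

Set Implicit Arguments.
Unset Strict Implicit.
Unset Printing Implicit Defensive.

Local Open Scope classical_set_scope.
Local Open Scope ring_scope.

Section Defs.
Variable R : realType.

Definition Rge0 : set R := `[0, +oo[.

Definition pos_part (x : R) : R := Num.max x 0.

Definition xstar (x y z : R) : R := pos_part (y + z - x).

Definition Phi (phi : R -> R) (r rho : R) : R := (phi r + phi rho) ^+ 2.

(* Y_* = | sqrt((z - c)_+) + e^{i theta} sqrt((x - c)_+) |,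
   c = (x - y + s^2)^2/(4 s^2), for s > 0 ; Y_* = 0 for s = 0.
   The complex modulus |u + e^{i th} v| is written out as
   sqrt((u + v cos th)^2 + (v sin th)^2). *)
Definition Ystar (x y z s theta : R) : R :=
  if s == 0 then 0 else
  let c := (x - y + s ^+ 2) ^+ 2 / (4 * s ^+ 2) in
  let u := Num.sqrt (pos_part (z - c)) in
  let v := Num.sqrt (pos_part (x - c)) in
  Num.sqrt ((u + v * cos theta) ^+ 2 + (v * sin theta) ^+ 2).

Notation leb := (@lebesgue_measure R).

Definition W (phi : R -> R) (x y z : R) : R :=
  let xs := xstar x y z in
  if 0 < xs * x * y * z then
    (4 * pi * Num.sqrt (x * y * z))^-1 *
    Rintegral leb
      `[Num.max `|Num.sqrt x - Num.sqrt y| `|Num.sqrt xs - Num.sqrt z|,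
        Num.min (Num.sqrt x + Num.sqrt y) (Num.sqrt xs + Num.sqrt z)]
      (fun s => Rintegral leb `[0, 2 * pi]
         (fun th => Phi phi (Num.sqrt 2 * s) (Num.sqrt 2 * Ystar x y z s th)))
  else if [&& x == 0, 0 < y & 0 < z] then
    Phi phi (Num.sqrt (2 * y)) (Num.sqrt (2 * z)) / Num.sqrt (y * z)
  else if [&& y == 0, 0 < x & x < z] then
    Phi phi (Num.sqrt (2 * x)) (Num.sqrt (2 * (z - x))) / Num.sqrt (x * z)
  else if [&& z == 0, 0 < x & x < y] then
    Phi phi (Num.sqrt (2 * (y - x))) (Num.sqrt (2 * x)) / Num.sqrt (x * y)
  else 0.

Definition Kop (phi f : R -> R) (x y z : R) : R :=
  W phi x y z * (f x + f (xstar x y z) - f y - f z).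

Definition Jop (phi f : R -> R) (y z : R) : R :=
  2^-1 * Rintegral leb `[0, y + z] (fun x => Kop phi f x y z * Num.sqrt x).

(* x^q with the convention 0^q = +oo for q < 0 (and 0^0 = 1, 0^q = 0, q > 0) *)
Definition powq (q x : R) : \bar R :=
  if (x == 0) && (q < 0) then +oo%E else (x `^ q)%:E.

Definition Mq (q : R) (F : {measure set R -> \bar R}) : \bar R :=
  (\int[F]_(x in Rge0) powq q x)%E.

Definition Nmass (F : {measure set R -> \bar R}) : \bar R := Mq 0 F.
Definition Energy (F : {measure set R -> \bar R}) : \bar R := Mq 1 F.

Definition B1plus (F : {measure set R -> \bar R}) : Prop :=
  F `]-oo, 0[%classic = 0%E /\ (\int[F]_(x in Rge0) (1 + x)%:E < +oo)%E.

Definition deriv_within (A : set R) (g : R -> R) (x l : R) : Prop :=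
  (fun y => (g y - g x) / (y - x)) @ within (A `\ x) (nbhs x) --> l.

Definition C11b (f : R -> R) : Prop :=
  exists df : R -> R,
    (forall x, 0 <= x -> deriv_within Rge0 f x (df x)) /\
    (exists M, forall x, 0 <= x -> `|f x| <= M) /\
    (exists M, forall x, 0 <= x -> `|df x| <= M) /\
    (exists L, forall x y, 0 <= x -> 0 <= y -> `|df x - df y| <= L * `|x - y|).

Definition is_solution (phi : R -> R)
    (F : R -> {finite_measure set R -> \bar R}) : Prop :=
  (forall t, 0 <= t -> B1plus (F t)) /\
  (forall t, 0 <= t -> Nmass (F t) = Nmass (F 0) /\ Energy (F t) = Energy (F 0)) /\
  (forall f, C11b f ->
     let g := fun t => Rintegral (F t) Rge0 f in
     let h := fun t =>
       Rintegral ((F t) \x (F t))%E (Rge0 `*` Rge0)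
                 (fun yz => Jop phi f yz.1 yz.2) +
       Rintegral (((F t) \x (F t)) \x (F t))%E ((Rge0 `*` Rge0) `*` Rge0)
                 (fun xyz => Kop phi f xyz.1.1 xyz.1.2 xyz.2) in
     (forall t, 0 <= t -> deriv_within Rge0 g t (h t)) /\
     {within Rge0, continuous h}).

Definition kernel_assumption (phi : R -> R) (b0 eta : R) (k dk : R -> R) : Prop :=
  {within Rge0, continuous phi} /\
  (exists M, forall r, 0 <= r -> `|phi r| <= M) /\
  0 < b0 /\ 1 <= eta /\
  (forall r, 0 <= r -> 0 <= phi r <= b0 * (r `^ eta / (1 + r `^ eta))) /\
  (forall x, x \in `[1, Num.sqrt 2] -> deriv_within `[1, Num.sqrt 2] k x (dk x)) /\
  {within `[1, Num.sqrt 2], continuous dk} /\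
  k 1 = 1 /\
  (forall r a, 0 < r -> 1 < a <= Num.sqrt 2 -> phi (a * r) <= k a * phi r).

Definition q1 (k dk : R -> R) : R :=
  sup [set Num.max (2 * k x * dk x) 0 | x in `[1, Num.sqrt 2]].

End Defs.

(* Main.v *)
(* The test functions f(x) = (x + e)^(-p) are nonnegative, nonincreasing and
   convex, and sqrt x * f x is nondecreasing because p <= 1/2.  The quadratic
   term is bounded by W sqrt x <= 8 b0^2 / sqrt (y + z) and the interpolation
   M_(1/2-p) <= N^(1/2+p) E^(1/2-p).  The cubic term is symmetrized over the six
   permutations of energies a <= b <= c: values with b in first position are
   nonpositive by convexity, those with c in first position are controlled by
   the monotonicity of sqrt x * f x, and those with a in first position are
   harmless unless c >= 16 b.  In that case (a,b,c) is paired with (b,a,c) and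
   (a,c,b) with (b,c,a); the kernels of a pair differ by O(b0^2 (1 + q1)),
   because phi (r t) <= (1 + q1 (t - 1)) phi r for 1 <= t <= sqrt 2.  This gives
   d/dt int f dF_t <= a + b int f dF_t; Gronwall's lemma and monotone
   convergence as e -> 0 conclude. *)

Require Import Defs.
From HB Require Import structures.
From mathcomp Require Import all_boot all_order all_algebra.
From mathcomp Require Import all_classical all_reals all_analysis.
From mathcomp Require Import measurable_realfun ring lra.
Import Order.TTheory GRing.Theory Num.Theory numFieldNormedType.Exports.
Set Implicit Arguments.
Unset Strict Implicit.
Unset Printing Implicit Defensive.
Local Open Scope classical_set_scope.
Local Open Scope ring_scope.

(** * Integrals of functions not assumed measurable *)

Section IntegralBounds.

(** The kernel is unbounded: for energies al^2 <= be^2 <= ga^2 with al^2 in first position, [W] is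
    only controlled by a multiple of b0^2 ga / be, so a disparate triple cannot be estimated value
    by value. In a pair, f a - f b is multiplied by [W] at the first triple and by minus [W] at the
    second. Besides the kernel difference there remains an increment of f near c; convexity bounds
    it by 2 b / c times f a, and this factor beats ga / be. The threshold ga >= 4 be also keeps the
    relevant ratios of arguments of [phi] below sqrt 2, the range where its growth is controlled. At
    (a, c, b) and (b, c, a) the ranges of s differ, hence the change of variable to a projection h
    with common range [-al, al]. The definition of a solution does not say that the collision
    integrals converge, so they are bounded as total integrals, whose value is 0 when the extended
    integral is infinite. *)

Lemma ge0_le_integral_nomeas d (T : measurableType d) (R : realType)
    (mu : {measure set T -> \bar R}) (D : set T) (f g : T -> \bar R) :
  (forall x, D x -> 0 <= f x)%E -> (forall x, D x -> f x <= g x)%E ->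
  (\int[mu]_(x in D) f x <= \int[mu]_(x in D) g x)%E.
Proof.
move=> f0 fg.
have g0 x : D x -> (0 <= g x)%E by move=> Dx; exact: le_trans (f0 _ Dx) (fg _ Dx).
(* A nonnegative integrand is integrated as a supremum over the simple functions below it, and a
   larger integrand admits more of them. *)
rewrite !ge0_integralE//; apply: le_ereal_sup => _ [h hf <-].
by exists h => // x; apply: (le_trans (hf x)); apply: lee_restrict.
Qed.

(* The integral of an arbitrary function is a difference of two suprema, and
   [fine] sends both infinities to [0]. *)
Lemma le_Rintegral_nomeas d (T : measurableType d) (R : realType)
    (mu : {measure set T -> \bar R}) (D : set T) (f g : T -> R) :
  (forall x, D x -> 0 <= g x) -> (forall x, D x -> f x <= g x) ->
  (\int[mu]_(x in D) (g x)%:E < +oo)%E ->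
  \int[mu]_(x in D) f x <= \int[mu]_(x in D) g x.
Proof.
move=> g0 fg goo; rewrite /Rintegral.
have G0 : (0 <= \int[mu]_(x in D) (g x)%:E)%E.
  by apply: integral_ge0 => x Dx; rewrite lee_fin g0.
have : (\int[mu]_(x in D) (f x)%:E <= \int[mu]_(x in D) (g x)%:E)%E.
  rewrite integralE.
  apply: (@le_trans _ _ (\int[mu]_(x in D) (fun x => (f x)%:E)^\+ x)%E).
    by rewrite geeDl// oppe_le0 integral_ge0.
  apply: ge0_le_integral_nomeas => x Dx //.
  by rewrite funeposE ge_max !lee_fin fg//= g0.
case: (integral mu D (fun x => (f x)%:E)) => [r| |] rg /=; last 2 first.
- exact: fine_ge0.
- exact: fine_ge0.
by rewrite -lee_fin fineK// ge0_fin_numE.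
Qed.

(** Asking only [h - l <= m] admits [h < l], so callers need not know that the range of s is
    nonempty. *)
Lemma Rintegral_itv_le (R : realType) (l h m M : R) (f : R -> R) :
  0 <= m -> 0 <= M -> h - l <= m ->
  (forall s, l <= s <= h -> f s <= M) ->
  \int[lebesgue_measure]_(s in `[l, h]) f s <= M * m.
Proof.
move=> m0 M0 hlm fM.
have mI : measurable (`[l, h]%classic : set R) by exact: measurable_itv.
have E : (\int[lebesgue_measure]_(s in `[l, h]) M%:E =
          M%:E * lebesgue_measure (`[l, h] : set R)%classic)%E.
  by rewrite integral_cst.
apply: (@le_trans _ _ (\int[lebesgue_measure]_(s in `[l, h]) M)).
  apply: le_Rintegral_nomeas => [//|s /=|]; first by rewrite in_itv/= => /fM.
  rewrite E lebesgue_measure_itv/=; case: ifP => _; last by rewrite mule0 ltry.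
  by rewrite -EFinD -EFinM ltry.
rewrite /Rintegral E lebesgue_measure_itv/=; case: ifP => _ /=.
  by rewrite ler_wpM2l.
by rewrite mulr0 mulr_ge0.
Qed.

End IntegralBounds.

(** * Pointwise bounds on the collision kernel *)

Section Modulus.
Variable R : realType.
Implicit Types u v x y z s th : R.

Lemma ler_of_sqr x y : 0 <= y -> x ^+ 2 <= y ^+ 2 -> x <= y.
Proof. by move=> y0 xy; rewrite leNgt; apply/negP => yx; nra. Qed.

Lemma sqrt_le_sqr x y : 0 <= y -> x <= y ^+ 2 -> Num.sqrt x <= y.
Proof.
move=> y0 xy; apply: ler_of_sqr => //; have [x0|x0] := leP 0 x.
  by rewrite sqr_sqrtr.
by rewrite (ler0_sqrtr (ltW x0)) expr0n/= sqr_ge0.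
Qed.

Lemma pos_part_le x y : 0 <= y -> x <= y -> pos_part x <= y.
Proof. by move=> y0 xy; rewrite /pos_part ge_max xy y0. Qed.

Lemma ge0_pos_part x : 0 <= x -> pos_part x = x.
Proof. by move=> x0; rewrite /pos_part; apply/max_idPl. Qed.

(** The modulus of u + v e^{i th}, separated from [Ystar] so that u and v can vary independently. *)
Definition Ymod u v th : R :=
  Num.sqrt ((u + v * cos th) ^+ 2 + (v * sin th) ^+ 2).

Lemma Ymod_ge0 u v th : 0 <= Ymod u v th.
Proof. exact: sqrtr_ge0. Qed.

Lemma Ymod_sqr u v th :
  Ymod u v th ^+ 2 = u ^+ 2 + v ^+ 2 + 2 * u * v * cos th.
Proof.
rewrite sqr_sqrtr; last by rewrite addr_ge0// sqr_ge0.
transitivity (u ^+ 2 + v ^+ 2 * (cos th ^+ 2 + sin th ^+ 2) + 2 * u * v * cos th).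
  by ring.
by rewrite cos2Dsin2 mulr1.
Qed.

Lemma YmodC u v th : Ymod u v th = Ymod v u th.
Proof.
apply/eqP; rewrite -(@eqrXn2 _ 2) ?Ymod_ge0//.
by apply/eqP; rewrite !Ymod_sqr; ring.
Qed.

Lemma Ymod_le u v th : 0 <= u -> 0 <= v -> Ymod u v th <= u + v.
Proof.
move=> u0 v0; apply: ler_of_sqr; first by rewrite addr_ge0.
rewrite Ymod_sqr; have := cos_le1 th; have : 0 <= u * v by rewrite mulr_ge0.
nra.
Qed.

Lemma Ymod_ge u v th : 0 <= u -> 0 <= v -> u - v <= Ymod u v th.
Proof.
move=> u0 v0; apply: ler_of_sqr; first exact: Ymod_ge0.
rewrite Ymod_sqr; have := cos_geN1 th; have : 0 <= u * v by rewrite mulr_ge0.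
nra.
Qed.

(** Triangle inequality for two complex numbers that differ by the real number u - u'. Once squared,
    it reduces to the fact that a real part is at most the modulus. *)
Lemma Ymod_lip u u' v th : u' <= u -> Ymod u v th - Ymod u' v th <= u - u'.
Proof.
move=> uu'; rewrite lerBlDl; apply: ler_of_sqr.
  by rewrite addr_ge0 ?Ymod_ge0// subr_ge0.
have H : u' + v * cos th <= Ymod u' v th.
  apply: ler_of_sqr; first exact: Ymod_ge0.
  rewrite sqr_sqrtr; last by rewrite addr_ge0// sqr_ge0.
  by rewrite lerDl sqr_ge0.
have := Ymod_sqr u v th; have := Ymod_sqr u' v th.
nra.
Qed.

(** The squares differ by (u - u') (u + u' + 2 v cos th), and v <= u' <= u keeps the second factor
    nonnegative even for cos th = -1. *)
Lemma Ymod_mono u u' v th : 0 <= v <= u' -> u' <= u -> Ymod u' v th <= Ymod u v th.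
Proof.
move=> /andP[v0 vu] uu; apply: ler_of_sqr; first exact: Ymod_ge0.
rewrite !Ymod_sqr; have := cos_geN1 th; have := cos_le1 th.
move=> c1 c2.
have : 0 <= (u - u') * (u + u' + 2 * v * cos th).
  by rewrite mulr_ge0//; nra.
nra.
Qed.

(** The square of the signed projection (x - y + s^2) / (2 s), the quantity subtracted from z and x
    under the roots of [Ystar]. *)
Definition csq x y s : R := (x - y + s ^+ 2) ^+ 2 / (4 * s ^+ 2).

Definition Yreg x y z s th : R :=
  Ymod (Num.sqrt (pos_part (z - csq x y s))) (Num.sqrt (pos_part (x - csq x y s))) th.

Lemma YstarE x y z s th : s != 0 -> Ystar x y z s th = Yreg x y z s th.
Proof. by rewrite /Ystar => /negbTE->. Qed.

Lemma csq_ge0 x y s : 0 <= csq x y s.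
Proof. by rewrite /csq divr_ge0 ?sqr_ge0// mulr_ge0// sqr_ge0. Qed.

Lemma Ystar_ge0 x y z s th : 0 <= Ystar x y z s th.
Proof. by rewrite /Ystar; case: ifP => // _; exact: sqrtr_ge0. Qed.

Lemma Ystar_le x y z s th c : 0 <= c -> x <= c ^+ 2 -> z <= c ^+ 2 ->
  Ystar x y z s th <= 2 * c.
Proof.
move=> c0 xc zc; have [->|s0] := eqVneq s 0.
  by rewrite /Ystar eqxx mulr_ge0.
rewrite YstarE// /Yreg; apply: (le_trans (Ymod_le _ (sqrtr_ge0 _) (sqrtr_ge0 _))).
have H w : w <= c ^+ 2 -> Num.sqrt (pos_part (w - csq x y s)) <= c.
  move=> wc; apply: sqrt_le_sqr => //; apply: pos_part_le; first exact: sqr_ge0.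
  by have := csq_ge0 x y s; lra.
by have := H _ xc; have := H _ zc; lra.
Qed.

End Modulus.

(* The bound b0 r^eta / (1 + r^eta) is only used through b0 min(1, r). *)
Record kernel_bounds (R : realType) (phi : R -> R) (b0 q : R) : Prop := {
  kb_cont : continuous phi;
  kb_b0 : 0 <= b0;
  kb_q : 0 <= q;
  kb_ge0 : forall r, 0 <= phi r;
  kb_le : forall r, phi r <= b0;
  kb_ler : forall r, 0 <= r -> phi r <= b0 * r;
  kb_k : forall r al, 0 < r -> 1 <= al <= Num.sqrt 2 ->
    phi (al * r) <= (1 + q * (al - 1)) * phi r }.

Section Kernel.
Variables (R : realType) (phi : R -> R) (b0 q : R).
Hypothesis kb : kernel_bounds phi b0 q.
Let b0_ge0 := kb_b0 kb.
Let q_ge0 := kb_q kb.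
Let phi_ge0 := kb_ge0 kb.
Let phi_le := kb_le kb.
Let phi_ler := kb_ler kb.
Let phi_k := kb_k kb.
Implicit Types x y z s r rho th : R.

Local Notation leb := (@lebesgue_measure R).

Lemma Phi_ge0 r rho : 0 <= Phi phi r rho.
Proof. exact: sqr_ge0. Qed.

Lemma Phi_le r rho : Phi phi r rho <= 4 * b0 ^+ 2.
Proof.
rewrite /Phi; have := phi_ge0 r; have := phi_ge0 rho.
by have := phi_le r; have := phi_le rho; nra.
Qed.

Lemma PhiC r rho : Phi phi r rho = Phi phi rho r.
Proof. by rewrite /Phi addrC. Qed.

Lemma Phi_le_sqr r rho : 0 <= r -> 0 <= rho ->
  Phi phi r rho <= b0 ^+ 2 * (r + rho) ^+ 2.
Proof.
move=> r0 rho0; rewrite -exprMn ler_sqr ?nnegrE ?addr_ge0 ?mulr_ge0 ?addr_ge0//.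
by have := phi_ler r0; have := phi_ler rho0; nra.
Qed.

(** A one-sided Lipschitz bound. The growth condition at the ratio rho / rho' gives phi rho - phi
    rho' <= q (rho / rho' - 1) phi rho', and phi rho' <= b0 rho' cancels the denominator; the
    difference of the two squares supplies the other factor. *)
Lemma Phi_sub r rho rho' : 0 <= r -> 0 < rho' -> rho' <= rho ->
  rho <= Num.sqrt 2 * rho' ->
  Phi phi r rho - Phi phi r rho' <=
    q * b0 ^+ 2 * ((rho - rho') * (2 * r + rho + rho')).
Proof.
move=> r0 rho'0 le1 le2.
have rho0 : 0 <= rho by apply: le_trans le1; exact: ltW.
have al1 : 1 <= rho / rho' <= Num.sqrt 2.
  by rewrite ler_pdivlMr// mul1r le1/= ler_pdivrMr.
have := phi_k rho'0 al1.
rewrite divfK ?gt_eqF// => H.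
have {}H : phi rho - phi rho' <= q * b0 * (rho - rho').
  have -> : rho - rho' = (rho / rho' - 1) * rho' by rewrite mulrBl mul1r divfK ?gt_eqF.
  case/andP: al1 => al1 _.
  have h : 0 <= q * (rho / rho' - 1) by rewrite mulr_ge0// subr_ge0.
  have := ler_wpM2l h (phi_ler (ltW rho'0)); lra.
have E : Phi phi r rho - Phi phi r rho' =
  (phi rho - phi rho') * (2 * phi r + phi rho + phi rho') by rewrite /Phi; ring.
rewrite E.
have S0 : 0 <= 2 * phi r + phi rho + phi rho'.
  by have := phi_ge0 r; have := phi_ge0 rho; have := phi_ge0 rho'; lra.
have S1 : 2 * phi r + phi rho + phi rho' <= b0 * (2 * r + rho + rho').
  by have := phi_ler r0; have := phi_ler rho0; have := phi_ler (ltW rho'0); lra.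
have h : 0 <= q * b0 * (rho - rho') by rewrite !mulr_ge0// subr_ge0.
have := ler_wpM2r S0 H; have := ler_wpM2l h S1; lra.
Qed.

Definition thint x y z s : R :=
  \int[leb]_(th in `[0, 2 * pi]) Phi phi (Num.sqrt 2 * s) (Num.sqrt 2 * Ystar x y z s th).

Definition slo x y z : R := Num.max `|Num.sqrt x - Num.sqrt y|
  `|Num.sqrt (xstar x y z) - Num.sqrt z|.
Definition shi x y z : R := Num.min (Num.sqrt x + Num.sqrt y)
  (Num.sqrt (xstar x y z) + Num.sqrt z).

Lemma W_posE x y z : 0 < xstar x y z * x * y * z ->
  W phi x y z = (4 * pi * Num.sqrt (x * y * z))^-1 *
    \int[leb]_(s in `[slo x y z, shi x y z]) thint x y z s.
Proof. by rewrite /W => ->. Qed.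

Lemma thint_ge0 x y z s : 0 <= thint x y z s.
Proof. by apply: Rintegral_ge0 => th _; exact: Phi_ge0. Qed.

Lemma W_ge0 x y z : 0 <= W phi x y z.
Proof.
rewrite /W; case: ifP => _.
  rewrite mulr_ge0// ?invr_ge0 ?mulr_ge0 ?sqrtr_ge0 ?pi_ge0//.
  by apply: Rintegral_ge0 => s _; exact: thint_ge0.
by do 3! [case: ifP => _; first by rewrite divr_ge0 ?Phi_ge0 ?sqrtr_ge0].
Qed.

Lemma slo_ge0 x y z : 0 <= slo x y z.
Proof. by rewrite /slo le_max normr_ge0. Qed.

(** For each of the two pairs of roots u + v - |u - v| = 2 min(u, v), and the intersection of two
    intervals is no longer than either of them. *)
Lemma shi_slo x y z : shi x y z - slo x y z <=
  2 * Num.min (Num.min (Num.sqrt x) (Num.sqrt y))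
              (Num.min (Num.sqrt (xstar x y z)) (Num.sqrt z)).
Proof.
rewrite /shi /slo.
have H (u v : R) : u + v - `|u - v| <= 2 * Num.min u v.
  by case: (leP u v) => uv; [rewrite ler0_norm|rewrite gtr0_norm]; lra.
set a := Num.sqrt x; set b := Num.sqrt y; set c := Num.sqrt (xstar x y z).
set d := Num.sqrt z; have := H a b; have := H c d.
move: `|a - b| `|c - d| (Num.min a b) (Num.min c d) => A B C D h1 h2.
by case: (leP (a + b)); case: (leP A B); case: (leP C D); lra.
Qed.

(** The lengths 2 m of the range of s and 2 pi of the range of th cancel the factor 4 pi in the
    prefactor. *)
Lemma W_pos_le x y z m M : 0 < xstar x y z * x * y * z ->
  0 <= m -> 0 <= M -> shi x y z - slo x y z <= 2 * m ->
  (forall s th, 0 <= s <= Num.sqrt x + Num.sqrt y ->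
    Phi phi (Num.sqrt 2 * s) (Num.sqrt 2 * Ystar x y z s th) <= M) ->
  W phi x y z <= m * M / Num.sqrt (x * y * z).
Proof.
move=> P m0 M0 hm HM; rewrite W_posE//.
have pi0 : (0 : R) < pi by exact: pi_gt0.
have M2 : 0 <= M * (2 * pi) by rewrite mulr_ge0// mulr_ge0// ltW.
have H : \int[leb]_(s in `[slo x y z, shi x y z]) thint x y z s <=
    M * (2 * pi) * (2 * m).
  apply: Rintegral_itv_le => //; first by rewrite mulr_ge0.
  move=> s /andP[s1 s2]; apply: Rintegral_itv_le => //.
  - by rewrite mulr_ge0// ltW.
  - by rewrite subr0.
  move=> th _; apply: HM; rewrite (le_trans (slo_ge0 x y z) s1)/=.
  by apply: (le_trans s2); rewrite /shi ge_min lexx.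
have S : 0 <= (4 * pi * Num.sqrt (x * y * z))^-1.
  by rewrite invr_ge0 !mulr_ge0 ?sqrtr_ge0// ltW.
apply: (le_trans (ler_wpM2l S H)).
have -> : m * M / Num.sqrt (x * y * z) =
  (4 * pi * Num.sqrt (x * y * z))^-1 * (M * (2 * pi) * (2 * m)) => //.
by rewrite invfM; move: (Num.sqrt _)^-1 (@pi R) pi0 => w t t0; field; rewrite gt_eqF.
Qed.

End Kernel.

(** * Continuity and integrability of the angular integral *)

Section KernelContinuity.
Variables (R : realType) (phi : R -> R) (b0 q : R).
Hypothesis kb : kernel_bounds phi b0 q.
Implicit Types x y z s r rho th : R.

Local Notation leb := (@lebesgue_measure R).

(** All five ingredients depend on the same variable, so that one statement serves continuity in th,
    where only c and d vary, and in s, where r, u and v do. *)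
Lemma continuous_Phi_modulus (r u v c d : R -> R) (t : R) :
  {for t, continuous r} -> {for t, continuous u} -> {for t, continuous v} ->
  {for t, continuous c} -> {for t, continuous d} ->
  {for t, continuous (fun t => Phi phi (Num.sqrt 2 * r t)
    (Num.sqrt 2 * Num.sqrt ((u t + v t * c t) ^+ 2 + (v t * d t) ^+ 2)))}.
Proof.
move=> cr cu cv cc cd.
have cphi (g : R -> R) : {for t, continuous g} -> {for t, continuous (fun t => phi (g t))}.
  by move=> cg; apply: (@continuous_comp _ _ _ g phi) => //; exact: (kb_cont kb).
have csq (g : R -> R) : {for t, continuous g} -> {for t, continuous (fun t => g t ^+ 2)}.
  by move=> cg; apply: (@continuous_comp _ _ _ g (fun x => x ^+ 2)) => //; exact: exprn_continuous.
apply: (csq (fun t => phi _ + phi _)); apply: cvgD.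
  by apply: cphi; apply: cvgM => //; exact: cvg_cst.
apply: cphi; apply: cvgM; first exact: cvg_cst.
apply: (@continuous_comp _ _ _ (fun t => (u t + v t * c t) ^+ 2 + (v t * d t) ^+ 2) Num.sqrt).
  apply: cvgD.
    by apply: (csq (fun t => u t + v t * c t)); apply: cvgD => //; exact: cvgM.
  by apply: (csq (fun t => v t * d t)); exact: cvgM.
exact: sqrt_continuous.
Qed.

Lemma continuous_sqrt_pos_part (g : R -> R) (t : R) :
  {for t, continuous g} -> {for t, continuous (fun t => Num.sqrt (pos_part (g t)))}.
Proof.
move=> cg; apply: (@continuous_comp _ _ _ (fun t => pos_part (g t)) Num.sqrt).
  by apply: (@continuous_max _ _ g (fun=> 0)) => //; exact: cvg_cst.
exact: sqrt_continuous.
Qed.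

Lemma continuous_csq x y s : s != 0 -> {for s, continuous (csq x y)}.
Proof.
move=> s0; rewrite /csq.
have e : {for s, continuous (fun s => s ^+ 2)} by exact: exprn_continuous.
apply: cvgM.
  apply: (@continuous_comp _ _ _ (fun s => x - y + s ^+ 2) (fun x => x ^+ 2)).
    by apply: cvgD => //; exact: cvg_cst.
  exact: exprn_continuous.
apply: cvgV; first by rewrite mulf_neq0// expf_neq0.
by apply: cvgM => //; exact: cvg_cst.
Qed.

Lemma integrable_th (u v r : R) :
  leb.-integrable `[0, 2 * pi]
    (EFin \o (fun th => Phi phi (Num.sqrt 2 * r) (Num.sqrt 2 * Ymod u v th))).
Proof.
apply: continuous_compact_integrable; first exact: segment_compact.
apply: continuous_subspaceT => th.
apply: (@continuous_Phi_modulus (fun=> r) (fun=> u) (fun=> v) cos sin).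
- exact: cvg_cst.
- exact: cvg_cst.
- exact: cvg_cst.
- exact: continuous_cos.
- exact: continuous_sin.
Qed.

Lemma integrable_Ystar x y z s : s != 0 ->
  leb.-integrable `[0, 2 * pi]
    (EFin \o (fun th => Phi phi (Num.sqrt 2 * s) (Num.sqrt 2 * Ystar x y z s th))).
Proof.
move=> s0.
rewrite (_ : (fun th => Phi phi _ _) =
  (fun th => Phi phi (Num.sqrt 2 * s) (Num.sqrt 2 * Yreg x y z s th))).
  exact: integrable_th.
by apply/funext => th; rewrite YstarE.
Qed.

Lemma thint_Ymod x y z s : s != 0 -> thint phi x y z s =
  \int[leb]_(th in `[0, 2 * pi]) Phi phi (Num.sqrt 2 * s) (Num.sqrt 2 * Yreg x y z s th).
Proof. by move=> s0; apply: eq_Rintegral => th _; rewrite YstarE. Qed.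

(** Dominated convergence with the constant bound 4 b0^2 on ]0, s + 1[, an interval that avoids the
    singularity of [csq] at 0. *)
Lemma continuous_thint x y z s : 0 < s -> {for s, continuous (thint phi x y z)}.
Proof.
move=> s0.
pose f s th := Phi phi (Num.sqrt 2 * s) (Num.sqrt 2 * Yreg x y z s th).
have cf : {for s, continuous (fun s => \int[leb]_(th in `[0, 2 * pi]) f s th)}.
  apply: (@continuity_under_integral _ _ _ leb f `[0, 2 * pi]%classic _ 0 (s + 1) _ _
    (fun=> 4 * b0 ^+ 2)).
  - exact: measurable_itv.
  - by move=> t _; exact: integrable_th.
  - apply/aeW => th _ t; rewrite inE/= in_itv/= => /andP[t0 _].
    apply: (@continuous_Phi_modulus id (fun s => Num.sqrt (pos_part (z - csq x y s)))
      (fun s => Num.sqrt (pos_part (x - csq x y s))) (fun=> cos th) (fun=> sin th)).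
    + exact: cvg_id.
    + apply: continuous_sqrt_pos_part; apply: cvgB; first exact: cvg_cst.
      by apply: continuous_csq; rewrite gt_eqF.
    + apply: continuous_sqrt_pos_part; apply: cvgB; first exact: cvg_cst.
      by apply: continuous_csq; rewrite gt_eqF.
    + exact: cvg_cst.
    + exact: cvg_cst.
  - apply: continuous_compact_integrable; first exact: segment_compact.
    by apply: continuous_subspaceT => ?; exact: cvg_cst.
  - move=> t _; apply/aeW => th _.
    by rewrite ger0_norm ?Phi_ge0//; exact: (Phi_le kb).
  - by rewrite inE/= in_itv/= s0/= ltrDl.
suff : thint phi x y z t @[t --> s] --> \int[leb]_(th in `[0, 2 * pi]) f s th.
  by rewrite -thint_Ymod ?gt_eqF.
apply: cvg_trans cf; apply: near_eq_cvg.
near=> t; rewrite thint_Ymod// gt_eqF//.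
near: t; exact: lt_nbhsr.
Unshelve. all: by end_near.
Qed.

Lemma continuous_within_thint x y z l h : 0 < l ->
  {within `[l, h], continuous (thint phi x y z)}.
Proof.
move=> l0; apply: continuous_in_subspaceT => s; rewrite inE/= in_itv/= => /andP[ls _].
by apply: continuous_thint; exact: lt_le_trans ls.
Qed.

Lemma integrable_thint x y z l h : 0 < l ->
  leb.-integrable `[l, h] (EFin \o thint phi x y z).
Proof.
move=> l0; apply: continuous_compact_integrable; first exact: segment_compact.
exact: continuous_within_thint.
Qed.

End KernelContinuity.

Lemma Rintegral_le_add (R : realType) (l h C : R) (f g : R -> R) : l <= h ->
  (@lebesgue_measure R).-integrable `[l, h] (EFin \o f) ->
  (@lebesgue_measure R).-integrable `[l, h] (EFin \o g) ->
  (forall s, l <= s <= h -> f s <= g s + C) ->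
  \int[lebesgue_measure]_(s in `[l, h]) f s <=
    \int[lebesgue_measure]_(s in `[l, h]) g s + C * (h - l).
Proof.
move=> lh fi gi fg.
have mI : measurable (`[l, h]%classic : set R) by exact: measurable_itv.
have Ci : (@lebesgue_measure R).-integrable `[l, h] (EFin \o (fun=> C)).
  apply: continuous_compact_integrable; first exact: segment_compact.
  by apply: continuous_subspaceT => ?; exact: cvg_cst.
have -> : C * (h - l) = \int[lebesgue_measure]_(s in `[l, h]) C.
  rewrite /Rintegral integral_cst//= lebesgue_measure_itv/= lte_fin.
  by move: lh; rewrite le_eqVlt => /predU1P[->|->]; rewrite ?ltxx ?subrr ?mulr0 ?mule0.
rewrite -RintegralD//; apply: le_Rintegral => //.
exact: (integrableD _ gi Ci).
Qed.

(** * Kernel bounds in terms of the square roots of the energies *)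

Section KernelBounds.
Variables (R : realType) (phi : R -> R) (b0 q : R).
Hypothesis kb : kernel_bounds phi b0 q.
Let b0_ge0 := kb_b0 kb.
Let q_ge0 := kb_q kb.
Implicit Types x y z s th al be ga : R.

Local Notation leb := (@lebesgue_measure R).

Lemma sqrt_sqr x : 0 <= x -> Num.sqrt (x ^+ 2) = x.
Proof. by move=> x0; rewrite sqrtr_sqr ger0_norm. Qed.

Lemma sqrt_2M x : Num.sqrt (2 * x) = Num.sqrt 2 * Num.sqrt x.
Proof. by rewrite sqrtrM. Qed.

Lemma sqr_sqrt2 : Num.sqrt 2 ^+ 2 = 2 :> R.
Proof. by rewrite sqr_sqrtr. Qed.

Lemma Phi_scaled_le r rho c : 0 <= r -> 0 <= rho -> r + rho <= c ->
  Phi phi (Num.sqrt 2 * r) (Num.sqrt 2 * rho) <= 2 * b0 ^+ 2 * c ^+ 2.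
Proof.
move=> r0 rho0 rc; have w0 := sqrtr_ge0 (2 : R).
have := Phi_le_sqr kb (mulr_ge0 w0 r0) (mulr_ge0 w0 rho0).
rewrite -mulrDr exprMn sqr_sqrt2 => /le_trans; apply.
have h : (r + rho) ^+ 2 <= c ^+ 2 by rewrite ler_sqr ?nnegrE//; lra.
by have := ler_wpM2l (sqr_ge0 b0) h; lra.
Qed.

Lemma Phi_Ystar_le x y z s th c : 0 <= c ->
  x <= c ^+ 2 -> y <= c ^+ 2 -> z <= c ^+ 2 ->
  0 <= s <= Num.sqrt x + Num.sqrt y ->
  Phi phi (Num.sqrt 2 * s) (Num.sqrt 2 * Ystar x y z s th) <= 32 * b0 ^+ 2 * c ^+ 2.
Proof.
move=> c0 xc yc zc /andP[s0 sxy].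
have := sqrt_le_sqr c0 xc; have := sqrt_le_sqr c0 yc => h1 h2.
(* Both s and [Ystar] are at most 2 c, whence 4 c, and 2 (4 c)^2 = 32 c^2. *)
have := @Phi_scaled_le s (Ystar x y z s th) (4 * c) s0 (Ystar_ge0 _ _ _ _ _).
have := Ystar_le y s th c0 xc zc => h3; rewrite exprMn.
by move=> /(_ ltac:(lra)); lra.
Qed.

Lemma xstar_gt0_W x y z : 0 < x -> 0 < y -> 0 < z ->
  (0 < xstar x y z * x * y * z) = (0 < xstar x y z).
Proof. by move=> x0 y0 z0; rewrite !pmulr_lgt0. Qed.

Lemma xstar_ge0 x y z : 0 <= xstar x y z.
Proof. by rewrite /xstar /pos_part le_max lexx orbT. Qed.

Lemma W_eq0 x y z : 0 < x -> 0 < y -> 0 < z -> xstar x y z = 0 -> W phi x y z = 0.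
Proof.
move=> x0 y0 z0 xs0.
by rewrite /W xs0 !mul0r ltxx !gt_eqF.
Qed.

Lemma sqrt_sqr3 x y z : 0 <= x -> 0 <= y -> 0 <= z ->
  Num.sqrt (x ^+ 2 * y ^+ 2 * z ^+ 2) = x * y * z.
Proof. by move=> x0 y0 z0; rewrite -!exprMn sqrt_sqr// !mulr_ge0. Qed.

(** Writing the energies as squares turns the denominator sqrt(x y z) into a product. Through m each
    caller chooses which of the four roots bounds the half-length of the range of s. *)
Lemma W_le_root x y z c m : 0 < x <= c -> 0 < y <= c -> 0 < z <= c ->
  Num.min (Num.min x y) (Num.min (Num.sqrt (xstar (x ^+ 2) (y ^+ 2) (z ^+ 2))) z) <= m ->
  W phi (x ^+ 2) (y ^+ 2) (z ^+ 2) <= 32 * b0 ^+ 2 * c ^+ 2 * m / (x * y * z).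
Proof.
move=> /andP[x0 xc] /andP[y0 yc] /andP[z0 zc] hm.
have c0 : 0 <= c by lra.
have [x0' y0' z0'] : [/\ 0 <= x, 0 <= y & 0 <= z] by split; exact: ltW.
have X0 : 0 < x ^+ 2 by rewrite exprn_gt0.
have Y0 : 0 < y ^+ 2 by rewrite exprn_gt0.
have Z0 : 0 < z ^+ 2 by rewrite exprn_gt0.
have m0 : 0 <= m by apply: le_trans hm; rewrite !le_min sqrtr_ge0 !ltW.
have [xs0|xs0] := eqVneq (xstar (x ^+ 2) (y ^+ 2) (z ^+ 2)) 0.
  rewrite W_eq0// divr_ge0 ?mulr_ge0//; lra.
have xsp : 0 < xstar (x ^+ 2) (y ^+ 2) (z ^+ 2) by rewrite lt0r xs0 xstar_ge0.
have := @W_pos_le _ phi (x ^+ 2) (y ^+ 2) (z ^+ 2) m (32 * b0 ^+ 2 * c ^+ 2).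
rewrite xstar_gt0_W// sqrt_sqr3// => H.
rewrite [32 * b0 ^+ 2 * c ^+ 2 * m]mulrC; apply: H => //.
- by rewrite !mulr_ge0.
- apply: (le_trans (shi_slo _ _ _)); rewrite !sqrt_sqr//.
  by rewrite ler_pM2l.
- by move=> s th; apply: Phi_Ystar_le => //; rewrite ler_sqr.
Qed.

Lemma Phi_quot_le x y c u v : 0 < x -> 0 < y -> 0 <= c ->
  0 <= u <= c -> 0 <= v <= c ->
  Phi phi (Num.sqrt (2 * u ^+ 2)) (Num.sqrt (2 * v ^+ 2)) / Num.sqrt (x ^+ 2 * y ^+ 2) <=
  32 * b0 ^+ 2 * c ^+ 2 / (x * y).
Proof.
move=> x0 y0 c0 /andP[u0 uc] /andP[v0 vc].
have -> : Num.sqrt (x ^+ 2 * y ^+ 2) = x * y by rewrite -exprMn sqrt_sqr// mulr_ge0// ltW.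
rewrite ler_pM2r ?invr_gt0 ?mulr_gt0// !sqrt_2M !sqrt_sqr//.
have := @Phi_scaled_le u v (2 * c) u0 v0; rewrite exprMn => /(_ ltac:(lra)).
have : 0 <= b0 ^+ 2 * c ^+ 2 by rewrite mulr_ge0 ?sqr_ge0.
by lra.
Qed.

(** The choice m = al cancels al in the denominator, so the bound persists at al = 0, where [W] is
    given by its boundary formula. The next two lemmas do the same in the other positions. *)
Lemma W_le_x al y z c : 0 <= al <= c -> 0 < y <= c -> 0 < z <= c ->
  W phi (al ^+ 2) (y ^+ 2) (z ^+ 2) <= 32 * b0 ^+ 2 * c ^+ 2 / (y * z).
Proof.
move=> /andP[al0 alc] hy hz; case/andP: (hy) => y0 yc; case/andP: (hz) => z0 zc.
have c0 : 0 <= c by lra.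
move: al0; rewrite le_eqVlt => /predU1P[<-|al0].
  rewrite /W expr0n/= !(mulr0, mul0r) ltxx eqxx/= !exprn_gt0//=.
  by apply: Phi_quot_le; lra.
have -> : 32 * b0 ^+ 2 * c ^+ 2 / (y * z) = 32 * b0 ^+ 2 * c ^+ 2 * al / (al * y * z).
  by field; rewrite !gt_eqF.
by apply: W_le_root => //; [rewrite al0|rewrite !ge_min lexx].
Qed.

Lemma W_le_y x al z c : 0 < x <= c -> 0 <= al <= c -> 0 < z <= c ->
  W phi (x ^+ 2) (al ^+ 2) (z ^+ 2) <= 32 * b0 ^+ 2 * c ^+ 2 / (x * z).
Proof.
move=> hx /andP[al0 alc] hz; case/andP: (hx) => x0 xc; case/andP: (hz) => z0 zc.
have c0 : 0 <= c by lra.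
move: al0; rewrite le_eqVlt => /predU1P[<-|al0].
  rewrite /W expr0n/= !(mulr0, mul0r) ltxx eqxx/= (gt_eqF (exprn_gt0 2 x0))/= exprn_gt0//=.
  have B0 : 0 <= 32 * b0 ^+ 2 * c ^+ 2 / (x * z).
    by rewrite divr_ge0 ?mulr_ge0 ?sqr_ge0 ?(ltW x0) ?(ltW z0).
  case: ifP => [h|_]; last by rewrite (gt_eqF (exprn_gt0 2 z0)).
  have xz : 0 <= z ^+ 2 - x ^+ 2 by rewrite subr_ge0 ltW.
  rewrite -(sqr_sqrtr xz); apply: Phi_quot_le; rewrite ?sqrtr_ge0//=; first lra.
  by apply: sqrt_le_sqr; nra.
have -> : 32 * b0 ^+ 2 * c ^+ 2 / (x * z) = 32 * b0 ^+ 2 * c ^+ 2 * al / (x * al * z).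
  by field; rewrite !gt_eqF.
by apply: W_le_root => //; [rewrite al0|rewrite !ge_min lexx ?orbT].
Qed.

Lemma W_le_z x y al c : 0 < x <= c -> 0 < y <= c -> 0 <= al <= c ->
  W phi (x ^+ 2) (y ^+ 2) (al ^+ 2) <= 32 * b0 ^+ 2 * c ^+ 2 / (x * y).
Proof.
move=> hx hy /andP[al0 alc]; case/andP: (hx) => x0 xc; case/andP: (hy) => y0 yc.
have c0 : 0 <= c by lra.
move: al0; rewrite le_eqVlt => /predU1P[<-|al0].
  rewrite /W expr0n/= !(mulr0, mul0r) ltxx eqxx/= (gt_eqF (exprn_gt0 2 x0))/=.
  rewrite (gt_eqF (exprn_gt0 2 y0))/= exprn_gt0//=.
  have B0 : 0 <= 32 * b0 ^+ 2 * c ^+ 2 / (x * y).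
    by rewrite divr_ge0 ?mulr_ge0 ?sqr_ge0 ?(ltW x0) ?(ltW y0).
  case: ifP => [h|_] //.
  have xz : 0 <= y ^+ 2 - x ^+ 2 by rewrite subr_ge0 ltW.
  rewrite -(sqr_sqrtr xz); apply: Phi_quot_le; rewrite ?sqrtr_ge0//=; last lra.
  by apply: sqrt_le_sqr; nra.
have -> : 32 * b0 ^+ 2 * c ^+ 2 / (x * y) = 32 * b0 ^+ 2 * c ^+ 2 * al / (x * y * al).
  by field; rewrite !gt_eqF.
by apply: W_le_root => //; [rewrite al0|rewrite !ge_min lexx ?orbT].
Qed.

End KernelBounds.

(** * Comparison of the kernel at permuted energies *)

Section KernelDifference.
Variables (R : realType) (phi : R -> R) (b0 q : R).
Hypothesis kb : kernel_bounds phi b0 q.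
Let b0_ge0 := kb_b0 kb.
Let q_ge0 := kb_q kb.
Implicit Types x y z s th al be ga : R.

Local Notation leb := (@lebesgue_measure R).

Lemma sqrt_sub_ge be ga : 0 <= be -> 4 * be <= ga ->
  3 / 4 * ga <= Num.sqrt (ga ^+ 2 - be ^+ 2).
Proof.
move=> be0 bega; apply: ler_of_sqr; first exact: sqrtr_ge0.
by rewrite sqr_sqrtr; nra.
Qed.

(** Since be <= ga / 4, one has Y - Y' <= be^2 / ga <= ga / 16 <= Y' / 8, and 9/8 <= sqrt 2 makes
    the growth condition applicable. The factor 10 is the 2 from scaling both arguments by sqrt 2,
    times the 5 of the last hypothesis. *)
Lemma Phi_diff_le r Y Y' be ga : 0 <= r -> 0 <= be -> 4 * be <= ga -> 0 < ga ->
  ga / 2 <= Y' -> Y' <= Y -> (Y - Y') * ga <= be ^+ 2 -> 2 * r + Y + Y' <= 5 * ga ->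
  Phi phi (Num.sqrt 2 * r) (Num.sqrt 2 * Y) - Phi phi (Num.sqrt 2 * r) (Num.sqrt 2 * Y') <=
    10 * (q * b0 ^+ 2) * be ^+ 2.
Proof.
move=> r0 be0 bega ga0 gaY YY' dY sum.
have w1 : 9 / 8 <= Num.sqrt 2 :> R.
  by apply: ler_of_sqr; rewrite ?sqrtr_ge0// sqr_sqrt2; lra.
have w0 : 0 < Num.sqrt 2 :> R by lra.
have Y'0 : 0 < Y' by lra.
have YY : Y - Y' <= ga / 16.
  by rewrite -(ler_pM2r ga0); apply: (le_trans dY); nra.
have h : Num.sqrt 2 * Y <= Num.sqrt 2 * (Num.sqrt 2 * Y').
  by rewrite ler_pM2l//; nra.
have := Phi_sub kb (mulr_ge0 (ltW w0) r0) (mulr_gt0 w0 Y'0).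
move=> /(_ (Num.sqrt 2 * Y)); rewrite ler_pM2l// => /(_ YY' h) /le_trans; apply.
have -> : (Num.sqrt 2 * Y - Num.sqrt 2 * Y') *
    (2 * (Num.sqrt 2 * r) + Num.sqrt 2 * Y + Num.sqrt 2 * Y') =
    2 * ((Y - Y') * (2 * r + Y + Y')).
  by rewrite -[X in X * ((Y - _) * _)]sqr_sqrt2; ring.
have h1 : (Y - Y') * (2 * r + Y + Y') <= (Y - Y') * (5 * ga).
  by rewrite ler_wpM2l// subr_ge0.
have qb : 0 <= q * b0 ^+ 2 by rewrite mulr_ge0 ?sqr_ge0.
have h2 : 2 * ((Y - Y') * (2 * r + Y + Y')) <= 10 * be ^+ 2 by lra.
by have := ler_wpM2l qb h2; lra.
Qed.

Lemma sqrt_xstar_sqr x y z : 0 <= y + z - x ->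
  Num.sqrt (xstar x y z) ^+ 2 = y + z - x.
Proof. by move=> h; rewrite sqr_sqrtr ?xstar_ge0// /xstar ge0_pos_part. Qed.

Lemma csq_swap x y s : s != 0 -> csq y x s = csq x y s + (y - x).
Proof. by move=> s0; rewrite /csq; field. Qed.

(** Law of cosines: sides al, be, s that form a triangle satisfy |al^2 - be^2 + s^2| <= 2 al s. *)
Lemma csq_le al be s : 0 <= al <= be -> be - al <= s <= be + al -> 0 < s ->
  csq (al ^+ 2) (be ^+ 2) s <= al ^+ 2.
Proof.
move=> /andP[al0 albe] /andP[s1 s2] s0.
rewrite /csq ler_pdivrMr; last by rewrite mulr_gt0// exprn_gt0.
have -> : al ^+ 2 * (4 * s ^+ 2) = (2 * al * s) ^+ 2 by ring.
have h1 : al ^+ 2 - be ^+ 2 + s ^+ 2 <= 2 * al * s by nra.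
have h2 : - (2 * al * s) <= al ^+ 2 - be ^+ 2 + s ^+ 2 by nra.
by rewrite -subr_ge0 subr_sqr mulr_ge0//; lra.
Qed.

(** The root X of [xstar] satisfies ga <= X <= ga + be - al, so the pair (X, ga) gives the weaker
    constraint at both ends. *)
Lemma range_abc al be ga : 0 <= al <= be -> be <= ga ->
  slo (al ^+ 2) (be ^+ 2) (ga ^+ 2) = be - al /\
  shi (al ^+ 2) (be ^+ 2) (ga ^+ 2) = be + al.
Proof.
move=> /andP[al0 albe] bega; rewrite /slo /shi.
have be0 : 0 <= be by lra.
have ga0 : 0 <= ga by lra.
have := @sqrt_xstar_sqr (al ^+ 2) (be ^+ 2) (ga ^+ 2) ltac:(nra).
have := sqrtr_ge0 (xstar (al ^+ 2) (be ^+ 2) (ga ^+ 2)).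
set X := Num.sqrt _ => X0 XE; rewrite !sqrt_sqr//.
have h1 : ga <= X by apply: ler_of_sqr => //; nra.
have h2 : X <= ga + be - al by apply: ler_of_sqr; [lra|nra].
split.
  by rewrite distrC !ger0_norm ?subr_ge0//; apply/max_idPl; lra.
by rewrite addrC; apply/min_idPl; lra.
Qed.

(** Now ga - (be - al) <= X <= ga, and again the pair (X, ga) does not bind. *)
Lemma range_bac al be ga : 0 <= al <= be -> be <= ga ->
  slo (be ^+ 2) (al ^+ 2) (ga ^+ 2) = be - al /\
  shi (be ^+ 2) (al ^+ 2) (ga ^+ 2) = be + al.
Proof.
move=> /andP[al0 albe] bega; rewrite /slo /shi.
have be0 : 0 <= be by lra.
have ga0 : 0 <= ga by lra.
have := @sqrt_xstar_sqr (be ^+ 2) (al ^+ 2) (ga ^+ 2) ltac:(nra).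
have := sqrtr_ge0 (xstar (be ^+ 2) (al ^+ 2) (ga ^+ 2)).
set X := Num.sqrt _ => X0 XE; rewrite !sqrt_sqr//.
have h1 : X <= ga by apply: ler_of_sqr => //; nra.
have h2 : ga - be + al <= X by apply: ler_of_sqr => //; nra.
split.
  rewrite ger0_norm ?subr_ge0// distrC ger0_norm ?subr_ge0//; apply/max_idPl; lra.
by apply/min_idPl; lra.
Qed.

(* At (a, b, c) and (b, a, c) the ranges of s agree and so does the second
   summand of Y_*; only the first summand u shrinks to u', with
   u^2 - u'^2 = b - a. *)
Lemma thint_diff_abc al be ga s : 0 <= al < be -> 4 * be <= ga ->
  be - al <= s <= be + al ->
  thint phi (al ^+ 2) (be ^+ 2) (ga ^+ 2) s <=
  thint phi (be ^+ 2) (al ^+ 2) (ga ^+ 2) s +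
    10 * (q * b0 ^+ 2) * be ^+ 2 * (2 * pi).
Proof.
move=> /andP[al0 albe] bega sI; have /andP[s1 s2] := sI.
have s0 : 0 < s by lra.
have pi0 := pi_ge0 R.
have be0 : 0 <= be by lra.
have ga0 : 0 < ga by lra.
have := @csq_le al be s; rewrite al0 (ltW albe) => /(_ isT sI s0) cs.
have := csq_ge0 (al ^+ 2) (be ^+ 2) s => cs0.
have := Rintegral_le_add; rewrite /thint => /(_ R 0 (2 * pi)).
rewrite subr0; apply; first by rewrite mulr_ge0.
- by apply: (integrable_Ystar kb); rewrite gt_eqF.
- by apply: (integrable_Ystar kb); rewrite gt_eqF.
move=> th _; rewrite -lerBlDl !YstarE ?gt_eqF// /Yreg (@csq_swap (al ^+ 2) (be ^+ 2)) ?gt_eqF//.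
set cc := csq _ _ _ in cs cs0 *.
have -> : be ^+ 2 - (cc + (be ^+ 2 - al ^+ 2)) = al ^+ 2 - cc by ring.
have h1 : 0 <= ga ^+ 2 - cc by nra.
have h2 : 0 <= ga ^+ 2 - (cc + (be ^+ 2 - al ^+ 2)) by nra.
have h3 : 0 <= al ^+ 2 - cc by lra.
rewrite !ge0_pos_part//.
have := sqr_sqrtr h1; have := sqr_sqrtr h2; have := sqr_sqrtr h3.
have := sqrtr_ge0 (ga ^+ 2 - cc).
have := sqrtr_ge0 (ga ^+ 2 - (cc + (be ^+ 2 - al ^+ 2))).
have := sqrtr_ge0 (al ^+ 2 - cc).
set v := Num.sqrt (al ^+ 2 - cc); set u := Num.sqrt (ga ^+ 2 - cc).
set u' := Num.sqrt _ => v0 u'0 u0 vE u'E uE.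
have vle : v <= al by apply: ler_of_sqr => //; lra.
have ule : u <= ga by apply: ler_of_sqr; lra.
have uu : u' <= u by apply: ler_of_sqr => //; nra.
have u'ge : 3 / 4 * ga <= u' by apply: ler_of_sqr => //; nra.
have Yge := Ymod_ge th u'0 v0.
have Yle := Ymod_le th u0 v0.
have YY : Ymod u' v th <= Ymod u v th by apply: Ymod_mono => //; lra.
have dY := Ymod_lip v th uu.
apply: (Phi_diff_le (ga := ga)) => //; try lra.
(* Here (u - u') (u + u') = be^2 - al^2 and u + u' >= 3/2 ga. *)
have h4 : (u - u') * ga <= be ^+ 2 by nra.
by apply: le_trans h4; rewrite ler_pM2r.
Qed.


End KernelDifference.

Section KernelDifferenceABC.
Variables (R : realType) (phi : R -> R) (b0 q : R).
Hypothesis kb : kernel_bounds phi b0 q.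
Let b0_ge0 := kb_b0 kb.
Let q_ge0 := kb_q kb.
Implicit Types x y z s th al be ga : R.

Local Notation leb := (@lebesgue_measure R).

(** The case al = 0 of both kernel comparisons, where [W] is given by boundary formulas. As be <= ga
    / 4, the numerator bound 10 be^2 is at most 5/2 of the denominator. *)
Lemma Phi_quot_diff be ga d : 0 < be -> 4 * be <= ga ->
  d = Num.sqrt (ga ^+ 2 - be ^+ 2) ->
  (Phi phi (Num.sqrt 2 * be) (Num.sqrt 2 * ga) -
   Phi phi (Num.sqrt 2 * be) (Num.sqrt 2 * d)) / (be * ga) <= 4 * (q * b0 ^+ 2).
Proof.
move=> be0 bega dE; have ga0 : 0 < ga by lra.
have d1 : 3 / 4 * ga <= d by rewrite dE sqrt_sub_ge// ltW.
have d2 : d ^+ 2 = ga ^+ 2 - be ^+ 2 by rewrite dE sqr_sqrtr//; nra.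
have d3 : d <= ga by apply: ler_of_sqr; [lra|nra].
have H := @Phi_diff_le _ _ _ _ kb be ga d be ga (ltW be0) (ltW be0) bega ga0.
rewrite ler_pdivrMr ?mulr_gt0//; apply: (le_trans (H _ _ _ _)); [lra|lra|nra|lra|].
have h : be ^+ 2 <= be * ga / 4 by nra.
have qb : 0 <= q * b0 ^+ 2 by rewrite mulr_ge0 ?sqr_ge0.
have : 0 <= be * ga by rewrite mulr_ge0// ltW.
by have := ler_wpM2l qb h; nra.
Qed.

Lemma W_diff_abc al be ga : 0 <= al < be -> 4 * be <= ga ->
  W phi (al ^+ 2) (be ^+ 2) (ga ^+ 2) - W phi (be ^+ 2) (al ^+ 2) (ga ^+ 2) <=
    4 * (q * b0 ^+ 2).
Proof.
move=> /andP[al0 albe] bega.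
have be0 : 0 < be by lra.
have ga0 : 0 < ga by lra.
have [be0' ga0'] : 0 <= be /\ 0 <= ga by split; exact: ltW.
have B2 : 0 < be ^+ 2 by rewrite exprn_gt0.
have G2 : 0 < ga ^+ 2 by rewrite exprn_gt0.
have BG : be ^+ 2 < ga ^+ 2 by nra.
have h : be ^+ 2 <= be * ga / 4 by nra.
move: (al0); rewrite le_eqVlt => /predU1P[alE|alp].
  rewrite -alE /W expr0n/= !(mulr0, mul0r) ltxx eqxx B2 G2 (gt_eqF B2)/= BG.
  rewrite !sqrt_2M -exprMn !sqrt_sqr ?mulr_ge0// -mulrBl.
  exact: Phi_quot_diff.
have xs1 : 0 < xstar (al ^+ 2) (be ^+ 2) (ga ^+ 2).
  by rewrite /xstar ge0_pos_part; nra.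
have xs2 : 0 < xstar (be ^+ 2) (al ^+ 2) (ga ^+ 2).
  by rewrite /xstar ge0_pos_part; nra.
have A2 : 0 < al ^+ 2 by rewrite exprn_gt0.
rewrite !W_posE ?xstar_gt0_W//.
have -> : be ^+ 2 * al ^+ 2 = al ^+ 2 * be ^+ 2 by rewrite mulrC.
rewrite sqrt_sqr3 ?(ltW alp) ?(ltW be0) ?(ltW ga0)//.
have [-> ->] : slo (al ^+ 2) (be ^+ 2) (ga ^+ 2) = be - al /\
  shi (al ^+ 2) (be ^+ 2) (ga ^+ 2) = be + al by apply: range_abc; lra.
have [-> ->] : slo (be ^+ 2) (al ^+ 2) (ga ^+ 2) = be - al /\
  shi (be ^+ 2) (al ^+ 2) (ga ^+ 2) = be + al by apply: range_bac; lra.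
rewrite -mulrBr.
have ba0 : 0 < be - al by rewrite subr_gt0.
(* Endpoints and prefactors agree, so only the angular integrals are compared; the length 2 al of
   the range will cancel al in the prefactor. *)
have H : \int[leb]_(s in `[be - al, be + al]) thint phi (al ^+ 2) (be ^+ 2) (ga ^+ 2) s -
  \int[leb]_(s in `[be - al, be + al]) thint phi (be ^+ 2) (al ^+ 2) (ga ^+ 2) s <=
  10 * (q * b0 ^+ 2) * be ^+ 2 * (2 * pi) * (2 * al).
  rewrite lerBlDl (_ : 2 * al = be + al - (be - al)); last by ring.
  apply: Rintegral_le_add; first lra.
  - exact: (integrable_thint kb).
  - exact: (integrable_thint kb).
  - by move=> s sI; apply: thint_diff_abc => //; rewrite al0 albe.
have pi0 := pi_gt0 R.
have S : 0 < 4 * pi * (al * be * ga) by rewrite !mulr_gt0.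
rewrite mulrC ler_pdivrMr//; apply: (le_trans H).
have qb : 0 <= q * b0 ^+ 2 by rewrite mulr_ge0 ?sqr_ge0.
have K : 0 <= 40 * (q * b0 ^+ 2) * pi * al by rewrite !mulr_ge0// ltW.
have K2 : 0 <= (q * b0 ^+ 2) * pi * al * (be * ga) by rewrite !mulr_ge0// ltW.
have := ler_wpM2l K h; move: K2; clear.
by move: (@pi R) => P; lra.
Qed.

(* Inverse of the signed projection h = (x - y + s^2) / (2 s), with A = y - x.
   In terms of h the modulus Y_* takes the same value at (x, y, z) = (a, c, b)
   and (b, c, a), so the two kernels differ only through s and ds/dh. *)
Definition sg (A h : R) : R := h + Num.sqrt (h ^+ 2 + A).

Lemma sg_sqrt_gt (A h : R) : 0 < A -> `|h| < Num.sqrt (h ^+ 2 + A).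
Proof.
by move=> A0; rewrite -sqrtr_sqr ltr_sqrt ?ltrDl//; have := sqr_ge0 h; lra.
Qed.

Lemma is_derive_sg (A h : R) : 0 < A ->
  is_derive h 1 (sg A) (1 + h / Num.sqrt (h ^+ 2 + A)).
Proof.
move=> A0.
have P : 0 < h ^+ 2 + A by have := sqr_ge0 h; lra.
have S : 0 < Num.sqrt (h ^+ 2 + A) by rewrite sqrtr_gt0.
have D1 : is_derive h 1 (fun h : R => h ^+ 2 + A) (h *+ 2).
  by apply: is_derive_eq; rewrite addr0 mulr2n; congr (_ + _); exact: mulr1.
have D2 := is_derive1_sqrt P.
have D3 := @is_derive1_comp _ Num.sqrt (fun h : R => h ^+ 2 + A) h _ _ D2 D1.
apply: is_derive_eq.
by congr (_ + _); rewrite -mulr_natr; field; rewrite gt_eqF.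
Qed.

Lemma sg_lt (A x y : R) : 0 < A -> x < y -> sg A x < sg A y.
Proof.
move=> A0 xy; rewrite /sg.
have := sg_sqrt_gt x A0; have := sg_sqrt_gt y A0.
have Px : 0 <= x ^+ 2 + A by have := sqr_ge0 x; lra.
have Py : 0 <= y ^+ 2 + A by have := sqr_ge0 y; lra.
have := sqr_sqrtr Px; have := sqr_sqrtr Py.
move: (Num.sqrt (x ^+ 2 + A)) (Num.sqrt (y ^+ 2 + A)) => p r rE pE.
rewrite !ltr_norml => /andP[r1 r2] /andP[p1 p2].
(* Otherwise r - p <= -(y - x), and (y - x) (y + x) = (r - p) (r + p) forces x + y <= -(r + p),
   against |x| < p and |y| < r. *)
rewrite ltNge; apply/negP => h.
have : (y - x) * (y + x) = (r - p) * (r + p) by lra.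
have : 0 < y - x by lra.
have : r - p <= - (y - x) by lra.
have : 0 < r + p by lra.
nra.
Qed.

(** Change of variable s = [sg A h]. Positivity of the lower endpoint places the range of s where
    [thint] has been shown continuous. *)
Lemma subst_thint x y z A al : 0 < A -> 0 < al -> 0 < sg A (- al) ->
  \int[leb]_(s in `[sg A (- al), sg A al]) thint phi x y z s =
  \int[leb]_(h in `[- al, al])
    (thint phi x y z (sg A h) * (1 + h / Num.sqrt (h ^+ 2 + A))).
Proof.
move=> A0 al0 sg0.
have dF : (sg A)^`()%classic = (fun h => 1 + h / Num.sqrt (h ^+ 2 + A)).
  by apply/funext => h; have D := is_derive_sg h A0; rewrite derive1E derive_val.
have cdF (h : R) : {for h, continuous (fun h : R => 1 + h / Num.sqrt (h ^+ 2 + A))}.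
  have P : 0 < h ^+ 2 + A by have := sqr_ge0 h; lra.
  apply: cvgD; first exact: cvg_cst.
  apply: cvgM; first exact: cvg_id.
  apply: cvgV; first by rewrite gt_eqF// sqrtr_gt0.
  apply: (@continuous_comp _ _ _ (fun h : R => h ^+ 2 + A) Num.sqrt).
    by apply: cvgD; [exact: exprn_continuous|exact: cvg_cst].
  exact: sqrt_continuous.
have cF (h : R) : {for h, continuous (sg A)}.
  have D := is_derive_sg h A0.
  by apply: differentiable_continuous; apply/derivable1_diffP; exact: ex_derive.
rewrite /Rintegral (@integration_by_substitution_increasing _ (sg A)).
- by rewrite dF.
- by rewrite ge0_cp// ltW.
- by move=> u v _ _; exact: sg_lt.
- by rewrite dF => h _; exact: cdF.
- by rewrite dF; apply/cvg_ex; eexists; apply: cvg_at_right_filter; exact: cdF.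
- by rewrite dF; apply/cvg_ex; eexists; apply: cvg_at_left_filter; exact: cdF.
- split.
  + by move=> h _; have D := is_derive_sg h A0; exact: ex_derive.
  + by apply: cvg_at_right_filter; exact: cF.
  + by apply: cvg_at_left_filter; exact: cF.
- exact: (continuous_within_thint kb).
Qed.

End KernelDifferenceABC.

(** * Difference of the kernels at (a, c, b) and (b, c, a) *)

Section KernelDifferenceACB.
Variables (R : realType) (phi : R -> R) (b0 q : R).
Hypothesis kb : kernel_bounds phi b0 q.
Let b0_ge0 := kb_b0 kb.
Let q_ge0 := kb_q kb.
Implicit Types x y z s th al be ga : R.

Local Notation leb := (@lebesgue_measure R).

Lemma integrable_subst_thint x y z A al : 0 < A -> 0 < sg A (- al) ->
  leb.-integrable `[- al, al] (EFin \o (fun h : R =>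
    thint phi x y z (sg A h) * (1 + h / Num.sqrt (h ^+ 2 + A)))).
Proof.
move=> A0 sg0; apply: continuous_compact_integrable; first exact: segment_compact.
apply: continuous_in_subspaceT => h; rewrite inE/= in_itv/= => /andP[h1 _].
have P : 0 < h ^+ 2 + A by have := sqr_ge0 h; lra.
have sgh : 0 < sg A h.
  by move: h1; rewrite le_eqVlt => /predU1P[<-//|h1]; apply: (lt_trans sg0); exact: sg_lt.
apply: cvgM.
  apply: (@continuous_comp _ _ _ (sg A) (thint phi x y z)).
    have D := is_derive_sg h A0.
    by apply: differentiable_continuous; apply/derivable1_diffP; exact: ex_derive.
  exact: (continuous_thint kb).
apply: cvgD; first exact: cvg_cst.
apply: cvgM; first exact: cvg_id.
apply: cvgV; first by rewrite gt_eqF// sqrtr_gt0.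
apply: (@continuous_comp _ _ _ (fun h : R => h ^+ 2 + A) Num.sqrt).
  by apply: cvgD; [exact: exprn_continuous|exact: cvg_cst].
exact: sqrt_continuous.
Qed.

(** With A = y - x, [sg A h] is the positive root of s^2 - 2 h s - A = 0, which is the equation (x -
    y + s^2) / (2 s) = h. *)
Lemma csq_sg x y h : 0 < y - x -> csq x y (sg (y - x) h) = h ^+ 2.
Proof.
move=> A0; rewrite /csq.
have P : 0 <= h ^+ 2 + (y - x) by have := sqr_ge0 h; lra.
have := sqr_sqrtr P; have := sg_sqrt_gt h A0; rewrite /sg ltr_norml.
move: (Num.sqrt _) => w /andP[w1 w2] wE.
have S : 0 < h + w by lra.
have -> : x - y + (h + w) ^+ 2 = 2 * h * (h + w).
  have -> : x - y = h ^+ 2 - w ^+ 2 by rewrite wE; ring.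
  by ring.
by field; rewrite gt_eqF.
Qed.

(** The binding pair is (al, ga): [sg] takes the values ga - al and ga + al at -al and al. *)
Lemma range_acb al be ga : 0 <= al <= be -> be <= ga ->
  slo (al ^+ 2) (ga ^+ 2) (be ^+ 2) = sg (ga ^+ 2 - al ^+ 2) (- al) /\
  shi (al ^+ 2) (ga ^+ 2) (be ^+ 2) = sg (ga ^+ 2 - al ^+ 2) al.
Proof.
move=> /andP[al0 albe] bega; rewrite /slo /shi /sg.
have be0 : 0 <= be by lra.
have ga0 : 0 <= ga by lra.
rewrite sqrrN.
have -> : al ^+ 2 + (ga ^+ 2 - al ^+ 2) = ga ^+ 2 by ring.
have := @sqrt_xstar_sqr _ (al ^+ 2) (ga ^+ 2) (be ^+ 2) ltac:(nra).
have := sqrtr_ge0 (xstar (al ^+ 2) (ga ^+ 2) (be ^+ 2)).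
set X := Num.sqrt (xstar _ _ _) => X0 XE; rewrite !sqrt_sqr//.
have h1 : ga <= X by apply: ler_of_sqr => //; nra.
have h2 : X <= ga + be - al by apply: ler_of_sqr; [lra|nra].
split.
  rewrite distrC !ger0_norm ?subr_ge0//; [|lra|lra].
  by rewrite addrC; apply/max_idPl; lra.
by apply/min_idPl; lra.
Qed.

(** Here the binding pair consists of the root of [xstar] and al, because al^2 + ga^2 - be^2 is
    [xstar]. In the variable h the range is thus [-al, al] once more. *)
Lemma range_bca al be ga : 0 <= al <= be -> be <= ga ->
  slo (be ^+ 2) (ga ^+ 2) (al ^+ 2) = sg (ga ^+ 2 - be ^+ 2) (- al) /\
  shi (be ^+ 2) (ga ^+ 2) (al ^+ 2) = sg (ga ^+ 2 - be ^+ 2) al.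
Proof.
move=> /andP[al0 albe] bega; rewrite /slo /shi /sg.
have be0 : 0 <= be by lra.
have ga0 : 0 <= ga by lra.
rewrite sqrrN.
have -> : al ^+ 2 + (ga ^+ 2 - be ^+ 2) = xstar (be ^+ 2) (ga ^+ 2) (al ^+ 2).
  by rewrite /xstar ge0_pos_part; [ring|nra].
have := @sqrt_xstar_sqr _ (be ^+ 2) (ga ^+ 2) (al ^+ 2) ltac:(nra).
have := sqrtr_ge0 (xstar (be ^+ 2) (ga ^+ 2) (al ^+ 2)).
set X := Num.sqrt (xstar _ _ _) => X0 XE; rewrite !sqrt_sqr//.
have h1 : X <= ga by apply: ler_of_sqr => //; nra.
have h2 : ga - be + al <= X by apply: ler_of_sqr => //; nra.
split.
  rewrite distrC !ger0_norm ?subr_ge0//; [|lra].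
  by rewrite [RHS]addrC; apply/max_idPr; lra.
by rewrite [RHS]addrC; apply/min_idPr; lra.
Qed.

(** With T1, T2 the angular integrals and w1, w2 the Jacobians, T1 w1 - T2 w2 = (T1 - T2) w1 + T2
    (w1 - w2). The first part costs 10 * 2 pi * 2 = 40 pi times q b0^2 be^2, the second 16 pi b0^2
    be^2. *)
Lemma thint_diff_acb al be ga h : 0 <= al < be -> 4 * be <= ga -> - al <= h <= al ->
  thint phi (al ^+ 2) (ga ^+ 2) (be ^+ 2) (sg (ga ^+ 2 - al ^+ 2) h) *
    (1 + h / Num.sqrt (h ^+ 2 + (ga ^+ 2 - al ^+ 2))) <=
  thint phi (be ^+ 2) (ga ^+ 2) (al ^+ 2) (sg (ga ^+ 2 - be ^+ 2) h) *
    (1 + h / Num.sqrt (h ^+ 2 + (ga ^+ 2 - be ^+ 2))) +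
    40 * pi * (b0 ^+ 2 * (1 + q)) * be ^+ 2.
Proof.
move=> /andP[al0 albe] bega /andP[h1 h2].
have be0 : 0 <= be by lra.
have ga0 : 0 < ga by lra.
have hh : h ^+ 2 <= al ^+ 2 by nra.
have A0 : 0 < ga ^+ 2 - al ^+ 2 by nra.
have B0 : 0 < ga ^+ 2 - be ^+ 2 by nra.
have PA : 0 <= h ^+ 2 + (ga ^+ 2 - al ^+ 2) by have := sqr_ge0 h; lra.
have PB : 0 <= h ^+ 2 + (ga ^+ 2 - be ^+ 2) by have := sqr_ge0 h; lra.
set sA := sg (ga ^+ 2 - al ^+ 2) h; set sB := sg (ga ^+ 2 - be ^+ 2) h.
set a := Num.sqrt (h ^+ 2 + (ga ^+ 2 - al ^+ 2)).
set b := Num.sqrt (h ^+ 2 + (ga ^+ 2 - be ^+ 2)).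
have sAE : sA = h + a by [].
have sBE : sB = h + b by [].
have aE : a ^+ 2 = h ^+ 2 + (ga ^+ 2 - al ^+ 2) by exact: sqr_sqrtr.
have bE : b ^+ 2 = h ^+ 2 + (ga ^+ 2 - be ^+ 2) by exact: sqr_sqrtr.
have a0 : 0 <= a by exact: sqrtr_ge0.
have b0' : 0 <= b by exact: sqrtr_ge0.
have ba : b <= a by apply: ler_of_sqr => //; nra.
have aga : a <= ga by apply: ler_of_sqr; [lra|nra].
have b34 : 3 / 4 * ga <= b by apply: ler_of_sqr => //; nra.
have dab : (a - b) * ga <= be ^+ 2 by nra.
have dS : (sA - sB) * ga <= be ^+ 2 by rewrite sAE sBE; lra.
have sA0 : 0 < sA by lra.
have sB0 : 0 < sB by lra.
have a1 : 0 < a by lra.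
have b1 : 0 < b by lra.
have dA1 : h / a <= 1 by rewrite ler_pdivrMr//; lra.
have dA2 : -1 <= h / a by rewrite ler_pdivlMr//; lra.
(* The difference is h (b - a) / (a b), where |h| <= ga / 4, a - b <= be^2 / ga and a b >= 9/16
   ga^2. *)
have dAB : h / a - h / b <= be ^+ 2 / ga ^+ 2.
  have -> : h / a - h / b = h * (b - a) / (a * b) by field; rewrite !gt_eqF.
  rewrite ler_pdivrMr ?mulr_gt0//.
  have g2 : 9 / 16 * ga ^+ 2 <= a * b by nra.
  have k1 : h * (b - a) <= 9 / 16 * be ^+ 2.
    have : h * (b - a) <= al * (a - b) by nra.
    have : al * (a - b) <= ga * (a - b) / 4 by nra.
    by have := sqr_ge0 be; lra.
  apply: (le_trans k1); rewrite [leRHS]mulrAC ler_pdivlMr ?exprn_gt0//.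
  by have := ler_wpM2l (sqr_ge0 be) g2; lra.
have qb : 0 <= q * b0 ^+ 2 by rewrite mulr_ge0 ?sqr_ge0.
pose u := Num.sqrt (pos_part (be ^+ 2 - h ^+ 2)).
pose v := Num.sqrt (pos_part (al ^+ 2 - h ^+ 2)).
have u0 : 0 <= u by exact: sqrtr_ge0.
have v0 : 0 <= v by exact: sqrtr_ge0.
have ube : u <= be.
  by apply: sqrt_le_sqr => //; apply: pos_part_le; have := sqr_ge0 h; nra.
have val : v <= al.
  by apply: sqrt_le_sqr => //; apply: pos_part_le; have := sqr_ge0 h; nra.
have YA th : Ystar (al ^+ 2) (ga ^+ 2) (be ^+ 2) sA th = Ymod u v th.
  by rewrite YstarE ?gt_eqF// /Yreg csq_sg.
have YB th : Ystar (be ^+ 2) (ga ^+ 2) (al ^+ 2) sB th = Ymod u v th.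
  by rewrite YstarE ?gt_eqF// /Yreg csq_sg// YmodC.
have pi0 := pi_gt0 R.
set T1 := thint _ _ _ _ sA; set T2 := thint _ _ _ _ sB.
have T12 : T1 <= T2 + 10 * (q * b0 ^+ 2) * be ^+ 2 * (2 * pi).
  have := Rintegral_le_add; rewrite /T1 /T2 /thint => /(_ R 0 (2 * pi)).
  rewrite subr0; apply; first by rewrite mulr_ge0// ltW.
  - by apply: (integrable_Ystar kb); rewrite gt_eqF.
  - by apply: (integrable_Ystar kb); rewrite gt_eqF.
  (* The modulus is common to both sides. [PhiC] moves it to the first slot, and [Phi_diff_le] then
     compares the two values of s. *)
  move=> th _; rewrite -lerBlDl YA YB ![Phi _ _ (_ * Ymod _ _ _)]PhiC.
  have := Ymod_le th u0 v0; have := Ymod_ge0 u v th => Y0 Y1.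
  by apply: (Phi_diff_le kb (ga := ga)) => //; lra.
have T2le : T2 <= 16 * pi * b0 ^+ 2 * ga ^+ 2.
  have -> : 16 * pi * b0 ^+ 2 * ga ^+ 2 = (2 * b0 ^+ 2 * (2 * ga) ^+ 2) * (2 * pi) by ring.
  apply: Rintegral_itv_le.
  - by rewrite mulr_ge0// ltW.
  - by rewrite !mulr_ge0// ltW.
  - by rewrite subr0.
  move=> th _; rewrite YB; apply: (Phi_scaled_le kb); [exact: ltW|exact: Ymod_ge0|].
  by have := Ymod_le th u0 v0; lra.
have T20 : 0 <= T2 by exact: thint_ge0.
have E0 : 0 <= 10 * (q * b0 ^+ 2) * be ^+ 2 * (2 * pi).
  by rewrite !mulr_ge0 ?sqr_ge0// ltW.
have S1 : T1 * (1 + h / a) <= (T2 + 10 * (q * b0 ^+ 2) * be ^+ 2 * (2 * pi)) * (1 + h / a).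
  by rewrite ler_wpM2r//; lra.
apply: (le_trans S1).
have S2 : T2 * (h / a - h / b) <= 16 * pi * b0 ^+ 2 * be ^+ 2.
  apply: (le_trans (ler_wpM2l T20 dAB)).
  rewrite mulrA ler_pdivrMr ?exprn_gt0//.
  by have := ler_wpM2r (sqr_ge0 be) T2le; clear; move: (@pi R) => P; lra.
have S3 : 10 * (q * b0 ^+ 2) * be ^+ 2 * (2 * pi) * (1 + h / a) <=
  10 * (q * b0 ^+ 2) * be ^+ 2 * (2 * pi) * 2 by rewrite ler_wpM2l//; lra.
have S4 : 0 <= pi * b0 ^+ 2 * be ^+ 2 by rewrite !mulr_ge0// ltW.
by move: S2 S3 S4; clear; move: (@pi R) (h / a) (h / b) => P ha hb; lra.
Qed.

(** The pointwise bound 40 pi be^2 times the length 2 al, divided by 4 pi al be ga, is 20 be / ga <=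
    5. *)
Lemma W_diff_acb al be ga : 0 <= al < be -> 4 * be <= ga ->
  W phi (al ^+ 2) (ga ^+ 2) (be ^+ 2) - W phi (be ^+ 2) (ga ^+ 2) (al ^+ 2) <=
    5 * (b0 ^+ 2 * (1 + q)).
Proof.
move=> /andP[al0 albe] bega.
have be0 : 0 < be by lra.
have ga0 : 0 < ga by lra.
have [be0' ga0'] : 0 <= be /\ 0 <= ga by split; exact: ltW.
have B2 : 0 < be ^+ 2 by rewrite exprn_gt0.
have G2 : 0 < ga ^+ 2 by rewrite exprn_gt0.
have BG : be ^+ 2 < ga ^+ 2 by nra.
have b2 := sqr_ge0 b0.
have qb : 0 <= q * b0 ^+ 2 by rewrite mulr_ge0 ?sqr_ge0.
have h : be ^+ 2 <= be * ga / 4 by nra.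
move: (al0); rewrite le_eqVlt => /predU1P[alE|alp].
  rewrite -alE /W expr0n/= !(mulr0, mul0r) ltxx eqxx B2 G2 (gt_eqF B2) (gt_eqF G2)/= BG.
  rewrite (mulrC (ga ^+ 2)) -exprMn !sqrt_2M !sqrt_sqr ?mulr_ge0// -mulrBl.
  rewrite ![Phi phi _ (Num.sqrt 2 * be)]PhiC.
  by have := @Phi_quot_diff _ _ _ _ kb be ga _ be0 bega erefl; lra.
have A2 : 0 < al ^+ 2 by rewrite exprn_gt0.
have xs1 : 0 < xstar (al ^+ 2) (ga ^+ 2) (be ^+ 2).
  by rewrite /xstar ge0_pos_part; nra.
have xs2 : 0 < xstar (be ^+ 2) (ga ^+ 2) (al ^+ 2).
  by rewrite /xstar ge0_pos_part; nra.
rewrite !W_posE ?xstar_gt0_W// !sqrt_sqr3 ?(ltW alp)//.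
have -> : be * ga * al = al * ga * be by ring.
have al1 : 0 <= al <= be by rewrite al0 ltW.
have bega' : be <= ga by lra.
have [-> ->] := range_acb al1 bega'.
have [-> ->] := range_bca al1 bega'.
have A0 : 0 < ga ^+ 2 - al ^+ 2 by nra.
have B0 : 0 < ga ^+ 2 - be ^+ 2 by nra.
have sA0 : 0 < sg (ga ^+ 2 - al ^+ 2) (- al).
  rewrite /sg sqrrN (_ : al ^+ 2 + (ga ^+ 2 - al ^+ 2) = ga ^+ 2); last by ring.
  by rewrite sqrt_sqr//; lra.
have sB0 : 0 < sg (ga ^+ 2 - be ^+ 2) (- al).
  rewrite /sg sqrrN.
  have : 3 / 4 * ga <= Num.sqrt (al ^+ 2 + (ga ^+ 2 - be ^+ 2)).
    by apply: ler_of_sqr; [exact: sqrtr_ge0|rewrite sqr_sqrtr; nra].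
  by lra.
rewrite !(subst_thint kb)// -mulrBr.
have pi0 := pi_gt0 R.
have := @Rintegral_le_add R (- al) al (40 * pi * (b0 ^+ 2 * (1 + q)) * be ^+ 2) _ _ _
  (integrable_subst_thint (al ^+ 2) (ga ^+ 2) (be ^+ 2) A0 sA0)
  (integrable_subst_thint (be ^+ 2) (ga ^+ 2) (al ^+ 2) B0 sB0).
rewrite -lerBlDl => /(_ ltac:(lra)) H.
have S : 0 < 4 * pi * (al * ga * be) by rewrite !mulr_gt0.
rewrite mulrC ler_pdivrMr//; apply: (le_trans (H _)).
  by move=> t tI; apply: thint_diff_acb => //; rewrite al0 albe.
have K : 0 <= 80 * pi * (b0 ^+ 2 * (1 + q)) * al.
  have Q1 : 0 <= 1 + q by rewrite addr_ge0.
  by apply: mulr_ge0 => //; apply: mulr_ge0; apply: mulr_ge0 => //; exact: pi_ge0.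
by have := ler_wpM2l K h; clear; move: (@pi R) => P; lra.
Qed.

End KernelDifferenceACB.

(** * Symmetrization of the cubic operator *)

Record test_function (R : realType) (f : R -> R) : Prop := {
  tf_ge0 : forall x, 0 <= x -> 0 <= f x;
  tf_dec : forall x y, 0 <= x -> x <= y -> f y <= f x;
  tf_conv : forall x y t, 0 <= x -> 0 <= y -> 0 <= t <= 1 ->
    f ((1 - t) * x + t * y) <= (1 - t) * f x + t * f y;
  tf_sqrt : forall x y, 0 <= x -> x <= y ->
    Num.sqrt x * f x <= Num.sqrt y * f y }.

Section SymmetrizedKernel.
Variables (R : realType) (phi : R -> R) (b0 q : R) (f : R -> R).
Hypothesis kb : kernel_bounds phi b0 q.
Hypothesis tf : test_function f.
Let b0_ge0 := kb_b0 kb.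
Let q_ge0 := kb_q kb.
Let f_ge0 := tf_ge0 tf.
Let f_dec := tf_dec tf.
Implicit Types x y z s th al be ga : R.

Lemma xstarC x y z : xstar x y z = xstar x z y.
Proof. by rewrite /xstar (addrC y). Qed.

(** y and x + z - y are the convex combinations of x and z with exchanged weights, so adding the two
    convexity inequalities cancels the weights. *)
Lemma convex_swap x y z : 0 <= x -> x <= y -> y <= z -> f y + f (x + z - y) <= f x + f z.
Proof.
move=> x0 xy yz; have [xz|xz] := eqVneq x z.
  have -> : y = z by lra.
  by rewrite -xz (_ : x + x - x = x) //; ring.
have xz' : 0 < z - x by rewrite subr_gt0 lt_neqAle xz (le_trans xy).
pose t := (y - x) / (z - x).
have t0 : 0 <= t by apply: divr_ge0; lra.
have t1 : t <= 1 by rewrite ler_pdivrMr// mul1r; lra.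
have tz : t * (z - x) = y - x by rewrite divfK// gt_eqF.
have z0 : 0 <= z by lra.
have := tf_conv tf x0 z0 (t := t) ltac:(lra).
have := tf_conv tf x0 z0 (t := 1 - t) ltac:(lra).
have -> : (1 - t) * x + t * z = y by lra.
have -> : (1 - (1 - t)) * x + (1 - t) * z = x + z - y by lra.
lra.
Qed.

(** z - h lies on the segment from z to z / 2 with weight 2 h / z on z / 2, and f (z / 2) <= f x
    because x <= z / 2. *)
Lemma convex_decay x z h : 0 <= x -> 0 <= h -> 2 * h <= z -> 2 * x <= z -> 0 < z ->
  f (z - h) - f z <= 2 * h / z * f x.
Proof.
move=> x0 h0 hz xz z0.
have t1 : 0 <= 2 * h / z <= 1 by apply/andP; split; [apply: divr_ge0; lra|rewrite ler_pdivrMr// mul1r].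
have z20 : 0 <= z / 2 by lra.
have := tf_conv tf (ltW z0) z20 t1.
have -> : (1 - 2 * h / z) * z + 2 * h / z * (z / 2) = z - h by field; rewrite gt_eqF.
have : f (z / 2) <= f x by apply: f_dec => //; lra.
have := f_ge0 (ltW z0).
case/andP: t1; move: (2 * h / z) => t t0 t1 fz0 fx; nra.
Qed.

Lemma Kop_mid_le0 x y z : 0 <= y -> y <= x -> x <= z ->
  Kop phi f x y z <= 0 /\ Kop phi f x z y <= 0.
Proof.
move=> y0 yx xz; rewrite /Kop xstarC.
have D : f x + f (xstar x z y) - f y - f z <= 0.
  rewrite /xstar ge0_pos_part; last by lra.
  by rewrite (addrC z); have := convex_swap y0 yx xz; lra.
split; apply: mulr_ge0_le0 => //; try exact: W_ge0.
by move: D; lra.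
Qed.

(** From x <= y follows [xstar] >= z, so f at [xstar] is absorbed by f z and only f x remains. *)
Lemma Kop_min_le x y z M : 0 <= x -> x <= y -> x <= z ->
  W phi x y z <= M -> Kop phi f x y z <= M * f x.
Proof.
move=> x0 xy xz WM; rewrite /Kop.
have D : f x + f (xstar x y z) - f y - f z <= f x.
  have : f (xstar x y z) <= f z.
    by apply: f_dec; [lra|rewrite /xstar ge0_pos_part; lra].
  by have := f_ge0 (le_trans x0 xy); lra.
apply: (le_trans (ler_wpM2l (W_ge0 _ _ _ _) D)).
by rewrite ler_wpM2r// f_ge0.
Qed.

Lemma Kop_diag x y z : 0 <= y -> 0 <= z -> (x = y) \/ (x = z) -> Kop phi f x y z = 0.
Proof.
move=> y0 z0 [->|->]; rewrite /Kop /xstar ge0_pos_part; try lra.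
  by rewrite (_ : y + z - y = z); [|ring]; rewrite (_ : _ - _ = 0) ?mulr0//; ring.
by rewrite (_ : y + z - z = y); [|ring]; rewrite (_ : _ - _ = 0) ?mulr0//; ring.
Qed.

(** [xstar] is at most m^2, m the smaller of x and y, but may be far smaller, so f at [xstar] is not
    bounded by f (m^2). The kernel bound with half-length sqrt([xstar]) supplies the missing weight,
    and the monotonicity of sqrt x f x applies. The constant is 32 times z / max(x, y) <= 4. *)
Lemma Kop_max_le x y z : 0 < x <= z -> 0 < y <= z -> z <= 4 * Num.max x y ->
  Kop phi f (z ^+ 2) (x ^+ 2) (y ^+ 2) <= 128 * b0 ^+ 2 * f (Num.min x y ^+ 2).
Proof.
move=> /andP[x0 xz] /andP[y0 yz] zm.
have z0 : 0 < z by lra.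
set m := Num.min x y; set M := Num.max x y.
have m0 : 0 < m by rewrite lt_min x0.
have M0 : 0 < M by rewrite lt_max x0.
have mM : x * y = m * M by rewrite /m /M; case: leP => _; rewrite // mulrC.
have Mz : M <= z by rewrite ge_max xz.
have fE : f (x ^+ 2) + f (y ^+ 2) = f (m ^+ 2) + f (M ^+ 2).
  by rewrite /m /M; case: leP => _; rewrite // addrC.
have sE : x ^+ 2 + y ^+ 2 = m ^+ 2 + M ^+ 2.
  by rewrite /m /M; case: leP => _; rewrite // addrC.
set xs := xstar (z ^+ 2) (x ^+ 2) (y ^+ 2).
have xs0 : 0 <= xs by exact: xstar_ge0.
have xsm : xs <= m ^+ 2.
  by rewrite /xs /xstar; apply: pos_part_le; [exact: sqr_ge0|rewrite sE; nra].
have D : f (z ^+ 2) + f xs - f (x ^+ 2) - f (y ^+ 2) <= f xs.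
  have : f (z ^+ 2) <= f (M ^+ 2) by apply: f_dec; [exact: sqr_ge0|nra].
  by have := f_ge0 (sqr_ge0 m); lra.
have Wle : W phi (z ^+ 2) (x ^+ 2) (y ^+ 2) <=
    32 * b0 ^+ 2 * z ^+ 2 * Num.sqrt xs / (z * x * y).
  by apply: (W_le_root kb); rewrite ?z0 ?x0 ?y0 ?lexx//= !ge_min lexx ?orbT.
rewrite /Kop -/xs; apply: (le_trans (ler_wpM2l (W_ge0 _ _ _ _) D)).
apply: (le_trans (ler_wpM2r (f_ge0 xs0) Wle)).
have h := tf_sqrt tf xs0 xsm; rewrite sqrt_sqr in h; last exact: ltW.
have -> : 32 * b0 ^+ 2 * z ^+ 2 * Num.sqrt xs / (z * x * y) * f xs =
  32 * b0 ^+ 2 * (z / (m * M)) * (Num.sqrt xs * f xs).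
  by rewrite -mM; field; rewrite !gt_eqF.
have c0 : 0 <= 32 * b0 ^+ 2 * (z / (m * M)).
  by rewrite !mulr_ge0 ?invr_ge0 ?mulr_ge0 ?(ltW z0) ?(ltW m0) ?(ltW M0).
apply: (le_trans (ler_wpM2l c0 h)).
have -> : 32 * b0 ^+ 2 * (z / (m * M)) * (m * f (m ^+ 2)) =
  z / M * (32 * b0 ^+ 2 * f (m ^+ 2)) by field; rewrite !gt_eqF.
have zM : z / M <= 4 by rewrite ler_pdivrMr.
have c1 : 0 <= 32 * b0 ^+ 2 * f (m ^+ 2) by rewrite !mulr_ge0 ?f_ge0 ?sqr_ge0.
by have := ler_wpM2r c1 zM; lra.
Qed.

Lemma Kop_max_eq0 x y z : 0 <= x -> 0 <= y -> 0 < z -> x + y <= z ->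
  Kop phi f z x y = 0.
Proof.
move=> x0 y0 z0 xyz; rewrite /Kop /W.
have -> : xstar z x y = 0 by rewrite /xstar /pos_part; apply/max_idPr; lra.
rewrite !mul0r ltxx (gt_eqF z0)/= z0/=.
have -> : (z < y) = false by apply/negbTE; rewrite -leNgt; lra.
have -> : (z < x) = false by apply/negbTE; rewrite -leNgt; lra.
by rewrite !andbF mul0r.
Qed.

Lemma Kop_zero2 x y z : [\/ x = 0 /\ y = 0, x = 0 /\ z = 0 | y = 0 /\ z = 0] ->
  0 <= x -> 0 <= y -> 0 <= z -> Kop phi f x y z = 0.
Proof.
move=> H x0 y0 z0; rewrite /Kop; suff -> : W phi x y z = 0 by rewrite mul0r.
rewrite /W; case: H => -[-> ->]; rewrite !(mulr0, mul0r) ltxx ?eqxx ?ltxx /= ?andbF//.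
by have -> : (x < 0) = false by [apply/negbTE; rewrite -leNgt]; rewrite !andbF.
Qed.

(* The positive part W(a,..) (f a - f b) of the first value is compensated by
   the negative part of the second one, up to the kernel difference C. *)
Lemma Kop_pair_le x y z x' y' z' a b c M C :
  0 <= a -> a <= b -> b <= c -> 0 < c -> 2 * b <= c ->
  x = a -> y + z = b + c -> f y + f z = f b + f c ->
  x' = b -> y' + z' = a + c -> f y' + f z' = f a + f c ->
  W phi x y z - W phi x' y' z' <= C -> 0 <= C ->
  W phi x' y' z' * (2 * b / c) <= M ->
  Kop phi f x y z + Kop phi f x' y' z' <= (C + M) * f a.
Proof.
move=> a0 ab bc c0 b2c -> yz fyz -> yz' fyz' WC C0 WM; rewrite /Kop.
rewrite /xstar !ge0_pos_part; try lra.
rewrite yz yz'.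
have -> : f a + f (b + c - a) - f y - f z = (f a - f b) - (f c - f (b + c - a)) by lra.
have -> : f b + f (a + c - b) - f y' - f z' = - (f a - f b) + (f (c - (b - a)) - f c).
  by rewrite (_ : c - (b - a) = a + c - b); [lra|ring].
have W10 := W_ge0 phi a y z; have W20 := W_ge0 phi b y' z'.
have d0 : 0 <= f a - f b by rewrite subr_ge0; apply: f_dec.
have fa := f_ge0 a0; have fb := f_ge0 (le_trans a0 ab).
have e0 : 0 <= f c - f (b + c - a) by rewrite subr_ge0; apply: f_dec; lra.
(* The kernel in front of this increment can be large; the factor 2 b / c gained by convexity
   compensates it, and [M] measures the product. *)
have e1 : f (c - (b - a)) - f c <= 2 * b / c * f a.
  have := @convex_decay a c (b - a) a0 ltac:(lra) ltac:(lra) ltac:(lra) c0.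
  move/le_trans; apply; rewrite ler_wpM2r// ler_pM2r ?invr_gt0//; lra.
have k1 : W phi a y z * (f c - f (b + c - a)) >= 0 by rewrite mulr_ge0.
have k2 : (W phi a y z - W phi b y' z') * (f a - f b) <= C * f a.
  apply: (le_trans (ler_wpM2r d0 WC)); rewrite ler_wpM2l//; lra.
have k3 : W phi b y' z' * (f (c - (b - a)) - f c) <= M * f a.
  apply: (le_trans (ler_wpM2l W20 e1)); rewrite mulrA ler_wpM2r//.
lra.
Qed.

Definition Ksym x y z : R :=
  Kop phi f x y z + Kop phi f x z y + (Kop phi f y x z + Kop phi f y z x) +
  (Kop phi f z x y + Kop phi f z y x).

Lemma Ksym_sorted al be ga : 0 <= al -> al <= be -> be <= ga ->
  Ksym (al ^+ 2) (be ^+ 2) (ga ^+ 2) <= 512 * (b0 ^+ 2 * (1 + q)) * f (al ^+ 2).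
Proof.
move=> al0 albe bega; rewrite /Ksym.
have be0 : 0 <= be by lra.
have ga0 : 0 <= ga by lra.
have A0 := sqr_ge0 al; have B0 := sqr_ge0 be; have G0 := sqr_ge0 ga.
have AB : al ^+ 2 <= be ^+ 2 by nra.
have BG : be ^+ 2 <= ga ^+ 2 by nra.
have fa := f_ge0 A0.
have bq : b0 ^+ 2 * f (al ^+ 2) <= b0 ^+ 2 * (1 + q) * f (al ^+ 2).
  by rewrite -mulrA ler_wpM2l ?sqr_ge0//; have := mulr_ge0 q_ge0 fa; lra.
have bf : 0 <= b0 ^+ 2 * f (al ^+ 2) by rewrite mulr_ge0 ?sqr_ge0.
move: (be0); rewrite le_eqVlt => /predU1P[beE|bep].
  (* Two energies vanish, and by convention so does [W] at every permutation. *)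
  have alE : al = 0 by lra.
  rewrite alE -beE expr0n/=; rewrite !Kop_zero2//; try by [constructor 1|constructor 2|constructor 3].
  by rewrite !addr0; move: bf bq; rewrite alE expr0n/=; lra.
have gap : 0 < ga by lra.
have G2 : 0 < ga ^+ 2 by rewrite exprn_gt0.
have [h4|h4] := ltP ga (4 * be).
  (* Comparable energies: 32 ga / be <= 128. The four values not settled by convexity add up to 4 *
     128 = 512, the constant of the lemma. *)
  have W4 : 32 * b0 ^+ 2 * ga ^+ 2 / (be * ga) <= 128 * b0 ^+ 2.
    rewrite ler_pdivrMr ?mulr_gt0//.
    have : ga ^+ 2 <= 4 * (be * ga) by nra.
    by move=> h; have := ler_wpM2l (sqr_ge0 b0) h; lra.
  have P1 : Kop phi f (al ^+ 2) (be ^+ 2) (ga ^+ 2) <= 128 * b0 ^+ 2 * f (al ^+ 2).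
    apply: Kop_min_le => //; first lra; apply: le_trans W4.
    by apply: (W_le_x kb); lra.
  have P2 : Kop phi f (al ^+ 2) (ga ^+ 2) (be ^+ 2) <= 128 * b0 ^+ 2 * f (al ^+ 2).
    apply: Kop_min_le => //; first lra; apply: le_trans W4.
    by rewrite (mulrC be); apply: (W_le_x kb); lra.
  have [Q1 Q2] := Kop_mid_le0 A0 AB BG.
  have [T1 T2] : Kop phi f (ga ^+ 2) (al ^+ 2) (be ^+ 2) <= 128 * b0 ^+ 2 * f (al ^+ 2) /\
      Kop phi f (ga ^+ 2) (be ^+ 2) (al ^+ 2) <= 128 * b0 ^+ 2 * f (al ^+ 2).
    move: (al0); rewrite le_eqVlt => /predU1P[alE|alp].
      have al2 : al ^+ 2 = 0 by rewrite -alE expr0n.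
      have -> : Kop phi f (ga ^+ 2) (al ^+ 2) (be ^+ 2) = 0 by apply: Kop_max_eq0 => //; lra.
      have -> : Kop phi f (ga ^+ 2) (be ^+ 2) (al ^+ 2) = 0 by apply: Kop_max_eq0 => //; lra.
      by split; lra.
    have mE : Num.min al be = al by apply/min_idPl.
    have ME : Num.max al be = be by apply/max_idPr.
    split; rewrite -{2}mE.
      by apply: Kop_max_le; rewrite ?ME ?alp ?bep//=; lra.
    by rewrite minC; apply: Kop_max_le; rewrite ?(maxC be) ?ME ?alp ?bep//=; lra.
  lra.
(* Now al^2 + be^2 <= ga^2, so [xstar] is 0 when ga^2 comes first. *)
rewrite [Kop phi f (ga ^+ 2) _ _]Kop_max_eq0//; last nra.
rewrite [Kop phi f (ga ^+ 2) _ _]Kop_max_eq0//; last nra.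
move: (albe); rewrite le_eqVlt => /predU1P[abE|ab].
  rewrite abE !(@Kop_diag (be ^+ 2))//; try by [left|right].
  by rewrite !addr0; move: bf bq; rewrite abE; lra.
have Q0 : 0 <= q * b0 ^+ 2 by rewrite mulr_ge0 ?sqr_ge0.
(* The large kernel bound 32 ga / be times 2 be^2 / ga^2 is 64 be / ga <= 16. *)
have WM w : w <= 32 * b0 ^+ 2 * ga ^+ 2 / (be * ga) ->
    w * (2 * be ^+ 2 / ga ^+ 2) <= 16 * b0 ^+ 2.
  have -> : 32 * b0 ^+ 2 * ga ^+ 2 / (be * ga) = 32 * b0 ^+ 2 * ga / be.
    by field; rewrite !gt_eqF.
  move=> wle; have k : 0 <= 2 * be ^+ 2 / ga ^+ 2 by rewrite divr_ge0 ?mulr_ge0.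
  apply: (le_trans (ler_wpM2r k wle)).
  have -> : 32 * b0 ^+ 2 * ga / be * (2 * be ^+ 2 / ga ^+ 2) = 64 * b0 ^+ 2 * be / ga.
    by field; rewrite !gt_eqF.
  rewrite ler_pdivrMr//; have := ler_wpM2l (sqr_ge0 b0) h4; lra.
have alb : 0 <= al < be by rewrite al0.
have R1 : Kop phi f (al ^+ 2) (be ^+ 2) (ga ^+ 2) + Kop phi f (be ^+ 2) (al ^+ 2) (ga ^+ 2)
    <= (4 * (q * b0 ^+ 2) + 16 * b0 ^+ 2) * f (al ^+ 2).
  apply: (@Kop_pair_le _ _ _ _ _ _ (al ^+ 2) (be ^+ 2) (ga ^+ 2)) => //.
  - nra.
  - exact: (W_diff_abc kb).
  - by rewrite mulr_ge0.
  - by apply: WM; apply: (W_le_y kb); lra.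
have R2 : Kop phi f (al ^+ 2) (ga ^+ 2) (be ^+ 2) + Kop phi f (be ^+ 2) (ga ^+ 2) (al ^+ 2)
    <= (5 * (b0 ^+ 2 * (1 + q)) + 16 * b0 ^+ 2) * f (al ^+ 2).
  apply: (@Kop_pair_le _ _ _ _ _ _ (al ^+ 2) (be ^+ 2) (ga ^+ 2)) => //.
  - nra.
  - by rewrite addrC.
  - by rewrite addrC.
  - by rewrite addrC.
  - by rewrite addrC.
  - exact: (W_diff_acb kb).
  - by have := sqr_ge0 b0; lra.
  - by apply: WM; apply: (W_le_z kb); lra.
have qf : 0 <= q * b0 ^+ 2 * f (al ^+ 2) by rewrite mulr_ge0.
lra.
Qed.

Lemma Ksym_le x y z : 0 <= x -> 0 <= y -> 0 <= z ->
  Ksym x y z <= 512 * (b0 ^+ 2 * (1 + q)) * (f x + f y + f z).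
Proof.
have main x1 y1 z1 : 0 <= x1 -> x1 <= y1 -> y1 <= z1 ->
    Ksym x1 y1 z1 <= 512 * (b0 ^+ 2 * (1 + q)) * (f x1 + f y1 + f z1).
  move=> x0 xy yz; have y0 := le_trans x0 xy; have z0 := le_trans y0 yz.
  have := @Ksym_sorted (Num.sqrt x1) (Num.sqrt y1) (Num.sqrt z1) (sqrtr_ge0 _).
  rewrite !sqr_sqrtr// !ler_sqrt// => /(_ xy yz) /le_trans; apply.
  have Q1 : 0 <= 1 + q by rewrite addr_ge0.
  apply: ler_wpM2l.
    by apply: mulr_ge0; [exact: ler0n|apply: mulr_ge0 => //; exact: sqr_ge0].
  by have := f_ge0 y0; have := f_ge0 z0; lra.
have s12 x1 y1 z1 : Ksym x1 y1 z1 = Ksym y1 x1 z1 by rewrite /Ksym; ring.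
have s23 x1 y1 z1 : Ksym x1 y1 z1 = Ksym x1 z1 y1 by rewrite /Ksym; ring.
move=> x0 y0 z0; have [xy|/ltW xy] := leP x y; have [yz|/ltW yz] := leP y z.
- exact: main.
- have [xz|/ltW xz] := leP x z.
    by rewrite s23; have := main _ _ _ x0 xz yz; lra.
  by rewrite s23 s12; have := main _ _ _ z0 xz xy; lra.
- have [xz|/ltW xz] := leP x z.
    by rewrite s12; have := main _ _ _ y0 xy xz; lra.
  by rewrite s12 s23; have := main _ _ _ y0 yz xz; lra.
- by rewrite s23 s12 s23; have := main _ _ _ z0 yz xy; lra.
Qed.

End SymmetrizedKernel.

(** * Measurability of the kernel *)

Section KernelMeasurability.
Variables (R : realType) (phi : R -> R) (b0 q : R).
Hypothesis kb : kernel_bounds phi b0 q.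

Local Notation leb := (@lebesgue_measure R).

Section Combinators.
Context d (T : measurableType d).
Implicit Types f g : T -> R.

(** The inverse is written x (x^2)^(-1), because the real power of exponent -1 is the inverse on
    nonnegative numbers; at 0 both sides are 0. *)
Lemma measurable_funV f : measurable_fun setT f -> measurable_fun setT (fun x => (f x)^-1).
Proof.
move=> mf; rewrite (_ : (fun x => _) = (fun x => f x * (f x ^+ 2) `^ (-1))).
  apply: measurable_funM => //.
  apply: (measurableT_comp (f := @powR R ^~ (-1))); first exact: measurable_powR.
  exact: measurable_funX.
apply/funext => x; rewrite powR_inv1 ?sqr_ge0// expr2.
by have [->|h] := eqVneq (f x) 0; rewrite ?mul0r ?invr0//; field.
Qed.

Lemma measurable_fun_cont (h : R -> R) f :
  continuous h -> measurable_fun setT f -> measurable_fun setT (fun x => h (f x)).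
Proof. by move=> ch mf; apply: measurableT_comp => //; exact: continuous_measurable_fun. Qed.

Lemma measurable_sqrt f : measurable_fun setT f ->
  measurable_fun setT (fun x => Num.sqrt (f x)).
Proof. by apply: measurable_fun_cont => ?; exact: sqrt_continuous. Qed.

Lemma measurable_pos_part f : measurable_fun setT f ->
  measurable_fun setT (fun x => pos_part (f x)).
Proof. by move=> mf; apply: (measurable_maxr mf); exact: measurable_cst. Qed.

Lemma measurable_Phi f g : measurable_fun setT f -> measurable_fun setT g ->
  measurable_fun setT (fun x => Phi phi (f x) (g x)).
Proof.
move=> mf mg; apply: measurable_funX.
by apply: measurable_funD; apply: measurable_fun_cont => //; exact: (kb_cont kb).
Qed.

Lemma measurable_Ystar (x y z s th : T -> R) :
  measurable_fun setT x -> measurable_fun setT y -> measurable_fun setT z ->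
  measurable_fun setT s -> measurable_fun setT th ->
  measurable_fun setT (fun t => Ystar (x t) (y t) (z t) (s t) (th t)).
Proof.
move=> mx my mz ms mth; rewrite /Ystar.
have ms2 : measurable_fun setT (fun t => s t ^+ 2) by exact: measurable_funX.
have mc : measurable_fun setT
    (fun t => (x t - y t + s t ^+ 2) ^+ 2 / (4 * s t ^+ 2)).
  apply: measurable_funM.
    by apply: measurable_funX; apply: measurable_funD => //; exact: measurable_funB.
  by apply: measurable_funV; apply: measurable_funM => //; exact: measurable_cst.
have mu (w : T -> R) : measurable_fun setT w -> measurable_fun setT
    (fun t => Num.sqrt (pos_part (w t - (x t - y t + s t ^+ 2) ^+ 2 / (4 * s t ^+ 2)))).
  by move=> mw; apply: measurable_sqrt; apply: measurable_pos_part; exact: measurable_funB.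
have mcos : measurable_fun setT (fun t => cos (th t)).
  by apply: measurable_fun_cont => // ?; exact: continuous_cos.
have msin : measurable_fun setT (fun t => sin (th t)).
  by apply: measurable_fun_cont => // ?; exact: continuous_sin.
apply: measurable_fun_ifT.
- by apply: measurable_fun_eqr => //; exact: measurable_cst.
- exact: measurable_cst.
- apply: measurable_sqrt; apply: measurable_funD; apply: measurable_funX.
    by apply: measurable_funD; [exact: mu|apply: measurable_funM => //; exact: mu].
  by apply: measurable_funM => //; exact: mu.
Qed.

(** The domain may move with t: it enters the integrand as a cut-off, and Tonelli's theorem gives
    measurability in t. *)
Lemma measurable_Rintegral_section (f : T * R -> R) (b : T * R -> bool) :
  measurable_fun setT f -> measurable_fun setT b -> (forall p, 0 <= f p) ->
  measurable_fun setT (fun t => \int[leb]_(s in [set s | b (t, s)]) f (t, s)).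
Proof.
move=> mf mb f0.
pose g p := ((if b p then f p else 0)%:E : \bar R).
rewrite (_ : (fun t => _) = fine \o (fubini_F leb g)); last first.
  apply/funext => t; rewrite /= /Rintegral /fubini_F; congr fine.
  rewrite integral_mkcond; apply: eq_integral => s _; rewrite patchE /g.
  have -> : (s \in [set s | b (t, s)]) = b (t, s) by apply/idP/idP; rewrite inE.
  by case: (b (t, s)).
apply: measurableT_comp => //.
apply: measurable_fun_fubini_tonelli_F => [|p]; last by rewrite /g lee_fin; case: ifP.
apply/measurable_EFinP; apply: measurable_fun_ifT => //.
Qed.

End Combinators.

Lemma measurable_comp_fst d (T : measurableType d) (f : T -> R) :
  measurable_fun setT f -> measurable_fun setT (fun p : T * R => f p.1).
Proof. by move=> mf; apply: (measurableT_comp mf); exact: measurable_fst. Qed.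

Lemma measurable_thint d (T : measurableType d) (x y z s : T -> R) :
  measurable_fun setT x -> measurable_fun setT y -> measurable_fun setT z ->
  measurable_fun setT s ->
  measurable_fun setT (fun t => thint phi (x t) (y t) (z t) (s t)).
Proof.
move=> mx my mz ms.
rewrite (_ : (fun t => thint _ _ _ _ _) = (fun t =>
  \int[leb]_(th in [set th | 0 <= th <= 2 * pi])
    Phi phi (Num.sqrt 2 * s t) (Num.sqrt 2 * Ystar (x t) (y t) (z t) (s t) th))); last first.
  by apply/funext => t; rewrite /thint set_itvcc.
apply: (@measurable_Rintegral_section _ _
  (fun p : T * R => Phi phi (Num.sqrt 2 * s p.1)
     (Num.sqrt 2 * Ystar (x p.1) (y p.1) (z p.1) (s p.1) p.2))
  (fun p : T * R => 0 <= p.2 <= 2 * pi)).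
- apply: measurable_Phi; apply: measurable_funM; first exact: measurable_cst.
  + exact: measurable_comp_fst.
  + exact: measurable_cst.
  + apply: measurable_Ystar; try exact: measurable_comp_fst; exact: measurable_snd.
- apply: measurable_and; apply: measurable_fun_ler => //.
- by move=> p; exact: Phi_ge0.
Qed.

Lemma measurable_W d (T : measurableType d) (x y z : T -> R) :
  measurable_fun setT x -> measurable_fun setT y -> measurable_fun setT z ->
  measurable_fun setT (fun t => W phi (x t) (y t) (z t)).
Proof.
move=> mx my mz; rewrite /W.
have c0 : measurable_fun [set: T] (fun=> 0 : R) by exact: measurable_cst.
have c2 : measurable_fun [set: T] (fun=> 2 : R) by exact: measurable_cst.
have mxs : measurable_fun setT (fun t => xstar (x t) (y t) (z t)).
  by apply: measurable_pos_part; apply: measurable_funB => //; exact: measurable_funD.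
have mq (u v a b : T -> R) : measurable_fun setT u -> measurable_fun setT v ->
    measurable_fun setT a -> measurable_fun setT b ->
    measurable_fun setT (fun t =>
      Phi phi (Num.sqrt (2 * u t)) (Num.sqrt (2 * v t)) / Num.sqrt (a t * b t)).
  move=> mu mv ma mb; apply: measurable_funM.
    by apply: measurable_Phi; apply: measurable_sqrt; exact: measurable_funM.
  by apply: measurable_funV; apply: measurable_sqrt; exact: measurable_funM.
have meq (u : T -> R) : measurable_fun setT u -> measurable_fun setT (fun t => u t == 0).
  by move=> mu; exact: measurable_fun_eqr.
have mlt (u v : T -> R) : measurable_fun setT u -> measurable_fun setT v ->
  measurable_fun setT (fun t => u t < v t) by move=> mu mv; exact: measurable_fun_ltr.
have msub (u v : T -> R) : measurable_fun setT u -> measurable_fun setT v ->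
  measurable_fun setT (fun t => u t - v t) by move=> mu mv; exact: measurable_funB.
apply: measurable_fun_ifT.
- by apply: mlt => //; do 3! [apply: measurable_funM => //].
- apply: measurable_funM.
    apply: measurable_funV; apply: measurable_funM; first exact: measurable_cst.
    by apply: measurable_sqrt; do 2! [apply: measurable_funM => //].
  rewrite (_ : (fun t => Rintegral _ _ _) = (fun t =>
    \int[leb]_(s in [set s | slo (x t) (y t) (z t) <= s <= shi (x t) (y t) (z t)])
      thint phi (x t) (y t) (z t) s)); last first.
    by apply/funext => t; rewrite set_itvcc.
  apply: (@measurable_Rintegral_section _ T
    (fun p : T * R => thint phi (x p.1) (y p.1) (z p.1) p.2)
    (fun p : T * R => slo (x p.1) (y p.1) (z p.1) <= p.2 <= shi (x p.1) (y p.1) (z p.1))).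
  + by apply: measurable_thint; try exact: measurable_comp_fst; exact: measurable_snd.
  + have mslo : measurable_fun setT (fun t => slo (x t) (y t) (z t)).
      apply: measurable_maxr; apply: measurableT_comp => //.
        by apply: msub; exact: measurable_sqrt.
      by apply: msub; exact: measurable_sqrt.
    have mshi : measurable_fun setT (fun t => shi (x t) (y t) (z t)).
      by apply: measurable_minr; apply: measurable_funD; exact: measurable_sqrt.
    apply: measurable_and; apply: measurable_fun_ler => //.
      exact: (measurable_comp_fst mslo).
    exact: (measurable_comp_fst mshi).
  + by move=> p; exact: thint_ge0.
apply: measurable_fun_ifT.
- apply: measurable_and; first exact: meq.
  by apply: measurable_and; exact: mlt.
- exact: mq.
apply: measurable_fun_ifT.
- apply: measurable_and; first exact: meq.
  by apply: measurable_and; exact: mlt.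
- by apply: mq => //; exact: msub.
apply: measurable_fun_ifT => //.
- apply: measurable_and; first exact: meq.
  by apply: measurable_and; exact: mlt.
- by apply: mq => //; exact: msub.
Qed.

End KernelMeasurability.

(** * Permutation invariance of the triple product measure *)

Section TripleProduct.
Context d (T : measurableType d) (R : realType).
Variable mu : {finite_measure set T -> \bar R}.
Local Notation m3 := ((mu \x mu) \x mu)%E.
Implicit Types f : T * T * T -> \bar R.

(* The library declares [mu \x mu] sigma-finite only for subprobabilities, so
   Fubini on the triple product goes through this named copy of [mu \x mu]. *)
Definition prod2 : set (T * T)%type -> \bar R := (mu \x mu)%E.

HB.instance Definition _ := Measure.on prod2.

Lemma prod2_fin : fin_num_fun prod2.
Proof.
apply: lty_fin_num_fun; rewrite /prod2 -setXTT [ltLHS]product_measure1E//.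
by rewrite lte_mul_pinfty// ?fin_num_measure// -ge0_fin_numE// fin_num_measure.
Qed.

HB.instance Definition _ := Measure_isFinite.Build _ _ _ prod2 prod2_fin.

Lemma measurable_swap12 : measurable_fun [set: T * T * T] (fun w : T * T * T => ((w.1.2, w.1.1), w.2)).
Proof.
apply/measurable_fun_pairP; split; rewrite /comp/=; last exact: measurable_snd.
apply/measurable_fun_pairP; split; rewrite /comp/=.
  exact: (measurableT_comp measurable_snd measurable_fst).
exact: (measurableT_comp measurable_fst measurable_fst).
Qed.

Lemma measurable_swap23 : measurable_fun [set: T * T * T] (fun w : T * T * T => ((w.1.1, w.2), w.1.2)).
Proof.
apply/measurable_fun_pairP; split; rewrite /comp/=.
  apply/measurable_fun_pairP; split; rewrite /comp/=; last exact: measurable_snd.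
  exact: (measurableT_comp measurable_fst measurable_fst).
exact: (measurableT_comp measurable_snd measurable_fst).
Qed.

Lemma integral3E f : measurable_fun setT f -> (forall w, 0 <= f w)%E ->
  (\int[m3]_w f w = \int[mu]_x \int[mu]_y \int[mu]_z f (x, y, z))%E.
Proof.
move=> mf f0; rewrite (@fubini_tonelli1 _ _ _ _ _ prod2 mu f mf f0).
have H := @fubini_tonelli1 _ _ _ _ _ mu mu (fubini_F mu f).
apply: H; first exact: measurable_fun_fubini_tonelli_F.
by move=> w; exact: integral_ge0.
Qed.

Lemma integral3_swap12 f : measurable_fun setT f -> (forall w, 0 <= f w)%E ->
  (\int[m3]_w f ((w.1.2, w.1.1), w.2) = \int[m3]_w f w)%E.
Proof.
move=> mf f0; have ms := measurableT_comp mf measurable_swap12.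
apply: (etrans (integral3E ms (fun w => f0 _))).
apply: (etrans _ (esym (integral3E mf f0))) => /=.
apply: (@fubini_tonelli _ _ _ _ _ mu mu (fun p => \int[mu]_z f (p.2, p.1, z))%E).
- by apply: (@measurable_fun_fubini_tonelli_F _ _ _ _ _ mu _ ms) => w; exact: f0.
- by move=> w; exact: integral_ge0.
Qed.

Lemma integral3_swap23 f : measurable_fun setT f -> (forall w, 0 <= f w)%E ->
  (\int[m3]_w f ((w.1.1, w.2), w.1.2) = \int[m3]_w f w)%E.
Proof.
move=> mf f0; have ms := measurableT_comp mf measurable_swap23.
apply: (etrans (integral3E ms (fun w => f0 _))).
apply: (etrans _ (esym (integral3E mf f0))) => /=.
apply: eq_integral => x _.
apply: (@fubini_tonelli _ _ _ _ _ mu mu (fun p => f (x, p.2, p.1))%E) => //.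
apply: (measurableT_comp mf); apply/measurable_fun_pairP; split; rewrite /comp/=.
  apply/measurable_fun_pairP; split; rewrite /comp/=; last exact: measurable_snd.
  exact: measurable_cst.
exact: measurable_fst.
Qed.

(** Invariance of the measure is tested on nonnegative functions, where Tonelli's theorem proves it
    and composition preserves it. *)
Definition m3_invariant (s : T * T * T -> T * T * T) : Prop :=
  measurable_fun setT s /\
  forall f, measurable_fun setT f -> (forall w, 0 <= f w)%E ->
    (\int[m3]_w f (s w) = \int[m3]_w f w)%E.

Lemma m3_invariant_swap12 : m3_invariant (fun w => ((w.1.2, w.1.1), w.2)).
Proof. by split; [exact: measurable_swap12|exact: integral3_swap12]. Qed.

Lemma m3_invariant_swap23 : m3_invariant (fun w => ((w.1.1, w.2), w.1.2)).
Proof. by split; [exact: measurable_swap23|exact: integral3_swap23]. Qed.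

Lemma m3_invariant_comp s s' : m3_invariant s -> m3_invariant s' ->
  m3_invariant (s \o s').
Proof.
move=> [ms Hs] [ms' Hs']; split; first exact: measurableT_comp.
move=> f mf f0; rewrite -(Hs f)// -(Hs' (f \o s))//=.
exact: measurableT_comp.
Qed.

Lemma m3_invariant_integrable s (g : T * T * T -> R) : m3_invariant s ->
  m3.-integrable setT (EFin \o g) -> m3.-integrable setT (EFin \o (g \o s)).
Proof.
move=> [ms Hs] /integrableP[mg gi]; apply/integrableP; split.
  exact: (measurableT_comp mg ms).
have mng : measurable_fun setT (fun w => `|(g w)%:E|)%E by exact: measurableT_comp.
by rewrite (Hs _ mng).
Qed.

Lemma m3_invariant_Rintegral s (g : T * T * T -> R) : m3_invariant s ->
  measurable_fun setT g -> \int[m3]_w g (s w) = \int[m3]_w g w.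
Proof.
move=> [ms Hs] mg; rewrite /Rintegral; congr fine; rewrite integralE [RHS]integralE.
have mE : measurable_fun setT (EFin \o g) by exact/measurable_EFinP.
congr (_ - _)%E.
  rewrite -(Hs (EFin \o g)^\+%E)//; last exact: measurable_funepos.
  by apply: eq_integral => w _; rewrite !funeposE.
rewrite -(Hs (EFin \o g)^\-%E)//; last exact: measurable_funeneg.
by apply: eq_integral => w _; rewrite !funenegE.
Qed.

(** At least one of the positive and negative parts has infinite integral, so their difference is
    infinite and [fine] sends it to 0. *)
Lemma Rintegral_notin_integrable d' (T' : measurableType d')
    (m : {measure set T' -> \bar R}) (g : T' -> R) : measurable_fun setT g -> ~ m.-integrable setT (EFin \o g) ->
  \int[m]_w g w = 0.
Proof.
move=> mg ni.
have mE : measurable_fun setT (EFin \o g) by exact/measurable_EFinP.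
have : (\int[m]_w `|(EFin \o g) w| = +oo)%E.
  apply/eqP; rewrite eq_le leey/= leNgt; apply/negP => h.
  by apply: ni; apply/integrableP.
under eq_integral do rewrite -[(`|_|)%E]/((abse \o (EFin \o g)) _) fune_abse.
rewrite ge0_integralD//; last 2 first.
- exact: measurable_funepos.
- exact: measurable_funeneg.
have := @integral_ge0 _ _ _ m setT (EFin \o g)^\+%E (fun x _ => funepos_ge0 _ x).
have := @integral_ge0 _ _ _ m setT (EFin \o g)^\-%E (fun x _ => funeneg_ge0 _ x).
have -> : \int[m]_w g w = fine (\int[m]_w (EFin \o g)^\+%E w - \int[m]_w (EFin \o g)^\-%E w)%E.
  by rewrite /Rintegral integralE.
by case: (integral m setT (EFin \o g)^\+%E) => [r| |]; case: (integral m setT (EFin \o g)^\-%E) => [r'| |].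
Qed.

End TripleProduct.

Lemma ler_sixth (R : realFieldType) (I C V : R) :
  6 * I <= C * (3 * V) -> I <= C / 2 * V.
Proof. lra. Qed.

(** * Averaging the cubic integral over the six permutations *)

Section Symmetrization.
Context d (T : measurableType d) (R : realType).
Variable mu : {finite_measure set T -> \bar R}.
Local Notation m3 := ((mu \x mu) \x mu)%E.
Variables (D : set T) (K : T -> T -> T -> R) (g : T -> R) (C : R).
Hypothesis mD : measurable D.
Hypothesis mK : measurable_fun setT (fun w : T * T * T => K w.1.1 w.1.2 w.2).
Hypothesis mg : measurable_fun setT g.
Hypothesis g0 : forall x, D x -> 0 <= g x.
Hypothesis gi : (\int[mu]_(x in D) (g x)%:E < +oo)%E.
Hypothesis C0 : 0 <= C.
Hypothesis symK : forall x y z, D x -> D y -> D z ->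
  K x y z + K x z y + (K y x z + K y z x) + (K z x y + K z y x) <=
    C * (g x + g y + g z).

(** The restriction to the cube of D becomes a symmetric weight, so that permutations of the
    variables act on integrals over the whole space. *)
Let e (x : T) : R := \1_D x.
Let E3 (w : T * T * T) : R := e w.1.1 * e w.1.2 * e w.2.
Let K0 (w : T * T * T) : R := K w.1.1 w.1.2 w.2 * E3 w.
Let G0 (w : T * T * T) : R := g w.1.1 * E3 w.

Let me : measurable_fun setT e.
Proof. exact: measurable_indic. Qed.

Let e_ge0 x : 0 <= e x.
Proof. by rewrite /e indicE. Qed.

Let E3_ge0 w : 0 <= E3 w.
Proof. by rewrite /E3 !mulr_ge0. Qed.

Let mE3 : measurable_fun setT E3.
Proof.
apply: measurable_funM; first apply: measurable_funM.
- exact: (measurableT_comp me (measurableT_comp measurable_fst measurable_fst)).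
- exact: (measurableT_comp me (measurableT_comp measurable_snd measurable_fst)).
- exact: (measurableT_comp me measurable_snd).
Qed.

Let mK0 : measurable_fun setT K0.
Proof. exact: measurable_funM. Qed.

Let mG0 : measurable_fun setT G0.
Proof.
apply: measurable_funM => //.
exact: (measurableT_comp mg (measurableT_comp measurable_fst measurable_fst)).
Qed.

Let ge_ge0 x : 0 <= g x * e x.
Proof.
rewrite /e indicE; case: (boolP (x \in D)) => [/set_mem Dx|_]; last by rewrite mulr0.
by rewrite mulr1 g0.
Qed.

Let G0_ge0 w : 0 <= G0 w.
Proof. by rewrite /G0 /E3 !mulrA mulr_ge0// mulr_ge0// ge_ge0. Qed.

Let NE : (fine (mu D))%:E = mu D.
Proof. by rewrite fineK// fin_num_measure. Qed.

Let gE : (\int[mu]_x (g x * e x)%:E = (\int[mu]_(x in D) g x)%:E)%E.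
Proof.
rewrite /Rintegral fineK; last first.
  by rewrite ge0_fin_numE//; apply: integral_ge0 => x Dx; rewrite lee_fin g0.
rewrite [RHS]integral_mkcond; apply: eq_integral => x _; rewrite patchE /e indicE.
by case: ifP => _; rewrite ?mulr1 ?mulr0.
Qed.

Let intG0 : (\int[m3]_w (G0 w)%:E = (fine (mu D) ^+ 2 * \int[mu]_(x in D) g x)%:E)%E.
Proof.
have mEe : measurable_fun setT (EFin \o e) by exact/measurable_EFinP.
have ie (a : R) : 0 <= a -> (\int[mu]_x (a * e x)%:E = (a * fine (mu D))%:E)%E.
  move=> a0; under eq_integral do rewrite EFinM.
  rewrite ge0_integralZl_EFin//; last by move=> x _; rewrite lee_fin.
  by rewrite integral_indic// setIT EFinM NE.
have mG : measurable_fun setT (EFin \o G0) by exact/measurable_EFinP.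
have GE : (\int[m3]_w (G0 w)%:E = \int[mu]_x \int[mu]_y \int[mu]_z (G0 (x, y, z))%:E)%E.
  have G0E w : (0 <= (EFin \o G0) w)%E by rewrite lee_fin G0_ge0.
  exact: (integral3E mu mG G0E).
rewrite GE.
have -> : (\int[mu]_x \int[mu]_y \int[mu]_z (G0 (x, y, z))%:E =
    \int[mu]_x (fine (mu D) ^+ 2 * (g x * e x))%:E)%E.
  apply: eq_integral => x _.
  have -> : (\int[mu]_y \int[mu]_z (G0 (x, y, z))%:E =
      \int[mu]_y (g x * e x * fine (mu D) * e y)%:E)%E.
    apply: eq_integral => y _; rewrite /G0 /E3/=.
    under eq_integral do rewrite !mulrA.
    rewrite ie; last by apply: mulr_ge0 => //; exact: ge_ge0.
    by congr EFin; ring.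
  rewrite ie; last by apply: mulr_ge0; [exact: ge_ge0|exact: fine_ge0].
  by congr EFin; ring.
under eq_integral do rewrite EFinM.
rewrite ge0_integralZl_EFin ?sqr_ge0//.
- by rewrite gE.
- by move=> x _; rewrite lee_fin ge_ge0.
- by apply/measurable_EFinP; exact: measurable_funM.
Qed.

Let s12 (w : T * T * T) := ((w.1.2, w.1.1), w.2).
Let s23 (w : T * T * T) := ((w.1.1, w.2), w.1.2).
Let i12 : m3_invariant mu s12 := m3_invariant_swap12 mu.
Let i23 : m3_invariant mu s23 := m3_invariant_swap23 mu.

Lemma symmetrized_integral_le :
  \int[m3]_(w in (D `*` D) `*` D) K w.1.1 w.1.2 w.2 <=
    C / 2 * (fine (mu D) ^+ 2 * \int[mu]_(x in D) g x).
Proof.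
have V0 : 0 <= fine (mu D) ^+ 2 * \int[mu]_(x in D) g x.
  by rewrite mulr_ge0 ?sqr_ge0//; exact: Rintegral_ge0.
have -> : \int[m3]_(w in (D `*` D) `*` D) K w.1.1 w.1.2 w.2 = \int[m3]_w K0 w.
  rewrite Rintegral_mkcond; apply: eq_Rintegral => w _; rewrite patchE /K0 /E3 /e !indicE.
  have -> : (w \in (D `*` D) `*` D) = [&& w.1.1 \in D, w.1.2 \in D & w.2 \in D].
    apply/idP/idP.
      by move=> /set_mem[[h1 h2] h3]; rewrite !mem_set.
    by move=> /and3P[/set_mem h1 /set_mem h2 /set_mem h3]; rewrite mem_set.
  by case: (w.1.1 \in D); case: (w.1.2 \in D); case: (w.2 \in D);
    rewrite /= ?(mulr1, mulr0, mul0r).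
(* Integrability of the cubic integrand is not given. When it fails the integral is 0 and
   nonnegativity of the right side suffices. *)
have [iK|niK] := pselect (m3.-integrable setT (EFin \o K0)); last first.
  rewrite (Rintegral_notin_integrable mK0 niK).
  by rewrite mulr_ge0// divr_ge0.
have iG : m3.-integrable setT (EFin \o G0).
  apply/integrableP; split; first exact/measurable_EFinP.
  rewrite (_ : integral _ _ _ = \int[m3]_w (G0 w)%:E)%E; first by rewrite intG0 ltry.
  by apply: eq_integral => w _ /=; rewrite ger0_norm ?G0_ge0.
have VE : \int[m3]_w G0 w = fine (mu D) ^+ 2 * \int[mu]_(x in D) g x.
  by rewrite /Rintegral intG0.
(* Together with the identity and the two swaps, the 3-cycles [i1], [i2] and the last transposition
   [i3] exhaust the permutations. *)
have i1 := m3_invariant_comp i23 i12.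
have i2 := m3_invariant_comp i12 i23.
have i3 := m3_invariant_comp i23 i2.
have iK1 := m3_invariant_integrable i23 iK.
have iK2 := m3_invariant_integrable i12 iK.
have iK3 := m3_invariant_integrable i1 iK.
have iK4 := m3_invariant_integrable i2 iK.
have iK5 := m3_invariant_integrable i3 iK.
have eK1 := m3_invariant_Rintegral i23 mK0.
have eK2 := m3_invariant_Rintegral i12 mK0.
have eK3 := m3_invariant_Rintegral i1 mK0.
have eK4 := m3_invariant_Rintegral i2 mK0.
have eK5 := m3_invariant_Rintegral i3 mK0.
have iG1 := m3_invariant_integrable i12 iG.
have iG2 := m3_invariant_integrable i2 iG.
have eG1 := m3_invariant_Rintegral i12 mG0.
have eG2 := m3_invariant_Rintegral i2 mG0.
have iadd (u v : T * T * T -> R) : m3.-integrable setT (EFin \o u) ->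
    m3.-integrable setT (EFin \o v) -> m3.-integrable setT (EFin \o (fun w => u w + v w)).
  by move=> iu iv; exact: (integrableD measurableT iu iv).
have radd (u v : T * T * T -> R) : m3.-integrable setT (EFin \o u) ->
    m3.-integrable setT (EFin \o v) ->
    \int[m3]_w (u w + v w) = \int[m3]_w u w + \int[m3]_w v w.
  by move=> iu iv; exact: (RintegralD measurableT iu iv).
pose S w := K0 w + (K0 \o s23) w + ((K0 \o s12) w + (K0 \o (s23 \o s12)) w) +
  ((K0 \o (s12 \o s23)) w + (K0 \o (s23 \o (s12 \o s23))) w).
pose H w := G0 w + (G0 \o s12) w + (G0 \o (s12 \o s23)) w.
have a1 := iadd _ _ iK iK1.
have a2 := iadd _ _ iK2 iK3.
have a3 := iadd _ _ iK4 iK5.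
have a4 := iadd _ _ a1 a2.
have iS : m3.-integrable setT (EFin \o S) := iadd _ _ a4 a3.
have b1 := iadd _ _ iG iG1.
have iH : m3.-integrable setT (EFin \o H) := iadd _ _ b1 iG2.
have IS : \int[m3]_w S w = 6 * \int[m3]_w K0 w.
  rewrite /S (radd _ _ a4 a3) (radd _ _ a1 a2) (radd _ _ iK iK1) (radd _ _ iK2 iK3).
  by rewrite (radd _ _ iK4 iK5) /= eK1 eK2 eK3 eK4 eK5; ring.
have IH : \int[m3]_w H w = 3 * \int[m3]_w G0 w.
  by rewrite /H (radd _ _ b1 iG2) (radd _ _ iG iG1) /= eG1 eG2; ring.
have iCH : m3.-integrable setT (EFin \o (fun w => C * H w)).
  exact: (integrableZl measurableT C iH).
have ICH : \int[m3]_w (C * H w) = C * \int[m3]_w H w.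
  by rewrite RintegralZl.
have : \int[m3]_w S w <= \int[m3]_w (C * H w).
  apply: (le_Rintegral measurableT iS iCH) => w _.
  rewrite /S /H /K0 /G0 /= /E3 /s12 /s23 /=.
  case: w => -[x y] z /=; rewrite /e !indicE.
  case: (boolP (x \in D)) => [/set_mem hx|_]; last by rewrite !(mulr0, mul0r, addr0).
  case: (boolP (y \in D)) => [/set_mem hy|_]; last by rewrite !(mulr0, mul0r, addr0).
  case: (boolP (z \in D)) => [/set_mem hz|_]; last by rewrite !(mulr0, mul0r, addr0).
  by rewrite !mulr1; exact: symK.
(* Six equal integrals of the kernel against three of the weight: hence C / 2. *)
by rewrite ICH IS IH VE; exact: ler_sixth.
Qed.

End Symmetrization.

(** * One-sided derivatives and shifted powers *)

Section DerivWithin.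
Variable R : realType.
Implicit Types (A : set R) (g : R -> R) (x l : R).

Lemma deriv_within_is_derive A g x l : nbhs x A -> deriv_within A g x l ->
  is_derive x 1 g l.
Proof.
move=> xA H.
have H' : (h^-1 *: (g (h *: 1 + x) - g x)) @[h --> 0^'] --> l.
  have C : (h + x) @[h --> 0^'] --> within (A `\ x) (nbhs x).
    move=> P; rewrite /within/= => PA.
    have : \forall h \near (0 : R), (A `\ x) (h + x) -> P (h + x).
      have : (h + x) @[h --> (0 : R)] --> (0 + x) by apply: cvgD; [exact: cvg_id|exact: cvg_cst].
      by rewrite add0r => /(_ _ PA).
    have : \forall h \near (0 : R), A (h + x).
      have : (h + x) @[h --> (0 : R)] --> (0 + x) by apply: cvgD; [exact: cvg_id|exact: cvg_cst].
      by rewrite add0r => /(_ _ xA).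
    apply: filterS2 => h hA hP h0; apply: hP; split => //= /eqP.
    by rewrite -subr_eq0 addrK; exact/negP.
  have := cvg_comp _ _ C H; apply: cvg_trans; apply: near_eq_cvg; near=> h => /=.
  by rewrite addrK mulrC /GRing.scale/= mulr1.
apply: DeriveDef; first by apply/cvg_ex; exists l.
exact: cvg_lim H'.
Unshelve. all: by end_near.
Qed.

Lemma is_derive_deriv_within A g x l : is_derive x 1 g l -> deriv_within A g x l.
Proof.
move=> [dg <-]; rewrite /deriv_within.
have C : (y - x) @[y --> within (A `\ x) (nbhs x)] --> (0 : R)^'.
  move=> P /= P0.
  have : (y - x) @[y --> x] --> (x - x) by apply: cvgB; [exact: cvg_id|exact: cvg_cst].
  rewrite subrr => /(_ _ P0) /= Q.
  suff : \forall y \near x, (A `\ x) y -> P (y - x) by [].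
  have {}Q : \forall y \near x, y - x != 0 -> P (y - x) by exact: Q.
  apply: filterS Q => y Py [_ yx]; apply: Py.
  by apply/eqP => /eqP; rewrite subr_eq0 => /eqP.
have := cvg_comp _ _ C dg; apply: cvg_trans; apply: near_eq_cvg; near=> y => /=.
by rewrite /GRing.scale/= mulr1 subrK mulrC.
Unshelve. all: by end_near.
Qed.

Lemma deriv_within_continuous A g x l : deriv_within A g x l -> A x ->
  g y @[y --> within A (nbhs x)] --> g x.
Proof.
move=> H Ax.
have H2 : (g y - g x) @[y --> within (A `\ x) (nbhs x)] --> (0 : R).
  have C : (y - x) @[y --> within (A `\ x) (nbhs x)] --> (0 : R).
    have : (y - x) @[y --> x] --> (x - x) by apply: cvgB; [exact: cvg_id|exact: cvg_cst].
    rewrite subrr => C P /C HP.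
    have {}HP : \forall y \near x, P (y - x) by exact: HP.
    suff : \forall y \near x, (A `\ x) y -> P (y - x) by [].
    by apply: filterS HP => y Py _.
  have := cvgM H C; rewrite mulr0 => M P /M HP.
  have {}HP : \forall y \near x, (A `\ x) y -> P ((g y - g x) / (y - x) * (y - x)) by exact: HP.
  suff : \forall y \near x, (A `\ x) y -> P (g y - g x) by [].
  apply: filterS HP => y Py Axy; have := Py Axy; rewrite divfK// subr_eq0.
  by case: Axy => _ /eqP.
apply/cvgrPdist_lt => e e0.
have /cvgrPdist_lt/(_ e e0) h := H2.
have Q : \forall y \near x, (A `\ x) y -> `|0 - (g y - g x)| < e by exact: h.
suff : \forall y \near x, A y -> `|g x - g y| < e by [].
apply: filterS Q => y Q Ay; have [->|/eqP yx] := eqVneq y x; first by rewrite subrr normr0.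
by have := Q (conj Ay yx); rewrite sub0r opprB.
Qed.

End DerivWithin.

Section PowR.
Variable R : realType.
Implicit Types (a b r x y t p e : R).

(** For t in ]0, 1] and r <= 1 one has t <= t^r; this is applied to a / (a + b) and b / (a + b),
    whose sum is 1. *)
Lemma powR_subadd a b r : 0 <= a -> 0 <= b -> r <= 1 ->
  (a + b) `^ r <= a `^ r + b `^ r.
Proof.
rewrite le_eqVlt => /predU1P[<-|a0]; first by rewrite add0r lerDr powR_ge0.
rewrite le_eqVlt => /predU1P[<-|b0] r1; first by rewrite addr0 lerDl powR_ge0.
have s0 : 0 < a + b by lra.
have H c : 0 < c -> c <= a + b -> c / (a + b) * (a + b) `^ r <= c `^ r.
  move=> c0 cs; have t0 : 0 < c / (a + b) by rewrite divr_gt0.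
  have t1 : 0 < c / (a + b) <= 1 by rewrite t0 ler_pdivrMr// mul1r.
  have := ger1_powR t1 r1 => h.
  have {2}-> : c = c / (a + b) * (a + b) by rewrite divfK// gt_eqF.
  by rewrite [leRHS]powRM ?(ltW t0) ?(ltW s0)// ler_wpM2r// powR_ge0.
have Ha := H a a0 ltac:(lra); have Hb := H b b0 ltac:(lra).
have E : (a + b) `^ r = a / (a + b) * (a + b) `^ r + b / (a + b) * (a + b) `^ r.
  by rewrite -mulrDl -mulrDl divff ?mul1r// gt_eqF.
by rewrite E lerD.
Qed.

Lemma powR_decr x y p : 0 < x -> x <= y -> 0 <= p -> y `^ (- p) <= x `^ (- p).
Proof.
move=> x0 xy p0; have y0 : 0 < y by exact: lt_le_trans xy.
rewrite !powRN lef_pV2 ?posrE ?powR_gt0//.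
by apply: ge0_ler_powR; rewrite ?nnegrE// ltW.
Qed.

(* r^(-p) = exp (- p ln r) >= 1 - p ln r >= 1 - p (r - 1) *)
Lemma powR_tangent x y p : 0 < x -> 0 < y -> 0 <= p ->
  y `^ (- p) * (1 - p * (x / y - 1)) <= x `^ (- p).
Proof.
move=> x0 y0 p0; have r0 : 0 < x / y by rewrite divr_gt0.
have {2}-> : x = y * (x / y) by rewrite mulrC divfK// gt_eqF.
rewrite [leRHS]powRM ?(ltW y0) ?(ltW r0)// ler_wpM2l ?powR_ge0//.
rewrite /powR gt_eqF//; apply: le_trans (expR_ge1Dx _).
have L : ln (x / y) <= x / y - 1.
  have h : 1 + (x / y - 1) = x / y by ring.
  rewrite -{1}h; apply: le_ln1Dx; lra.
have := ler_wpM2l p0 L; lra.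
Qed.

Lemma is_derive_powR_shift a e x : 0 < x + e ->
  is_derive x 1 (fun x => (x + e) `^ a) (a * (x + e) `^ (a - 1)).
Proof.
move=> xe.
have D1 : is_derive x 1 (fun x : R => x + e) 1.
  by apply: is_derive_eq; rewrite addr0.
have I : x + e \in `]0, +oo[ by rewrite in_itv/= xe.
have D2 : is_derive (x + e) 1 (fun x : R => x `^ a) (a * (x + e) `^ (a - 1)).
  by apply: DeriveDef; [exact: derivable_powR|rewrite -derive1E powR_derive1].
have := @is_derive1_comp _ (fun x : R => x `^ a) (fun x : R => x + e) x _ _ D2 D1.
by rewrite mulr1.
Qed.

End PowR.

Section ShiftedPower.
Variables (R : realType) (p e : R).
Hypothesis p_gt0 : 0 < p.
Hypothesis p_le : p <= 2^-1.
Hypothesis e_gt0 : 0 < e.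
Implicit Types x y t : R.

Definition tfun x : R := (x + e) `^ (- p).

Let xe x : 0 <= x -> 0 < x + e.
Proof. by move=> x0; rewrite ltr_wpDl. Qed.

Lemma tfun_ge0 x : 0 <= tfun x.
Proof. exact: powR_ge0. Qed.

Lemma tfun_dec x y : 0 <= x -> x <= y -> tfun y <= tfun x.
Proof. by move=> x0 xy; apply: powR_decr; [exact: xe|rewrite lerD2r|exact: ltW]. Qed.

(** Let t = (x + e) / (y + e) <= 1. As p <= 1/2, t^p >= sqrt t, and y t >= x because x (y + e) <= y
    (x + e). *)
Lemma tfun_sqrt x y : 0 <= x -> x <= y -> Num.sqrt x * tfun x <= Num.sqrt y * tfun y.
Proof.
move=> x0 xy; have y0 : 0 <= y by exact: le_trans xy.
have Xe := xe x0; have Ye := xe y0.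
rewrite /tfun !powRN.
rewrite ler_pdivrMr ?powR_gt0// mulrAC ler_pdivlMr ?powR_gt0//.
have r0 : 0 < (x + e) / (y + e) by rewrite divr_gt0.
have r1 : 0 < (x + e) / (y + e) <= 1 by rewrite r0 ler_pdivrMr// mul1r lerD2r.
have E : (x + e) `^ p = ((x + e) / (y + e)) `^ p * (y + e) `^ p.
  by rewrite -powRM ?(ltW r0) ?(ltW Ye)// divfK// gt_eqF.
rewrite E mulrA ler_wpM2r ?powR_ge0//.
have : ((x + e) / (y + e)) `^ 2^-1 <= ((x + e) / (y + e)) `^ p by exact: ger_powR.
rewrite powR12_sqrt ?(ltW r0)// => h.
apply: le_trans (ler_wpM2l (sqrtr_ge0 y) h).
rewrite -sqrtrM// ler_wsqrtr// mulrA ler_pdivlMr//.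
have := ler_wpM2r (ltW e_gt0) xy; lra.
Qed.

(** Both values lie above the tangent line at the intermediate point m, and the linear parts cancel
    in the weighted sum. *)
Lemma tfun_conv x y t : 0 <= x -> 0 <= y -> 0 <= t <= 1 ->
  tfun ((1 - t) * x + t * y) <= (1 - t) * tfun x + t * tfun y.
Proof.
move=> x0 y0 /andP[t0 t1].
set m := (1 - t) * x + t * y.
have m0 : 0 <= m by rewrite addr_ge0// mulr_ge0// subr_ge0.
have Me := xe m0.
have hx := powR_tangent (xe x0) Me (ltW p_gt0).
have hy := powR_tangent (xe y0) Me (ltW p_gt0).
rewrite -/(tfun _) -/(tfun _) in hx hy.
have t1' : 0 <= 1 - t by rewrite subr_ge0.
have hx' := ler_wpM2l t1' hx; have hy' := ler_wpM2l t0 hy.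
apply: le_trans (lerD hx' hy').
have -> : (1 - t) * (tfun m * (1 - p * ((x + e) / (m + e) - 1))) +
    t * (tfun m * (1 - p * ((y + e) / (m + e) - 1))) =
    tfun m * (1 - p * (((1 - t) * x + t * y + e) / (m + e) - 1)) by ring.
by rewrite -/m divff ?gt_eqF// subrr mulr0 subr0 mulr1.
Qed.

Lemma tfun_test_function : test_function tfun.
Proof.
split.
- by move=> x _; exact: tfun_ge0.
- exact: tfun_dec.
- exact: tfun_conv.
- exact: tfun_sqrt.
Qed.

Lemma measurable_tfun : measurable_fun [set: R] tfun.
Proof.
apply: (measurableT_comp (f := @powR R ^~ (- p))); first exact: measurable_powR.
by apply: measurable_funD => //; exact: measurable_cst.
Qed.

Lemma powR_shift_le a x : 0 <= a -> 0 <= x -> (x + e) `^ (- a) <= e `^ (- a).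
Proof. by move=> a0 x0; apply: powR_decr => //; rewrite lerDr. Qed.

(** The shift e > 0 bounds each negative power on [0, +oo[ by its value at 0; the Lipschitz bound on
    the derivative then follows from the mean value theorem. *)
Lemma tfun_C11b : C11b tfun.
Proof.
exists (fun x => - p * (x + e) `^ (- p - 1)); split; last split; last split.
- move=> x x0; apply: is_derive_deriv_within.
  exact: (is_derive_powR_shift _ (xe x0)).
- exists (e `^ (- p)) => x x0; rewrite ger0_norm ?tfun_ge0//.
  by apply: powR_shift_le => //; exact: ltW.
- exists (p * e `^ (- p - 1)) => x x0.
  rewrite normrM normrN (gtr0_norm p_gt0) ger0_norm ?powR_ge0// ler_pM2l//.
  by rewrite -opprD powR_shift_le//; rewrite addr_ge0// ltW.
exists (p * ((p + 1) * e `^ (- p - 1 - 1))).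
have H x y : 0 <= x -> x <= y ->
    `|- p * (x + e) `^ (- p - 1) - - p * (y + e) `^ (- p - 1)| <=
    p * ((p + 1) * e `^ (- p - 1 - 1)) * `|x - y|.
  move=> x0 xy.
  have D z : z \in `]x, y[ -> is_derive z 1 (fun x => (x + e) `^ (- p - 1))
      ((- p - 1) * (z + e) `^ (- p - 1 - 1)).
    rewrite in_itv/= => /andP[xz _]; apply: is_derive_powR_shift.
    by apply: xe; apply: le_trans (ltW xz).
  have C : {within `[x, y], continuous (fun x => (x + e) `^ (- p - 1))}.
    apply: continuous_in_subspaceT => z; rewrite inE/= in_itv/= => /andP[xz _].
    have D' := @is_derive_powR_shift _ (- p - 1) e z (xe (le_trans x0 xz)).
    by apply: differentiable_continuous; apply/derivable1_diffP; exact: ex_derive.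
  have [z zI E] := MVT_segment xy D C.
  move: zI; rewrite in_itv/= => /andP[xz _].
  have z0 := le_trans x0 xz.
  have -> : - p * (x + e) `^ (- p - 1) - - p * (y + e) `^ (- p - 1) =
    p * ((y + e) `^ (- p - 1) - (x + e) `^ (- p - 1)) by ring.
  rewrite E !normrM (gtr0_norm p_gt0) (distrC y x) !mulrA ler_wpM2r//.
  have p1 : 0 <= p + 1 by rewrite addr_ge0// ltW.
  have N1 : `|- p - 1| = p + 1 by rewrite -opprD normrN ger0_norm.
  rewrite -!mulrA ler_pM2l// N1 ger0_norm ?powR_ge0// ler_wpM2l//.
  have -> : - p - 1 - 1 = - (p + 1 + 1) by ring.
  by apply: powR_shift_le => //; rewrite addr_ge0.
move=> x y x0 y0; have [xy|/ltW xy] := leP x y; first exact: H.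
by rewrite distrC (distrC x); exact: H.
Qed.

(** The bound has to be independent of e: subadditivity of the power 1 - p gives (S + e)^(1-p) -
    e^(1-p) <= S^(1-p). The factor 4 is 2 for the two reflected halves times (1 - p)^(-1) <= 2. *)
Lemma integral_tfun_le S : 0 <= S ->
  (\int[lebesgue_measure]_(x in `[0%R, S]) (tfun x + tfun (S - x))%:E <=
    (4 * S `^ (1 - p))%:E)%E.
Proof.
rewrite le_eqVlt => /predU1P[<-|S0].
  by rewrite set_itv1 integral_set1 lee_fin mulr_ge0// powR_ge0.
have q0 : 0 < 1 - p by have := p_le; lra.
pose F x := (1 - p)^-1 * ((x + e) `^ (1 - p) - (S - x + e) `^ (1 - p)).
have Sx x : x <= S -> 0 < S - x + e by move=> h; apply: xe; rewrite subr_ge0.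
have dF x : 0 < x + e -> 0 < S - x + e -> is_derive x 1 F (tfun x + tfun (S - x)).
  move=> h1 h2.
  have D1 := @is_derive_powR_shift _ (1 - p) e x h1.
  have D2 := @is_derive_powR_shift _ (1 - p) e (S - x) h2.
  have D3 : is_derive x 1 (fun x : R => S - x) (-1).
    by apply: is_derive_eq; rewrite add0r mul1r.
  have D4 := @is_derive1_comp _ (fun x : R => (x + e) `^ (1 - p)) (fun x : R => S - x) x _ _ D2 D3.
  have D5 : is_derive x 1 (fun x : R => (x + e) `^ (1 - p) - (S - x + e) `^ (1 - p))
     ((1 - p) * (x + e) `^ (1 - p - 1) - (1 - p) * (S - x + e) `^ (1 - p - 1) * -1).
    exact: (is_deriveB D1 D4).
  have := @is_deriveZ _ _ _ _ (1 - p)^-1 _ _ _ D5.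
  rewrite /GRing.scale/= /tfun (_ : 1 - p - 1 = - p); last by ring.
  rewrite (_ : (1 - p)^-1 * _ = (x + e) `^ (- p) + (S - x + e) `^ (- p)) //.
  by field; rewrite gt_eqF.
have cF x : 0 <= x <= S -> {for x, continuous F}.
  move=> /andP[x0 xS]; have D := dF x (xe x0) (Sx x xS).
  by apply: differentiable_continuous; apply/derivable1_diffP; exact: ex_derive.
have ct x : 0 < x + e -> {for x, continuous tfun}.
  move=> h; have D := @is_derive_powR_shift _ (- p) e x h.
  by apply: differentiable_continuous; apply/derivable1_diffP; exact: ex_derive.
rewrite (@continuous_FTC2 _ _ F 0 S S0).
- rewrite -EFinD lee_fin /F subrr subr0 !add0r.
  have h1 : (S + e) `^ (1 - p) - e `^ (1 - p) <= S `^ (1 - p).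
    rewrite lerBlDr; apply: powR_subadd; [exact: ltW|exact: ltW|].
    by rewrite gerBl ltW.
  have h2 : (1 - p)^-1 <= 2 by rewrite invf_ple ?posrE//; have := p_le; lra.
  have h3 : 0 <= S `^ (1 - p) by exact: powR_ge0.
  have h4 : 0 < (1 - p)^-1 by rewrite invr_gt0.
  have := ler_wpM2l (ltW h4) h1; have := ler_wpM2r h3 h2; lra.
- apply: continuous_in_subspaceT => x; rewrite inE/= in_itv/= => /andP[x0 xS].
  apply: cvgD; first by apply: ct; exact: xe.
  apply: (@continuous_comp _ _ _ (fun x : R => S - x) tfun).
    by apply: cvgB; [exact: cvg_cst|exact: cvg_id].
  by apply: ct; apply: xe; rewrite subr_ge0.
- split.
  + move=> x; rewrite in_itv/= => /andP[/ltW x0 /ltW xS].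
    by have D := dF x (xe x0) (Sx x xS); exact: ex_derive.
  + by apply: cvg_at_right_filter; apply: cF; rewrite lexx ltW.
  + by apply: cvg_at_left_filter; apply: cF; rewrite lexx ltW.
- move=> x; rewrite in_itv/= => /andP[/ltW x0 /ltW xS].
  have D := dF x (xe x0) (Sx x xS).
  by rewrite derive1E derive_val.
Qed.

End ShiftedPower.

(** * The quadratic term *)

Section QuadraticTerm.
Variables (R : realType) (phi : R -> R) (b0 q p e : R).
Hypothesis kb : kernel_bounds phi b0 q.
Hypothesis p_gt0 : 0 < p.
Hypothesis p_le : p <= 2^-1.
Hypothesis e_gt0 : 0 < e.
Let b0_ge0 := kb_b0 kb.
Implicit Types x y z : R.
Local Notation f := (tfun p e).

Lemma sqrt_add_le_max y z : 0 <= y -> 0 <= z ->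
  Num.sqrt (y + z) <= 2 * Num.max (Num.sqrt y) (Num.sqrt z).
Proof.
move=> y0 z0; apply: sqrt_le_sqr.
  by rewrite mulr_ge0// le_max sqrtr_ge0.
have := sqr_sqrtr y0; have := sqr_sqrtr z0.
have := sqrtr_ge0 y; have := sqrtr_ge0 z.
move: (Num.sqrt y) (Num.sqrt z) => u v v0 u0 vE uE.
rewrite -vE -uE exprMn; case: (leP u v) => h.
  have : u ^+ 2 <= v ^+ 2 by rewrite ler_sqr.
  by have := sqr_ge0 v; lra.
have : v ^+ 2 <= u ^+ 2 by rewrite ler_sqr ?nnegrE// ltW.
by have := sqr_ge0 u; lra.
Qed.

(** For positive energies, [Phi] <= 4 b0^2 and half-length m = min(sqrt y, sqrt z) leave 4 b0^2 /
    max(sqrt y, sqrt z) after cancellation, and sqrt(y + z) is at most twice that maximum. *)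
Lemma W_sqrt_le x y z : 0 <= x -> 0 <= y -> 0 <= z -> 0 < y + z ->
  W phi x y z * Num.sqrt x <= 8 * b0 ^+ 2 / Num.sqrt (y + z).
Proof.
move=> x0 y0 z0 yz0.
have B0 := sqr_ge0 b0.
have P0 : 0 <= 8 * b0 ^+ 2 / Num.sqrt (y + z) by rewrite divr_ge0 ?mulr_ge0 ?sqrtr_ge0.
have S0 : 0 < Num.sqrt (y + z) by rewrite sqrtr_gt0.
move: x0; rewrite le_eqVlt => /predU1P[<-|x0]; first by rewrite sqrtr0 mulr0.
have sx0 : 0 < Num.sqrt x by rewrite sqrtr_gt0.
have quot r rho w : 0 < w ->
    Phi phi r rho / Num.sqrt (x * w) * Num.sqrt x <= 8 * b0 ^+ 2 / Num.sqrt w.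
  move=> w0; have sw : 0 < Num.sqrt w by rewrite sqrtr_gt0.
  rewrite sqrtrM ?(ltW x0)//.
  have -> : Phi phi r rho / (Num.sqrt x * Num.sqrt w) * Num.sqrt x =
    Phi phi r rho / Num.sqrt w by field; rewrite !gt_eqF.
  by rewrite ler_pM2r ?invr_gt0//; have := Phi_le kb r rho; lra.
move: y0; rewrite le_eqVlt => /predU1P[yE|y0].
  have zp : 0 < z by lra.
  rewrite -yE add0r /W !(mulr0, mul0r) ltxx eqxx (gt_eqF x0) x0/=.
  case: ifP => _; first exact: quot.
  by rewrite (gt_eqF zp)/= mul0r; move: P0; rewrite -yE add0r.
move: z0; rewrite le_eqVlt => /predU1P[zE|z0].
  rewrite -zE addr0 /W !(mulr0, mul0r) ltxx eqxx (gt_eqF x0) (gt_eqF y0) x0/=.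
  case: ifP => _; first exact: quot.
  by rewrite mul0r; move: P0; rewrite -zE addr0.
have [xs0|xs0] := eqVneq (xstar x y z) 0.
  by rewrite W_eq0// mul0r.
have xsp : 0 < xstar x y z by rewrite lt0r xs0 xstar_ge0.
set m := Num.min (Num.sqrt y) (Num.sqrt z); set M := Num.max (Num.sqrt y) (Num.sqrt z).
have sy0 : 0 < Num.sqrt y by rewrite sqrtr_gt0.
have sz0 : 0 < Num.sqrt z by rewrite sqrtr_gt0.
have m0 : 0 < m by rewrite lt_min sy0.
have M0 : 0 < M by rewrite lt_max sy0.
have mM : Num.sqrt y * Num.sqrt z = m * M.
  by rewrite /m /M; case: leP => _; rewrite // mulrC.
have Wle : W phi x y z <= m * (4 * b0 ^+ 2) / Num.sqrt (x * y * z).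
  apply: W_pos_le.
  - by rewrite xstar_gt0_W.
  - exact: ltW.
  - by rewrite mulr_ge0.
  - apply: (le_trans (shi_slo _ _ _)); rewrite ler_pM2l//.
    by rewrite /m le_min !ge_min !lexx ?orbT.
  - by move=> s th _; exact: (Phi_le kb).
apply: (le_trans (ler_wpM2r (ltW sx0) Wle)).
have -> : Num.sqrt (x * y * z) = Num.sqrt x * (m * M).
  by rewrite -mM -mulrA sqrtrM ?(ltW x0)// sqrtrM// ltW.
have -> : m * (4 * b0 ^+ 2) / (Num.sqrt x * (m * M)) * Num.sqrt x = 4 * b0 ^+ 2 / M.
  by field; rewrite !gt_eqF.
rewrite ler_pdivrMr// mulrAC ler_pdivlMr//.
have := sqrt_add_le_max (ltW y0) (ltW z0); rewrite -/M => h.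
by have := ler_wpM2l B0 h; lra.
Qed.

(** The negative terms of the collision difference are dropped; 16 is 1/2 times 8 from the kernel
    bound times 4 from the integral of f. *)
Lemma Jop_le y z : 0 <= y -> 0 <= z ->
  Jop phi f y z <= 16 * b0 ^+ 2 * (y + z) `^ (2^-1 - p).
Proof.
move=> y0 z0; rewrite /Jop.
have B0 := sqr_ge0 b0.
have [S0|S0] := eqVneq (y + z) 0.
  by rewrite S0 set_itv1 Rintegral_set1 mulr0 !mulr_ge0// powR_ge0.
have Sp : 0 < y + z by rewrite lt0r S0 addr_ge0.
have sS : 0 < Num.sqrt (y + z) by rewrite sqrtr_gt0.
set S := y + z in S0 Sp sS *.
pose c := 8 * b0 ^+ 2 / Num.sqrt S.
have c0 : 0 <= c by rewrite divr_ge0 ?mulr_ge0// ltW.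
pose g x := f x + f (S - x).
have mg : measurable_fun setT g.
  apply: measurable_funD; first exact: measurable_tfun.
  apply: (measurableT_comp (measurable_tfun p e)).
  by apply: measurable_funB => //; exact: measurable_cst.
have g0 x : 0 <= g x by rewrite addr_ge0// tfun_ge0.
have I1 := integral_tfun_le p_gt0 p_le e_gt0 (ltW Sp).
have I0 : (0 <= \int[lebesgue_measure]_(x in `[0%R, S]) (g x)%:E)%E.
  by apply: integral_ge0 => x _; rewrite lee_fin.
have IF : (\int[lebesgue_measure]_(x in `[0%R, S]) (g x)%:E)%E \is a fin_num.
  by rewrite ge0_fin_numE//; apply: (le_lt_trans I1); rewrite ltry.
have IE : (\int[lebesgue_measure]_(x in `[0%R, S]) (c * g x)%:E =
    c%:E * \int[lebesgue_measure]_(x in `[0%R, S]) (g x)%:E)%E.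
  under eq_integral do rewrite EFinM.
  rewrite ge0_integralZl_EFin//.
  - by move=> x _; rewrite lee_fin.
  - by apply/measurable_EFinP; apply: measurable_funTS.
have H : \int[lebesgue_measure]_(x in `[0, S]) (Kop phi f x y z * Num.sqrt x) <=
    \int[lebesgue_measure]_(x in `[0, S]) (c * g x).
  apply: le_Rintegral_nomeas.
  - by move=> x _; rewrite mulr_ge0.
  - move=> x /=; rewrite in_itv/= => /andP[x0 xS].
    rewrite /Kop mulrAC.
    have -> : xstar x y z = S - x by rewrite /xstar ge0_pos_part// subr_ge0.
    have Ws := W_sqrt_le x0 y0 z0 Sp.
    have W0 : 0 <= W phi x y z * Num.sqrt x by rewrite mulr_ge0 ?W_ge0 ?sqrtr_ge0.
    have D : f x + f (S - x) - f y - f z <= g x.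
      by rewrite /g; have := tfun_ge0 p e y; have := tfun_ge0 p e z; lra.
    apply: (le_trans (ler_wpM2l W0 D)).
    by rewrite ler_wpM2r.
  - by rewrite IE -(fineK IF) -EFinM ltry.
have H2 : \int[lebesgue_measure]_(x in `[0, S]) (c * g x) <= c * (4 * S `^ (1 - p)).
  rewrite /Rintegral IE -(fineK IF) -EFinM /= ler_wpM2l//.
  by rewrite -lee_fin fineK.
have -> : 16 * b0 ^+ 2 * S `^ (2^-1 - p) = 2^-1 * (c * (4 * S `^ (1 - p))).
  have -> : S `^ (1 - p) = Num.sqrt S * S `^ (2^-1 - p).
    rewrite -powR12_sqrt ?(ltW Sp)// -powRD; last by apply/implyP => _; rewrite gt_eqF.
    by congr (_ `^ _); field.
  by rewrite /c; field; rewrite gt_eqF.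
by rewrite ler_pM2l ?invr_gt0//; exact: le_trans H2.
Qed.

End QuadraticTerm.

(** * The kernel assumption *)

Section KernelAssumption.
Variables (R : realType) (phi k dk : R -> R) (b0 eta : R).
Hypothesis HK : kernel_assumption phi b0 eta k dk.

(* The hypotheses on phi concern [0, +oo[ only; this extension is continuous on
   the whole line and defines the same kernel W. *)
Definition phi_ext (r : R) : R := phi (Num.max r 0).

Lemma phi_extE r : 0 <= r -> phi_ext r = phi r.
Proof. by move=> r0; rewrite /phi_ext; congr phi; apply/max_idPl. Qed.

Lemma continuous_phi_ext : continuous phi_ext.
Proof.
have [cphi _] := HK; move=> r.
have max0 s : 0 <= Num.max s 0 :> R by rewrite le_max lexx orbT.
have Ar : Rge0 (Num.max r 0) by rewrite /Rge0/= in_itv/= max0.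
have cm : {for r, continuous (fun s : R => Num.max s 0)}.
  by apply: (@continuous_max _ _ id (fun=> 0)); [exact: cvg_id|exact: cvg_cst].
have /subspace_continuousP/(_ _ Ar) H := cphi.
move=> P /H HP.
have {}HP : \forall y \near Num.max r 0, Rge0 y -> P (phi y) by exact: HP.
have := cm _ HP; rewrite /= => Q.
have {}Q : \forall s \near r, Rge0 (Num.max s 0) -> P (phi (Num.max s 0)) by exact: Q.
suff : \forall s \near r, P (phi_ext s) by [].
by apply: filterS Q => s; apply; rewrite /Rge0/= in_itv/= max0.
Qed.

Let sqrt2_gt1 : 1 < Num.sqrt 2 :> R.
Proof. by rewrite -{1}sqrtr1 ltr_sqrt// ltr1n. Qed.

Let I12 : set R := `[1, Num.sqrt 2].

Lemma continuous_k : {within I12, continuous k}.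
Proof.
have [_ [_ [_ [_ [_ [dK _]]]]]] := HK.
by apply/subspace_continuousP => x Ax; apply: (deriv_within_continuous (dK _ _)).
Qed.

(** By the extreme value theorem the set in [q1] is bounded above, which is what makes its [sup] an
    upper bound. *)
Lemma q1_ubound x : I12 x -> Num.max (2 * k x * dk x) 0 <= q1 k dk.
Proof.
have [_ [_ [_ [_ [_ [_ [cdk _]]]]]]] := HK; move=> Ax.
apply: sup_ubound; last by exists x.
have c : {within I12, continuous (fun x => 2 * k x * dk x)}.
  have ck := continuous_k.
  move=> y; apply: cvgM; last exact: cdk.
  by apply: cvgM; [exact: cvg_cst|exact: ck].
have [z _ zM] := EVT_max (ltW sqrt2_gt1) c.
exists (Num.max (2 * k z * dk z) 0) => _ [y Ay <-].
by rewrite ge_max !le_max lexx orbT andbT zM.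
Qed.

Lemma q1_ge0 : 0 <= q1 k dk.
Proof.
have A1 : I12 1 by rewrite /I12/= in_itv/= lexx ltW.
by apply: le_trans (q1_ubound A1); rewrite le_max lexx orbT.
Qed.

(** [q1] bounds the derivative 2 k k' of k^2, so the mean value theorem gives k(al)^2 <= 1 + q1 (al
    - 1); if k(al) > 1 then k(al) <= k(al)^2. *)
Lemma k_le al : 1 < al <= Num.sqrt 2 -> k al <= 1 + q1 k dk * (al - 1).
Proof.
move=> /andP[al1 al2].
have [_ [_ [_ [_ [_ [dK [_ [k1 _]]]]]]]] := HK.
have D x : x \in `]1, al[ -> is_derive x 1 (fun x => k x ^+ 2) (2 * k x * dk x).
  rewrite in_itv/= => /andP[x1 x2].
  have Ix : x \in `[1, Num.sqrt 2] by rewrite in_itv/= (ltW x1) (ltW (lt_le_trans x2 al2)).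
  have N : nbhs x I12.
    have := @near_in_itvoo R 1 al x; rewrite in_itv/= x1 x2 => /(_ isT).
    apply: filterS => y; rewrite /I12/= !in_itv/= => /andP[y1 y2].
    by rewrite (ltW y1) (ltW (lt_le_trans y2 al2)).
  have Dx := deriv_within_is_derive N (dK _ Ix).
  apply: is_derive_eq.
  by rewrite /GRing.scale/=; ring.
have C : {within `[1, al], continuous (fun x => k x ^+ 2)}.
  have ck : {within `[1, al], continuous k}.
    apply: continuous_subspaceW continuous_k => y; rewrite /I12/= !in_itv/= => /andP[-> h].
    exact: le_trans al2.
  by move=> y; apply: cvgM; exact: ck.
have [c cI E] := MVT al1 D C.
have Ic : I12 c.
  move: cI; rewrite /I12/= !in_itv/= => /andP[c1 c2].
  by rewrite (ltW c1) (ltW (lt_le_trans c2 al2)).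
have qc := q1_ubound Ic.
have qc' : 2 * k c * dk c <= q1 k dk by apply: le_trans qc; rewrite le_max lexx.
have al0 : 0 <= al - 1 by rewrite subr_ge0 ltW.
have H : k al ^+ 2 <= 1 + q1 k dk * (al - 1).
  have : k al ^+ 2 - k 1 ^+ 2 <= q1 k dk * (al - 1) by rewrite E ler_wpM2r.
  by rewrite k1 expr1n; lra.
have q0 := mulr_ge0 q1_ge0 al0.
have [h|h] := leP (k al) 1; first by lra.
by apply: le_trans H; nra.
Qed.

Lemma phi_ext_kernel_bounds : kernel_bounds phi_ext b0 (q1 k dk).
Proof.
have [_ [_ [b00 [eta1 [phib [_ [_ [_ phik]]]]]]]] := HK.
have max0 s : 0 <= Num.max s 0 :> R by rewrite le_max lexx orbT.
have le1 (s : R) : 0 <= s -> s / (1 + s) <= 1 by move=> s0; rewrite ler_pdivrMr; lra.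
have le2 (s : R) : 0 <= s -> s / (1 + s) <= s by move=> s0; rewrite ler_pdivrMr; nra.
split.
- exact: continuous_phi_ext.
- exact: ltW.
- exact: q1_ge0.
- by move=> r; have /andP[] := phib _ (max0 r).
- move=> r; have /andP[_ /le_trans] := phib _ (max0 r); apply.
  by rewrite ger_pMr// le1// powR_ge0.
- move=> r r0; rewrite phi_extE//; have /andP[_ /le_trans] := phib _ r0; apply.
  (* For r > 1 the quotient is at most 1 < r; for r <= 1 it is at most r^eta <= r since eta >= 1. *)
  rewrite ler_pM2l//; have [r1|r1] := leP r 1; last first.
    by apply: le_trans (ltW r1); exact/le1/powR_ge0.
  apply: (le_trans (le2 _ (powR_ge0 _ _))).
  move: r0; rewrite le_eqVlt => /predU1P[<-|r0].
    by rewrite powR0// gt_eqF//; lra.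
  by apply: ge1r_powR => //; rewrite r0.
- move=> r al r0 /andP[al1 al2].
  have al0 : 0 < al by lra.
  rewrite !phi_extE ?mulr_ge0 ?(ltW r0) ?(ltW al0)//.
  move: al1; rewrite le_eqVlt => /predU1P[<-|al1].
    by rewrite mul1r subrr mulr0 addr0 mul1r.
  have al12 : 1 < al <= Num.sqrt 2 by rewrite al1.
  apply: (le_trans (phik _ _ r0 al12)); rewrite ler_wpM2r//.
    by have /andP[] := phib _ (ltW r0).
  exact: k_le.
Qed.

Lemma W_phi_ext x y z : W phi_ext x y z = W phi x y z.
Proof.
have E r rho : 0 <= r -> 0 <= rho -> Phi phi_ext r rho = Phi phi r rho.
  by move=> r0 rho0; rewrite /Phi !phi_extE.
rewrite /W; case: ifP => _.
  congr (_ * _); apply: eq_Rintegral => s; rewrite inE/= in_itv/= => /andP[s1 _].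
  have s0 : 0 <= s by apply: le_trans s1; rewrite le_max normr_ge0.
  apply: eq_Rintegral => th _; apply: E; rewrite mulr_ge0 ?sqrtr_ge0//.
  exact: Ystar_ge0.
by rewrite !E ?sqrtr_ge0.
Qed.

End KernelAssumption.

(** * Moments *)

Section ProductIntegral.
Context d (T : measurableType d) (R : realType).
Variable mu : {finite_measure set T -> \bar R}.
Variables (D : set T) (g : T -> R).
Hypothesis mD : measurable D.
Hypothesis mg : measurable_fun setT g.
Hypothesis g0 : forall x, D x -> 0 <= g x.
Hypothesis gi : (\int[mu]_(x in D) (g x)%:E < +oo)%E.

Lemma integral_prod_sum :
  (\int[mu \x mu]_(w in D `*` D) (g w.1 + g w.2)%:E =
    (2 * (fine (mu D) * \int[mu]_(x in D) g x))%:E)%E.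
Proof.
pose e (x : T) : R := \1_D x.
have me : measurable_fun setT e by exact: measurable_indic.
have e0 x : 0 <= e x by rewrite /e indicE.
have ge0 x : 0 <= g x * e x.
  rewrite /e indicE; case: (boolP (x \in D)) => [/set_mem Dx|_]; last by rewrite mulr0.
  by rewrite mulr1 g0.
have NE : (fine (mu D))%:E = mu D by rewrite fineK// fin_num_measure.
have N0 : 0 <= fine (mu D) by exact: fine_ge0.
have gE : (\int[mu]_x (g x * e x)%:E = (\int[mu]_(x in D) g x)%:E)%E.
  rewrite /Rintegral fineK; last first.
    by rewrite ge0_fin_numE//; apply: integral_ge0 => x Dx; rewrite lee_fin g0.
  rewrite [RHS]integral_mkcond; apply: eq_integral => x _; rewrite patchE /e indicE.
  by case: ifP => _; rewrite ?mulr1 ?mulr0.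
have ie (a : R) : 0 <= a -> (\int[mu]_x (a * e x)%:E = (a * fine (mu D))%:E)%E.
  move=> a0; under eq_integral do rewrite EFinM.
  rewrite ge0_integralZl_EFin//.
  - by rewrite integral_indic// setIT EFinM NE.
  - by move=> x _; rewrite lee_fin.
  - exact/measurable_EFinP.
have ig (a : R) : 0 <= a -> (\int[mu]_x (a * (g x * e x))%:E = (a * \int[mu]_(x in D) g x)%:E)%E.
  move=> a0; under eq_integral do rewrite EFinM.
  rewrite ge0_integralZl_EFin//.
  - by rewrite gE EFinM.
  - by move=> x _; rewrite lee_fin.
  - by apply/measurable_EFinP; exact: measurable_funM.
pose G (w : T * T) := ((g w.1 * e w.1) * e w.2 + e w.1 * (g w.2 * e w.2)).
have -> : (\int[mu \x mu]_(w in D `*` D) (g w.1 + g w.2)%:E = \int[mu \x mu]_w (G w)%:E)%E.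
  rewrite integral_mkcond; apply: eq_integral => w _; rewrite patchE /G /e !indicE.
  have -> : (w \in D `*` D) = (w.1 \in D) && (w.2 \in D).
    apply/idP/idP; first by move=> /set_mem[h1 h2]; rewrite !mem_set.
    by move=> /andP[/set_mem h1 /set_mem h2]; rewrite mem_set.
  by case: (w.1 \in D); case: (w.2 \in D); rewrite /= ?(mulr1, mulr0, mul0r, mul1r, addr0).
have G0 w : (0 <= (EFin \o G) w)%E by rewrite lee_fin addr_ge0// mulr_ge0.
have m1 : measurable_fun setT (fun w : T * T => g w.1 * e w.1).
  by apply: (measurableT_comp (f := fun x => g x * e x)); [exact: measurable_funM|exact: measurable_fst].
have m2 : measurable_fun setT (fun w : T * T => g w.2 * e w.2).
  by apply: (measurableT_comp (f := fun x => g x * e x)); [exact: measurable_funM|exact: measurable_snd].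
have m3 : measurable_fun setT (fun w : T * T => e w.1) by exact: (measurableT_comp me measurable_fst).
have m4 : measurable_fun setT (fun w : T * T => e w.2) by exact: (measurableT_comp me measurable_snd).
have mG : measurable_fun setT (EFin \o G).
  by apply/measurable_EFinP; apply: measurable_funD; exact: measurable_funM.
have -> : (\int[mu \x mu]_w (G w)%:E = \int[mu]_x \int[mu]_y (G (x, y))%:E)%E.
  exact: (@fubini_tonelli1 _ _ _ _ _ mu mu _ mG G0).
have -> : (\int[mu]_x \int[mu]_y (G (x, y))%:E =
    \int[mu]_x ((fine (mu D) * (g x * e x))%:E + ((\int[mu]_(x in D) g x) * e x)%:E))%E.
  apply: eq_integral => x _; rewrite /G /=.
  under eq_integral do rewrite EFinD.
  rewrite ge0_integralD//.
  - by rewrite ie ?ge0// ig// (mulrC (fine _)) (mulrC (e x)).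
  - by move=> y _; rewrite lee_fin mulr_ge0.
  - by apply/measurable_EFinP; apply: measurable_funM => //; exact: measurable_cst.
  - by move=> y _; rewrite lee_fin mulr_ge0.
  - apply/measurable_EFinP; apply: measurable_funM; first exact: measurable_cst.
    exact: measurable_funM.
have I0 : 0 <= \int[mu]_(x in D) g x by exact: Rintegral_ge0.
rewrite ge0_integralD//.
- by rewrite ig// ie// -EFinD; congr EFin; ring.
- by move=> y _; rewrite lee_fin mulr_ge0.
- apply/measurable_EFinP; apply: measurable_funM; first exact: measurable_cst.
  exact: measurable_funM.
- by move=> y _; rewrite lee_fin mulr_ge0.
- by apply/measurable_EFinP; apply: measurable_funM => //; exact: measurable_cst.
Qed.

End ProductIntegral.

Section Moments.
Variable R : realType.

(** The right side is the tangent line to x^r at la. It comes from Young's inequality for (x / la)^r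
    and 1 with exponents 1 / r and 1 / (1 - r). *)
Lemma powR_young (r x la : R) : 0 < r < 1 -> 0 <= x -> 0 < la ->
  x `^ r <= la `^ r * (1 - r) + la `^ r * r / la * x.
Proof.
move=> /andP[r0 r1] x0 la0.
have t0 : 0 <= x / la by rewrite divr_ge0// ltW.
have r1' : 0 < 1 - r by rewrite subr_gt0.
have E : r^-1^-1 + (1 - r)^-1^-1 = 1 by rewrite !invrK; ring.
have := conjugate_powR (powR_ge0 (x / la) r) (ler01 : 0 <= 1 :> R) (_ : 0 < r^-1) (_ : 0 < (1 - r)^-1) E.
rewrite !invr_gt0 => /(_ r0 r1').
rewrite mulr1 -powRrM mulfV ?gt_eqF// powRr1// powR1 !invrK mul1r => h.
have xE : x = la * (x / la) by rewrite mulrC divfK// gt_eqF.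
rewrite {1}xE powRM ?(ltW la0)//.
apply: (le_trans (ler_wpM2l (powR_ge0 la r) h)).
by rewrite le_eqVlt; apply/orP; left; apply/eqP; ring.
Qed.

(** Hölder's inequality, obtained by integrating the tangent line at la and choosing la = E / N. *)
Lemma moment_interpolation (mu : {finite_measure set R -> \bar R}) (r : R) :
  0 <= r < 1 -> (\int[mu]_(x in @Rge0 R) x%:E < +oo)%E ->
  (\int[mu]_(x in @Rge0 R) (x `^ r)%:E <=
   (fine (mu (@Rge0 R)) `^ (1 - r) * (\int[mu]_(x in @Rge0 R) x) `^ r)%:E)%E.
Proof.
move=> /andP[r0 r1] Ei.
set N := fine _; set E := Rintegral _ _ _.
have mD : measurable (@Rge0 R) by exact: measurable_itv.
have NE : N%:E = mu (@Rge0 R) by rewrite fineK// fin_num_measure.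
have N0 : 0 <= N by exact: fine_ge0.
have D0 x : @Rge0 R x -> 0 <= x by rewrite /Rge0/= in_itv/= andbT.
have EE : (\int[mu]_(x in @Rge0 R) x%:E = E%:E)%E.
  rewrite /E /Rintegral fineK// ge0_fin_numE//.
  by apply: integral_ge0 => x Dx; rewrite lee_fin D0.
have E0 : 0 <= E by apply: Rintegral_ge0.
move: r0; rewrite le_eqVlt => /predU1P[<-|r0].
  under eq_integral do rewrite powRr0.
  by rewrite integral_cst// subr0 powRr1// powRr0 mulr1 mul1e NE.
have B (la : R) : 0 < la -> (\int[mu]_(x in @Rge0 R) (x `^ r)%:E <=
    (la `^ r * (1 - r) * N + la `^ r * r / la * E)%:E)%E.
  move=> la0.
  have c1 : 0 <= la `^ r * (1 - r) by rewrite mulr_ge0 ?powR_ge0// subr_ge0 ltW.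
  have c2 : 0 <= la `^ r * r / la by rewrite divr_ge0 ?mulr_ge0 ?powR_ge0// ltW.
  have -> : ((la `^ r * (1 - r) * N + la `^ r * r / la * E)%:E =
     \int[mu]_(x in @Rge0 R) ((la `^ r * (1 - r))%:E + (la `^ r * r / la)%:E * x%:E))%E.
    rewrite ge0_integralD//.
    - by rewrite integral_cst// ge0_integralZl_EFin// EE EFinD !EFinM NE.
    - by move=> x Dx; rewrite -EFinM lee_fin mulr_ge0// D0.
    - by apply: measurable_funeM; apply/measurable_EFinP.
  apply: ge0_le_integral_nomeas => x Dx; first by rewrite lee_fin powR_ge0.
  by rewrite -EFinM -EFinD lee_fin powR_young ?r0// D0.
have rfin : (\int[mu]_(x in @Rge0 R) (x `^ r)%:E)%E \is a fin_num.
  rewrite ge0_fin_numE; last by apply: integral_ge0 => x _; rewrite lee_fin powR_ge0.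
  by apply: (le_lt_trans (B 1 ltr01)); rewrite ltry.
rewrite -(fineK rfin) lee_fin; set X := fine _.
have r1' : 0 < 1 - r by rewrite subr_gt0.
(* N or E may vanish, so la is (E + de) / (N + de) with de tending to 0; subadditivity then
   separates de from N and E. *)
have B' (de : R) : 0 < de -> X <= (N `^ (1 - r) + de `^ (1 - r)) * (E `^ r + de `^ r).
  move=> de0; have Nd : 0 < N + de by rewrite ltr_wpDl.
  have Ed : 0 < E + de by rewrite ltr_wpDl.
  have la0 : 0 < (E + de) / (N + de) by rewrite divr_gt0.
  have := B _ la0; rewrite -(fineK rfin) lee_fin -/X; set la := (E + de) / (N + de).
  move=> h.
  have lr := powR_ge0 la r.
  have h2 : X <= la `^ r * (N + de).
    apply: (le_trans h).
    have k1 : la `^ r * (1 - r) * N <= la `^ r * (1 - r) * (N + de).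
      by rewrite ler_wpM2l ?lerDl ?(ltW de0)// mulr_ge0// ltW.
    have k2 : la `^ r * r / la * E <= la `^ r * r / la * (E + de).
      apply: ler_wpM2l; last by rewrite lerDl ltW.
      by apply: divr_ge0; [apply: mulr_ge0 => //|]; exact: ltW.
    apply: (le_trans (lerD k1 k2)).
    have -> : la `^ r * r / la * (E + de) = la `^ r * r * (N + de).
      by rewrite /la; field; rewrite !gt_eqF.
    by rewrite le_eqVlt; apply/orP; left; apply/eqP; ring.
  apply: (le_trans h2).
  have -> : la `^ r * (N + de) = (N + de) `^ (1 - r) * (E + de) `^ r.
    rewrite /la powRM ?(ltW Ed) ?invr_ge0 ?(ltW Nd)//.
    rewrite -[(N + de)^-1]powR_inv1 ?(ltW Nd)// -powRrM mulN1r.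
    have -> : (N + de) `^ (1 - r) = (N + de) `^ (- r) * (N + de).
      have Nd' : 0 <= N + de by exact: ltW.
      rewrite (addrC 1) (@powRD _ (N + de) (- r) 1); first by rewrite powRr1.
      by apply/implyP => _; rewrite gt_eqF.
    by ring.
  apply: ler_pM; rewrite ?powR_ge0//; apply: powR_subadd; rewrite ?(ltW de0)//.
  - by rewrite gerBl ltW.
  - exact: ltW.
have L : ((N `^ (1 - r) + de `^ (1 - r)) * (E `^ r + de `^ r)) @[de --> 0^'+] -->
    (N `^ (1 - r) + 0) * (E `^ r + 0).
  by apply: cvgM; apply: cvgD; try exact: cvg_cst; exact: powR_cvg0.
rewrite !addr0 in L.
rewrite -(cvg_lim _ L)//; apply: limr_ge; first by apply/cvg_ex; eexists; exact: L.
near=> de; apply: B'; near: de; exact: nbhs_right_gt.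
Unshelve. all: by end_near.
Qed.

End Moments.

(** * Gronwall estimate and passage to the limit *)

Lemma gronwall_within (R : realType) (G h : R -> R) (a b : R) : 0 <= a -> 0 <= b ->
  (forall t, 0 <= t -> deriv_within (@Rge0 R) G t (h t)) ->
  (forall t, 0 <= t -> h t <= a + b * G t) ->
  forall t, 0 <= t -> G t <= (a * t + G 0) * expR (b * t).
Proof.
move=> a0 b0 dG hG t; rewrite le_eqVlt => /predU1P[<-|t0].
  by rewrite !mulr0 add0r expR0 mulr1.
have R0 s : 0 <= s -> @Rge0 R s by move=> s0; rewrite /Rge0/= in_itv/= s0.
(* The derivative of u is at most a (exp(-b s) - 1) <= 0. Subtracting a s yields the factor a t of
   the conclusion. *)
pose u (s : R) : R := expR (- b * s) * G s - a * s.
have De (s : R) : is_derive s 1 (fun s : R => expR (- b * s)) (- b * expR (- b * s)).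
  have D1 : is_derive s 1 (fun s : R => - b * s) (- b).
    by apply: is_derive_eq; exact: mulr1.
  have D2 := is_derive_expR (- b * s).
  have := @is_derive1_comp _ expR (fun s : R => - b * s) s _ _ D2 D1.
  by rewrite mulrC.
have Du (s : R) : s \in `]0, t[ ->
    is_derive s 1 u (expR (- b * s) * (h s - b * G s) - a).
  rewrite in_itv/= => /andP[s0 _].
  have N : nbhs s (@Rge0 R).
    have := @lt_nbhsr R 0 s s0; apply: filterS => y y0; exact/R0/ltW.
  have D := deriv_within_is_derive N (dG s (ltW s0)); have D' := De s.
  apply: is_derive_eq; rewrite /GRing.scale/=; ring.
have Cu : {within `[0, t], continuous u}.
  have CG : {within `[0, t], continuous G}.
    apply: (@continuous_subspaceW _ _ _ (@Rge0 R)).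
      by move=> y /=; rewrite in_itv/= => /andP[y0 _]; exact: R0.
    apply/subspace_continuousP => s As.
    by apply: (deriv_within_continuous (dG s _)) => //; move: As; rewrite /Rge0/= in_itv/= andbT.
  have Ce : {within `[0, t], continuous (fun s : R => expR (- b * s))}.
    apply: continuous_subspaceT => s; have D' := De s.
    by apply: differentiable_continuous; apply/derivable1_diffP; exact: ex_derive.
  have Ca : {within `[0, t], continuous (fun s : R => a * s)}.
    by apply: continuous_subspaceT => s; apply: cvgM; [exact: cvg_cst|exact: cvg_id].
  by move=> s; apply: cvgB; [apply: cvgM; [exact: Ce|exact: CG]|exact: Ca].
have [c cI E] := MVT t0 Du Cu.
have ut : u t <= u 0.
  rewrite -subr_le0 E subr0; apply: mulr_le0_ge0; last exact: ltW.
  move: cI; rewrite in_itv/= => /andP[c0 _].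
  have hc : h c - b * G c <= a by rewrite lerBlDr hG// ltW.
  have e1 : expR (- b * c) <= 1.
    by rewrite -expR0 ler_expR mulNr oppr_le0 mulr_ge0// ltW.
  have e0 : 0 <= expR (- b * c) by exact: expR_ge0.
  have := ler_wpM2l e0 hc; have := ler_wpM2r a0 e1; lra.
move: ut; rewrite /u !mulr0 expR0 mul1r subr0 => ut.
have eE : expR (- b * t) * expR (b * t) = 1 by rewrite -expRD mulNr addNr expR0.
have -> : G t = expR (- b * t) * G t * expR (b * t) by rewrite mulrAC eE mul1r.
by rewrite ler_pM2r ?expR_gt0//; lra.
Qed.

(** The isolated factor x is the mass of the second variable in the quadratic term; the other power
    comes from interpolation with r = 1/2 - p. *)
Lemma powR_three_halves (R : realType) (x p : R) : 0 <= x -> 0 < p ->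
  x `^ (3 / 2 + p) = x * x `^ (1 - (2^-1 - p)).
Proof.
move=> x0 p0; rewrite -(@mulr_powRB1 _ x (3 / 2 + p))//; last by lra.
by congr (_ * _ `^ _); field.
Qed.

Lemma quadratic_constant_le (R : realFieldType) (c n x y z : R) : 0 <= c -> 0 <= n ->
  x <= y * z -> 2 * (n * (16 * c * x)) <= 32 * c * (n * y * z).
Proof. by move=> c0 n0 h; have := ler_wpM2l (mulr_ge0 c0 n0) h; lra. Qed.

Lemma numeric_constants (R : realFieldType) : (32 <= 8 ^+ 2 :> R) /\ (256 <= 8 ^+ 4 :> R).
Proof. by split; lra. Qed.

Lemma rate_constants_le (R : realFieldType) (c n q w : R) : 0 <= c -> 0 <= n -> 0 <= q ->
  256 <= w -> 256 * (c * q) * n <= w * c * n * q.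
Proof.
move=> c0 n0 q0 hw.
by have := ler_wpM2r (mulr_ge0 (mulr_ge0 c0 n0) q0) hw; lra.
Qed.

(** * Moment estimates along a solution *)

Section Solution.
Variables (R : realType) (p b0 eta : R) (phi k dk : R -> R).
Variable F : R -> {finite_measure set R -> \bar R}.
Hypothesis p_gt0 : 0 < p.
Hypothesis p_le : p <= 2^-1.
Hypothesis HK : kernel_assumption phi b0 eta k dk.
Hypothesis eta_ge : 1 + p <= eta.
Hypothesis HF : is_solution phi F.
Let N : R := fine (Nmass (F 0)).
Let E : R := fine (Energy (F 0)).
Local Notation D := (@Rge0 R).
Local Notation Q := (q1 k dk).

Let mD : measurable D.
Proof. exact: measurable_itv. Qed.

Let D0 x : D x -> 0 <= x.
Proof. by rewrite /Rge0/= in_itv/= andbT. Qed.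

Let kb := phi_ext_kernel_bounds HK.
Let B0 := sqr_ge0 b0.
Let b00 : 0 <= b0 := kb_b0 kb.
Let Q1 : 0 <= 1 + Q.
Proof. by rewrite addr_ge0// (kb_q kb). Qed.

Lemma NmassE (mu : {finite_measure set R -> \bar R}) : Nmass mu = mu D.
Proof.
rewrite /Nmass /Mq; under eq_integral do rewrite /powq ltxx andbF powRr0.
by rewrite integral_cst// mul1e.
Qed.

Lemma EnergyE (mu : {finite_measure set R -> \bar R}) :
  Energy mu = (\int[mu]_(x in D) x%:E)%E.
Proof.
rewrite /Energy /Mq; apply: eq_integral => x; rewrite inE => Dx.
by rewrite /powq [_ < 0]ltNge ler01 andbF powRr1// D0.
Qed.

Let N_t t : 0 <= t -> fine (F t D) = N.
Proof.
by move=> t0; have [_ [/(_ t t0)[h _] _]] := HF; rewrite -NmassE h.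
Qed.

Let N_ge0 : 0 <= N.
Proof. by rewrite /N NmassE; exact: fine_ge0. Qed.

Let E_t t : 0 <= t -> \int[F t]_(x in D) x = E.
Proof.
by move=> t0; have [_ [/(_ t t0)[_ h] _]] := HF; rewrite /Rintegral -EnergyE h.
Qed.

Let E_fin t : 0 <= t -> (\int[F t]_(x in D) x%:E < +oo)%E.
Proof.
move=> t0; have [/(_ t t0)[_ h] _] := HF; apply: le_lt_trans h.
apply: ge0_le_integral_nomeas => x /D0 x0; first by rewrite lee_fin.
by rewrite lee_fin lerDr.
Qed.

Lemma tfun_integral_fin (mu : {finite_measure set R -> \bar R}) (e : R) : 0 < e ->
  (\int[mu]_(x in D) (tfun p e x)%:E < +oo)%E.
Proof.
move=> e0; apply: (@le_lt_trans _ _ (\int[mu]_(x in D) (e `^ (- p))%:E)%E).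
  apply: ge0_le_integral_nomeas => x /D0 x0; first by rewrite lee_fin tfun_ge0.
  by rewrite lee_fin; apply: powR_shift_le => //; exact: ltW.
rewrite integral_cst// lte_mul_pinfty// ?lee_fin ?powR_ge0//.
by rewrite -ge0_fin_numE// fin_num_measure.
Qed.

Lemma cubic_term_le t e : 0 <= t -> 0 < e ->
  \int[((F t \x F t) \x F t)%E]_(w in (D `*` D) `*` D) Kop phi (tfun p e) w.1.1 w.1.2 w.2
  <= 256 * (b0 ^+ 2 * (1 + Q)) * N ^+ 2 * \int[F t]_(x in D) tfun p e x.
Proof.
move=> t0 e0.
have KE x y z : Kop phi (tfun p e) x y z = Kop (phi_ext phi) (tfun p e) x y z.
  by rewrite /Kop W_phi_ext.
have tf := tfun_test_function p_gt0 p_le e0.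
have := @symmetrized_integral_le _ _ _ (F t) D (Kop phi (tfun p e)) (tfun p e)
  (512 * (b0 ^+ 2 * (1 + Q))) mD.
rewrite N_t// => H.
have -> : 256 * (b0 ^+ 2 * (1 + Q)) * N ^+ 2 * \int[F t]_(x in D) tfun p e x =
  512 * (b0 ^+ 2 * (1 + Q)) / 2 * (N ^+ 2 * \int[F t]_(x in D) tfun p e x) by field.
apply: H.
- rewrite (_ : (fun w => _) = (fun w : R * R * R =>
    W (phi_ext phi) w.1.1 w.1.2 w.2 * (tfun p e w.1.1 + tfun p e (xstar w.1.1 w.1.2 w.2) -
      tfun p e w.1.2 - tfun p e w.2))); last by apply/funext => w; rewrite KE.
  have m1 : measurable_fun setT (fun w : R * R * R => w.1.1).
    exact: (measurableT_comp measurable_fst measurable_fst).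
  have m2 : measurable_fun setT (fun w : R * R * R => w.1.2).
    exact: (measurableT_comp measurable_snd measurable_fst).
  have m3 : measurable_fun setT (fun w : R * R * R => w.2) by exact: measurable_snd.
  have mt := measurable_tfun p e.
  apply: measurable_funM; first exact: (measurable_W kb).
  apply: measurable_funB; last exact: (measurableT_comp mt m3).
  apply: measurable_funB; last exact: (measurableT_comp mt m2).
  apply: measurable_funD; first exact: (measurableT_comp mt m1).
  apply: (measurableT_comp mt); apply: measurable_pos_part.
  by apply: measurable_funB => //; exact: measurable_funD.
- exact: measurable_tfun.
- by move=> x _; exact: tfun_ge0.
- exact: tfun_integral_fin.
- by apply: mulr_ge0; [exact: ler0n|exact: mulr_ge0].
- move=> x y z /D0 x0 /D0 y0 /D0 z0; rewrite !KE.
  exact: (Ksym_le kb tf x0 y0 z0).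
Qed.

(** Subadditivity splits (y + z)^(1/2-p) into two equal moments, whence 2 * 16 = 32, and each is
    interpolated between mass and energy. *)
Lemma quadratic_term_le t e : 0 <= t -> 0 < e ->
  \int[(F t \x F t)%E]_(w in D `*` D) Jop phi (tfun p e) w.1 w.2
  <= 32 * b0 ^+ 2 * (N `^ (3 / 2 + p) * E `^ (2^-1 - p)).
Proof.
move=> t0 e0.
have JE y z : Jop phi (tfun p e) y z = Jop (phi_ext phi) (tfun p e) y z.
  by rewrite /Jop; congr (_ * _); apply: eq_Rintegral => x _; rewrite /Kop W_phi_ext.
pose r := 2^-1 - p.
have r01 : 0 <= r < 1 by rewrite /r; have := p_gt0; have := p_le; lra.
pose g x := 16 * b0 ^+ 2 * x `^ r.
have c0 : 0 <= 16 * b0 ^+ 2 by rewrite mulr_ge0.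
have g0 x : D x -> 0 <= g x by move=> _; rewrite mulr_ge0// powR_ge0.
have mp : measurable_fun [set: R] (fun x : R => x `^ r) by exact: measurable_powR.
have mg : measurable_fun setT g.
  by apply: measurable_funM => //; exact: measurable_cst.
have I := moment_interpolation r01 (E_fin t0); rewrite E_t// N_t// in I.
have I0 : (0 <= \int[F t]_(x in D) (x `^ r)%:E)%E.
  by apply: integral_ge0 => x _; rewrite lee_fin powR_ge0.
have If : (\int[F t]_(x in D) (x `^ r)%:E)%E \is a fin_num.
  by rewrite ge0_fin_numE//; apply: (le_lt_trans I); rewrite ltry.
have gE : (\int[F t]_(x in D) (g x)%:E = (16 * b0 ^+ 2)%:E * \int[F t]_(x in D) (x `^ r)%:E)%E.
  under eq_integral do rewrite EFinM.
  rewrite ge0_integralZl_EFin//.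
  - by move=> x _; rewrite lee_fin powR_ge0.
  - by apply/measurable_EFinP; exact: measurable_funTS.
have gi : (\int[F t]_(x in D) (g x)%:E < +oo)%E.
  by rewrite gE -(fineK If) -EFinM ltry.
have PE := integral_prod_sum mD mg g0 gi; rewrite N_t// in PE.
apply: (@le_trans _ _ (\int[(F t \x F t)%E]_(w in D `*` D) (g w.1 + g w.2))).
  apply: le_Rintegral_nomeas.
  - by move=> w [h1 h2]; rewrite addr_ge0// g0.
  - move=> w [/D0 h1 /D0 h2]; rewrite JE.
    apply: (le_trans (Jop_le kb p_gt0 p_le e0 h1 h2)).
    by rewrite -mulrDr ler_wpM2l// powR_subadd//; case/andP: r01 => _ /ltW.
  - by rewrite PE ltry.
rewrite /Rintegral PE /=.
have -> : \int[F t]_(x in D) g x = 16 * b0 ^+ 2 * fine (\int[F t]_(x in D) (x `^ r)%:E)%E.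
  by rewrite /Rintegral gE -[in LHS](fineK If) -EFinM.
have I' : fine (\int[F t]_(x in D) (x `^ r)%:E)%E <= N `^ (1 - r) * E `^ r.
  by rewrite -lee_fin fineK.
have -> : N `^ (3 / 2 + p) = N * N `^ (1 - r) by rewrite /r powR_three_halves.
exact: quadratic_constant_le.
Qed.

Let a : R := 8 ^+ 2 * b0 ^+ 2 * N `^ (3 / 2 + p) * E `^ (2^-1 - p)
           + 8 `^ (2 + eta) * b0 ^+ 2 * N ^+ 3.
Let b : R := 8 `^ (3 + eta) * b0 ^+ 2 * N ^+ 2 * (1 + Q).

Lemma a_ge0 : 0 <= a.
Proof. by rewrite /a addr_ge0// !mulr_ge0 ?powR_ge0. Qed.

Lemma b_ge0 : 0 <= b.
Proof. by rewrite /b !mulr_ge0 ?powR_ge0. Qed.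

Lemma tfun_moment_le t e : 0 <= t -> 0 < e ->
  \int[F t]_(x in D) tfun p e x <=
    (a * t + \int[F 0]_(x in D) tfun p e x) * expR (b * t).
Proof.
move=> t0 e0; move: t t0.
have [_ [_ /(_ _ (tfun_C11b p_gt0 e0))[dG _]]] := HF.
apply: (gronwall_within a_ge0 b_ge0 dG) => t t0 /=.
have hJ := quadratic_term_le t0 e0; have hK := cubic_term_le t0 e0.
apply: (le_trans (lerD hJ hK)).
have G0 : 0 <= \int[F t]_(x in D) tfun p e x by apply: Rintegral_ge0 => x _; exact: tfun_ge0.
apply: lerD.
  rewrite /a -[leLHS]addr0 lerD//; last by rewrite !mulr_ge0 ?powR_ge0.
  rewrite !mulrA; apply: ler_wpM2r; first exact: powR_ge0.
  apply: ler_wpM2r; first exact: powR_ge0.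
  do 2! apply: ler_wpM2r => //.
  exact: (proj1 (numeric_constants R)).
rewrite ler_wpM2r// /b.
(* The rate 256 fits because 256 <= 8^4 and 3 + eta >= 4. *)
have h8 : 256 <= 8 `^ (3 + eta).
  apply: (@le_trans _ _ (8 `^ 4%:R)); first by rewrite powR_mulrn//; exact: (proj2 (numeric_constants R)).
  apply: ler_powR; first by rewrite ler1n.
  rewrite (_ : 4%:R = 3 + 1 :> R); last by rewrite natr1.
  by rewrite lerD2l; apply: le_trans eta_ge; rewrite lerDl ltW.
by apply: rate_constants_le => //; exact: sqr_ge0.
Qed.

Lemma tfun_le_powq e x : 0 < e -> 0 <= x -> ((tfun p e x)%:E <= powq (- p) x)%E.
Proof.
move=> e0 x0; rewrite /powq; case: ifP => [_|]; first by rewrite leey.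
rewrite oppr_lt0 p_gt0 andbT => /negbT xn0.
by rewrite lee_fin; apply: powR_decr; [rewrite lt0r xn0|rewrite lerDl ltW|exact: ltW].
Qed.

(** At x = 0 the values (n + 1)^p diverge, in agreement with 0^(-p) = +oo; elsewhere the power is
    continuous. *)
Lemma powq_le_lim x : 0 <= x ->
  (powq (- p) x <= limn (fun n => (tfun p (n.+1%:R)^-1 x)%:E))%E.
Proof.
move=> x0; rewrite /powq oppr_lt0 p_gt0 andbT.
have [->|xn0] := eqVneq x 0.
  suff -> : limn (fun n => (tfun p (n.+1%:R)^-1 0)%:E) = +oo%E by [].
  apply: cvg_lim => //; apply/cvgeyPge => A.
  near=> n; rewrite lee_fin /tfun add0r.
  have n0 : 0 <= n.+1%:R :> R by [].
  rewrite -[(n.+1%:R)^-1]powR_inv1// -powRrM mulN1r opprK.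
  (* |A|^(1/p) is the rank beyond which (n + 1)^p exceeds A. *)
  apply: (@le_trans _ _ ((`|A| `^ p^-1) `^ p)).
    by rewrite -powRrM mulVf ?gt_eqF// powRr1// ler_norm.
  apply: ge0_ler_powR; rewrite ?nnegrE ?powR_ge0 ?(ltW p_gt0)//.
  apply: (@le_trans _ _ n%:R); last by rewrite ler_nat.
  by near: n; exact: nbhs_infty_ger.
have xp : 0 < x by rewrite lt0r xn0.
suff -> : limn (fun n => (tfun p (n.+1%:R)^-1 x)%:E) = (x `^ (- p))%:E by [].
apply: cvg_lim => //; apply: cvg_EFin; first by near=> n.
have c : {for x, continuous (fun y : R => y `^ (- p))}.
  have dx : derivable (fun y : R => y `^ (- p)) x 1.
    by apply: derivable_powR; rewrite in_itv/= xp.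
  by apply: differentiable_continuous; apply/derivable1_diffP.
have cx : (x + n.+1%:R^-1) @[n --> \oo] --> x.
  rewrite -[X in _ --> X]addr0; apply: cvgD; first exact: cvg_cst.
  exact: (@cvg_harmonic R).
exact: (cvg_comp _ _ cx c).
Unshelve. all: by end_near.
Qed.

Lemma Mq_le t : 0 <= t -> (Mq (- p) (F 0) < +oo)%E ->
  (Mq (- p) (F t) <= ((a * t)%:E + Mq (- p) (F 0)) * (expR (b * t))%:E)%E.
Proof.
move=> t0 M0oo.
have M0ge : (0 <= Mq (- p) (F 0))%E.
  apply: integral_ge0 => x /D0 x0; rewrite /powq; case: ifP => _ //.
  by rewrite lee_fin powR_ge0.
have M0f : Mq (- p) (F 0) \is a fin_num by rewrite ge0_fin_numE.
have e_gt0 n : 0 < (n.+1%:R)^-1 :> R by rewrite invr_gt0.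
pose g' n x := (tfun p (n.+1%:R)^-1 x)%:E : \bar R.
have GE s n : (\int[F s]_(x in D) g' n x = (\int[F s]_(x in D) tfun p (n.+1%:R)^-1 x)%:E)%E.
  rewrite /Rintegral fineK// ge0_fin_numE; first exact: tfun_integral_fin.
  by apply: integral_ge0 => x _; rewrite lee_fin tfun_ge0.
have nd x : D x -> {homo g'^~ x : n m / (n <= m)%N >-> (n <= m)%E}.
  move=> /D0 x0 n m nm; rewrite lee_fin /tfun; apply: powR_decr; last exact: ltW.
    by rewrite ltr_wpDl.
  by rewrite lerD2l lef_pV2 ?posrE// ler_nat.
have mg' n : measurable_fun D (g' n).
  by apply/measurable_EFinP; apply: measurable_funTS; exact: measurable_tfun.
have g'0 n x : D x -> (0 <= g' n x)%E by rewrite lee_fin tfun_ge0.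
have C := cvg_monotone_convergence (mu := F t) mD mg' g'0 nd.
apply: (@le_trans _ _ (\int[F t]_(x in D) limn (g'^~ x))%E).
  apply: ge0_le_integral_nomeas => x /D0 x0; last exact: powq_le_lim.
  by rewrite /powq; case: ifP => _ //; rewrite lee_fin powR_ge0.
rewrite -(cvg_lim _ C)//; apply: lime_le; first by apply/cvg_ex; eexists; exact: C.
near=> n; rewrite GE -(fineK M0f) -EFinD -EFinM lee_fin.
apply: (le_trans (tfun_moment_le t0 (e_gt0 n))).
(* The initial moment of every [tfun] is below that of x^(-p), which makes the bound uniform in
   n. *)
rewrite ler_pM2r ?expR_gt0// lerD2l -lee_fin -GE fineK//.
apply: ge0_le_integral_nomeas => x /D0 x0; first by rewrite lee_fin tfun_ge0.
exact: tfun_le_powq.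
Unshelve. all: by end_near.
Qed.

End Solution.

Theorem theorem2p1 (R : realType) (p b0 eta : R) (phi k dk : R -> R)
    (F : R -> {finite_measure set R -> \bar R}) :
  0 < p <= 2^-1 ->
  kernel_assumption phi b0 eta k dk ->
  1 + p <= eta ->
  (Mq (- p)%R (F 0%R) < +oo)%E ->
  is_solution phi F ->
  let N := fine (Nmass (F 0)) in
  let E := fine (Energy (F 0)) in
  let a := 8 ^+ 2 * b0 ^+ 2 * N `^ (3 / 2 + p) * E `^ (2^-1 - p)
           + 8 `^ (2 + eta) * b0 ^+ 2 * N ^+ 3 in
  let b := 8 `^ (3 + eta) * b0 ^+ 2 * N ^+ 2 * (1 + q1 k dk) in
  (forall t, 0 < t -> (Mq (- p)%R (F t) < +oo)%E) /\
  (forall t, 0 <= t ->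
     (Mq (- p)%R (F t) <= ((a * t)%:E + Mq (- p)%R (F 0%R)) * (expR (b * t))%:E)%E).
Proof.
move=> /andP[p0 p1] HK eta1 M0 HF N E a b.
have H t : 0 <= t ->
  (Mq (- p)%R (F t) <= ((a * t)%:E + Mq (- p)%R (F 0%R)) * (expR (b * t))%:E)%E.
  by move=> t0; exact: (Mq_le p0 p1 HK eta1 HF t0 M0).
split=> // t t0; apply: (le_lt_trans (H t (ltW t0))).
have M0ge : (0 <= Mq (- p)%R (F 0%R))%E.
  apply: integral_ge0 => x _; rewrite /powq; case: ifP => _ //.
  by rewrite lee_fin powR_ge0.
have M0f : Mq (- p)%R (F 0%R) \is a fin_num by rewrite ge0_fin_numE.
by rewrite -(fineK M0f) -EFinD -EFinM ltry.
Qed.
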